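(* Let $\alpha\in(0,1)$ and let $\beta$ be an even integer with $\alpha\beta>1+\frac\pi2$. Let $\varphi(t)=\sum_{n=0}^\infty\alpha^n\cos(\beta^n\pi t)$ be the Weierstraß function, and let $\nu=-\frac{\log\alpha}{\log\beta}$. Let $H(t)=\xi_{\varphi(t)}\xi_{\varphi(t)}^T$ for $t\in(0,1)$, and let $\kappa_H$ be the function produced by the algorithm with a fixed constant $c>0$. Then \[ \log\Bigl(\max_{|z|=r}\|W_H(1;z)\|\Bigr)\asymp r^{\frac1{1+\nu}}\asymp\kappa_H(r),\qquad r>1, \] and \[ 0<\limsup_{r\to\infty}\frac{n_H(r)}{r^{1/(1+\nu)}}<\infty . \]
   Context: Notation: $\xi_\phi=(\cos\phi,\sin\phi)^T$, $J=\begin{pmatrix}0&-1\\1&0\end{pmatrix}$, and $\Omega(s,t)=\int_s^tH$. Fundamental solution: $W_H(t;z)$ solves $\partial_tW_H(t;z)J=zW_H(t;z)H(t)$ with $W_H(0;z)=I$ on $[0,1]$; $W_H(1;\cdot)$ is the monodromy matrix. Counting function: $n_H(r)=\#\{\lambda\in\sigma_H:|\lambda|<r\}$, where $\sigma_H$ is the (discrete, simple) spectrum of the self-adjoint operator part of the relation $A_H$. Here $A_H$ consists of pairs $(f,g)$ in $L^2(H)$ such that $f$ is absolutely continuous with $f'=JHg$ a.e., $(1,0)f(0)=0$ and $(0,1)f(1)=0$. $L^2(H)$ is the closed subspace of $L^2(H(t)dt)$ of functions $f$ such that $\xi_\phi^Tf$ is a.e. constant on every interval where $H=\xi_\phi\xi_\phi^T$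 a.e. Algorithm for $\kappa_H$ (constant $c$): for $r>0$ set $\sigma_0=0$. Recursively: - if $\det\Omega(\sigma_{j-1},1)>c/r^2$, let $\sigma_j\in(\sigma_{j-1},1)$ be the unique point with $\det\Omega(\sigma_{j-1},\sigma_j)=c/r^2$; - otherwise $\sigma_j=1$, $\kappa_H(r)=j$, and stop. Asymptotic notation: $\asymp$ means two-sided bounds with positive constants. *)

(* Defs.v *)
From HB Require Import structures.
From mathcomp Require Import all_boot all_order all_algebra.
From mathcomp Require Import all_classical all_reals all_analysis.
From mathcomp Require Import finmap.
Set Implicit Arguments. Unset Strict Implicit. Unset Printing Implicit Defensive.
Import Order.TTheory GRing.Theory Num.Theory.
Import numFieldNormedType.Exports.
Local Open Scope classical_set_scope.
Local Open Scope ring_scope.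

Section Defs.
Variable R : realType.

Definition rint (a b : R) (f : R -> R) : R :=
  Rintegral (@lebesgue_measure R) `[a, b] f.

Definition mxint (m n : nat) (a b : R) (F : R -> 'M[R]_(m, n)) : 'M[R]_(m, n) :=
  \matrix_(i, j) rint a b (fun s => F s i j).

Definition Jmx : 'M[R]_2 :=
  \matrix_(i < 2, j < 2)
    (if (i == 0%N :> nat) && (j == 1%N :> nat) then -1
     else if (i == 1%N :> nat) && (j == 0%N :> nat) then 1 else 0).

Definition xi (p : R) : 'cV[R]_2 :=
  \col_(i < 2) (if i == 0%N :> nat then cos p else sin p).

Definition weierstrass (alpha : R) (beta : nat) (t : R) : R :=
  limn (series (fun n : nat => alpha ^+ n * cos ((beta ^ n)%:R * pi * t))).

Definition Hamiltonian (phi : R -> R) (t : R) : 'M[R]_2 :=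
  xi (phi t) *m (xi (phi t))^T.

Definition Omega (H : R -> 'M[R]_2) (s t : R) : 'M[R]_2 := mxint s t H.

(* The fundamental solution, encoded via real and imaginary parts:
   for z = x + i y, W_H(t;z) = Wr x y t + i * Wi x y t, where W_H solves
   d/dt W J = z W H, W(0) = I, i.e. (integral form, J^{-1} = -J)
   W(t) = I - z int_0^t W H J.  Continuity in t makes the integral meaningful. *)
Definition is_fundamental_solution (H : R -> 'M[R]_2)
    (Wr Wi : R -> R -> R -> 'M[R]_2) : Prop :=
  forall x y : R,
    (forall i j, {within `[0, 1], continuous (fun t => Wr x y t i j)}) /\
    (forall i j, {within `[0, 1], continuous (fun t => Wi x y t i j)}) /\
    forall t, 0 <= t <= 1 ->
      Wr x y t = 1%:M - mxint 0 t (fun s => (x *: Wr x y s - y *: Wi x y s) *m H s *m Jmx)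
   /\ Wi x y t = - mxint 0 t (fun s => (x *: Wi x y s + y *: Wr x y s) *m H s *m Jmx).

Definition cmx_norm (A B : 'M[R]_2) : R :=
  Num.sqrt (\sum_(i < 2) \sum_(j < 2) (A i j ^+ 2 + B i j ^+ 2)).

Definition max_monodromy (Wr Wi : R -> R -> R -> 'M[R]_2) (r : R) : R :=
  sup [set v : R | exists x y : R,
         x ^+ 2 + y ^+ 2 = r ^+ 2 /\ v = cmx_norm (Wr x y 1) (Wi x y 1)].

(* lambda is an eigenvalue of A_H: there is (f, lambda f) in A_H with f <> 0
   in L^2(H).  f absolutely continuous with f' = lambda J H f a.e. is written
   in integral form with f continuous; (1,0) f(0) = 0, (0,1) f(1) = 0. *)
Definition is_eigenvalue (H : R -> 'M[R]_2) (lam : R) : Prop :=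
  exists f : R -> 'cV[R]_2,
    (forall i, {within `[0, 1], continuous (fun t => f t i 0)}) /\
    (forall t, 0 <= t <= 1 ->
       f t = f 0 + lam *: mxint 0 t (fun s => Jmx *m H s *m f s)) /\
    f 0 ord0 0 = 0 /\ f 1 ord_max 0 = 0 /\
    0 < rint 0 1 (fun t => ((f t)^T *m H t *m f t) 0 0).

Definition n_count (H : R -> 'M[R]_2) (r : R) : nat :=
  #|` fset_set [set lam : R | is_eigenvalue H lam /\ `|lam| < r] |%fset.

Definition kappa_spec (H : R -> 'M[R]_2) (c r : R) (j : nat) : Prop :=
  (0 < j)%N /\
  exists sigma : nat -> R,
    sigma 0%N = 0 /\ sigma j = 1 /\
    (forall i : nat, (0 < i < j)%N ->
       c / r ^+ 2 < \det (Omega H (sigma i.-1) 1) /\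
       sigma i.-1 < sigma i < 1 /\
       \det (Omega H (sigma i.-1) (sigma i)) = c / r ^+ 2) /\
    \det (Omega H (sigma j.-1) 1) <= c / r ^+ 2.
End Defs.

(* Main.v *)
(** Write [b] for [beta], [S n] for the [n]-th partial sum of the Weierstrass function [phi],
    and [rho = b / a], so that [rho ^ (1 / (1 + nu)) = b]; all three quantities are shown to be
    of order [b ^ n] when [r] is of order [rho ^ n].  Since [phi t = S n t + a ^ n phi (b ^ n t)],
    on each of the [b ^ n] cells of length [b ^ - n] the function [phi] varies by an amount of
    order [a ^ n]: by at most [C a ^ n], and between the end points by at least
    [(2 - pi / (a b - 1)) a ^ n], with alternating sign because [beta] is even.

    - Over a cell [det Omega] is of order [(a / b) ^ 2n = rho ^ - 2n], which gives [kappa].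
    - In the frame rotating with [S n], the energy [u ^ 2 + a ^ 2n v ^ 2] of a row [(u, v)] of [W]
      grows at rate [O (b ^ n)] for [|z| <= rho ^ (n + 1)]: upper bound for the monodromy matrix.
    - For [z = i r] the combination [f = W_1 + i W_2] of the rows of [W] has [det (Re f, Im f)]
      nondecreasing, growing by a fixed factor over each cell: lower bound.
    - Eigenvalues correspond to the multiples of [pi] taken by the Pruefer angle [th] of a real
      solution at [1], which is increasing in the spectral parameter [lam].  The rotating frame
      bounds this angle by [O (b ^ n)] for [|lam| <= rho ^ (n + 1)].  Conversely, for
      [lam = K rho ^ n] the angle is carried, near every node, from just above one stationary
      angle [phi + pi / 2] modulo [pi] to just below the next one; as [phi] goes down and up over
      two consecutive cells, the angle gains [pi] every two cells. *)
Require Import Defs.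
From HB Require Import structures.
From mathcomp Require Import all_boot all_order all_algebra.
From mathcomp Require Import all_classical all_reals all_analysis.
From mathcomp Require Import ring lra.
Import Order.TTheory GRing.Theory Num.Theory.
Import numFieldNormedType.Exports.
Local Open Scope classical_set_scope.
Local Open Scope ring_scope.
Set Implicit Arguments. Unset Strict Implicit. Unset Printing Implicit Defensive.

(** * Calculus on a segment *)

Section Calculus.
Context {R : realType}.
Implicit Types (a b t : R) (f g df dg : R -> R).

(** No derivative of [phi] is available: it enters only through its oscillation, or through a smooth
    partial sum. The weight [a ^ n] in the rotating frame balances two effects. In that frame the
    direction of [H] is [(cos del, sin del)] with [sin del = O (a ^ n)], so the term carrying [z]
    acts at rate [a ^ n |z| = O (b ^ n)]; the rotation of the frame, of speed [O ((a b) ^ n)], is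
    divided by [a ^ n] and is [O (b ^ n)] as well. The hypothesis on [a b] says
    [pi / (a b - 1) < 2]: the jump [2 a ^ n] of the tail [a ^ n phi (b ^ n t)] between neighbouring
    nodes beats the variation of [S n]. All later estimates use only the record [fractal], whose
    constants do not depend on the level, so that one argument at level [n] serves all scales. For
    the upper limit of the counting function, an upper bound for every [r] and a lower bound along
    [r = 2 K rho ^ n] suffice, and positive eigenvalues alone already give the latter. *)

Definition wcont a b f := {within `[a, b], continuous f}.

(** Continuity up to the end points and a derivative inside: what the mean value theorem asks for,
    and what the integral of a continuous function provides. *)
Definition smooth a b f df :=
  wcont a b f /\ forall t, a < t < b -> is_derive t 1 f (df t).

Lemma wcont_sub a b a' b' f : a <= a' -> b' <= b -> wcont a b f -> wcont a' b' f.
Proof.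
move=> aa bb; apply: continuous_subspaceW => x /=.
by rewrite !in_itv/= => /andP[? ?]; apply/andP; split; lra.
Qed.

Lemma wcont_ext a b f g : (forall t, a <= t <= b -> f t = g t) -> wcont a b f -> wcont a b g.
Proof.
move=> fg; rewrite /wcont; apply: subspace_eq_continuous => x xab.
by apply: fg; move: xab; rewrite inE/= in_itv.
Qed.

Lemma wcont_cst a b (c : R) : wcont a b (fun=> c).
Proof. by apply: continuous_subspaceT => x; exact: cvg_cst. Qed.

Lemma wcont_id a b : wcont a b (fun t => t).
Proof. by apply: continuous_subspaceT => x; exact: cvg_id. Qed.

Lemma wcont_add a b f g : wcont a b f -> wcont a b g -> wcont a b (fun t => f t + g t).
Proof. by move=> cf cg x; apply: continuousD; [exact: cf|exact: cg]. Qed.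

Lemma wcont_opp a b f : wcont a b f -> wcont a b (fun t => - f t).
Proof. by move=> cf x; apply: continuousN; exact: cf. Qed.

Lemma wcont_mul a b f g : wcont a b f -> wcont a b g -> wcont a b (fun t => f t * g t).
Proof. by move=> cf cg x; apply: continuousM; [exact: cf|exact: cg]. Qed.

Lemma wcont_exp a b f n : wcont a b f -> wcont a b (fun t => f t ^+ n).
Proof.
move=> cf; elim: n => [|n IH].
  by apply: (@wcont_ext _ _ (fun=> 1)) => [t _|]; [rewrite expr0|exact: wcont_cst].
apply: (@wcont_ext _ _ (fun t => f t * f t ^+ n)) => [t _|]; first by rewrite exprS.
exact: wcont_mul.
Qed.

Lemma wcont_inv a b f : (forall t, a <= t <= b -> f t != 0) ->
  wcont a b f -> wcont a b (fun t => (f t)^-1).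
Proof.
move=> f0 cf; apply/subspace_continuousP => x /= xab.
move/subspace_continuousP: cf => /(_ x xab) cf; apply: cvgV => //.
by apply: f0; move: xab; rewrite in_itv.
Qed.

Lemma wcont_comp a b f (g : R -> R) : continuous g -> wcont a b f ->
  wcont a b (fun t => g (f t)).
Proof. by move=> cg cf x; apply: continuous_comp; [exact: cf|exact: cg]. Qed.

Lemma wcont_continuous a b f : continuous f -> wcont a b f.
Proof. exact: continuous_subspaceT. Qed.

Lemma smooth_sub a b a' b' f df : a <= a' -> b' <= b ->
  smooth a b f df -> smooth a' b' f df.
Proof.
move=> aa bb [cf hf]; split; first exact: wcont_sub cf.
by move=> t /andP[? ?]; apply: hf; lra.
Qed.

Lemma smooth_eq a b f df df' : (forall t, a < t < b -> df t = df' t) ->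
  smooth a b f df -> smooth a b f df'.
Proof. by move=> e [cf hf]; split => // t tab; rewrite -e//; exact: hf. Qed.

Lemma smooth_cst a b (c : R) : smooth a b (fun=> c) (fun=> 0).
Proof. by split=> [|t _]; [exact: wcont_cst|exact: is_derive_cst]. Qed.

Lemma smooth_id a b : smooth a b (fun t => t) (fun=> 1).
Proof. by split=> [|t _]; [exact: wcont_id|exact: is_derive_id]. Qed.

Lemma smooth_add a b f g df dg : smooth a b f df -> smooth a b g dg ->
  smooth a b (fun t => f t + g t) (fun t => df t + dg t).
Proof.
move=> [cf hf] [cg hg]; split=> [|t tab]; first exact: wcont_add.
by apply: is_deriveD; [exact: hf|exact: hg].
Qed.

Lemma smooth_opp a b f df : smooth a b f df -> smooth a b (fun t => - f t) (fun t => - df t).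
Proof.
move=> [cf hf]; split=> [|t tab]; first exact: wcont_opp.
by apply: is_deriveN; exact: hf.
Qed.

Lemma smooth_mul a b f g df dg : smooth a b f df -> smooth a b g dg ->
  smooth a b (fun t => f t * g t) (fun t => df t * g t + f t * dg t).
Proof.
move=> [cf hf] [cg hg]; split=> [|t tab]; first exact: wcont_mul.
apply: (@is_derive_eq _ _ _ _ _ _ _ _ (is_deriveM (hf _ tab) (hg _ tab))).
by rewrite /GRing.scale /= addrC mulrC.
Qed.

Lemma smooth_sqr a b f df : smooth a b f df ->
  smooth a b (fun t => f t ^+ 2) (fun t => 2 * f t * df t).
Proof.
move=> sf; rewrite (_ : (fun t => f t ^+ 2) = (fun t => f t * f t)); last first.
  by apply: funext => t; rewrite expr2.
by apply: smooth_eq (smooth_mul sf sf) => t _; ring.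
Qed.

Lemma smooth_inv a b f df : (forall t, a <= t <= b -> f t != 0) ->
  smooth a b f df -> smooth a b (fun t => (f t)^-1) (fun t => - df t / f t ^+ 2).
Proof.
move=> f0 [cf hf]; split=> [|t tab]; first exact: wcont_inv.
have h0 : f t != 0 by apply: f0; lra.
apply: (@is_derive_eq _ _ _ _ _ _ _ _ (is_deriveV h0 (hf _ tab))).
by rewrite /GRing.scale /= !mulNr mulrC.
Qed.

Lemma smooth_comp a b f df (g dg : R -> R) : (forall x : R, is_derive x 1 g (dg x)) ->
  smooth a b f df -> smooth a b (fun t => g (f t)) (fun t => dg (f t) * df t).
Proof.
move=> hg [cf hf]; split=> [|t tab].
  apply: wcont_comp cf => x; apply: differentiable_continuous.
  by apply/derivable1_diffP; case: (hg x).
exact: (is_derive1_comp (g := f) (f := g)) (hg _) (hf _ tab).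
Qed.

Lemma smooth_sin a b f df : smooth a b f df ->
  smooth a b (fun t => sin (f t)) (fun t => cos (f t) * df t).
Proof. exact: smooth_comp. Qed.

Lemma smooth_cos a b f df : smooth a b f df ->
  smooth a b (fun t => cos (f t)) (fun t => - sin (f t) * df t).
Proof. by apply: (smooth_comp (dg := fun x => - sin x)). Qed.

Lemma smooth_expR a b f df : smooth a b f df ->
  smooth a b (fun t => expR (f t)) (fun t => expR (f t) * df t).
Proof. exact: smooth_comp. Qed.

Lemma smooth_le a b f df : a <= b -> smooth a b f df ->
  (forall t, a < t < b -> 0 <= df t) -> f a <= f b.
Proof.
rewrite le_eqVlt => /predU1P[->//|ab] [cf hf] df0.
have hf' x : x \in `]a, b[ -> is_derive x 1 f (df x) by rewrite in_itv; exact: hf.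
have [c] := MVT ab hf' cf; rewrite in_itv/= => cab e.
by rewrite -subr_ge0 e mulr_ge0 ?df0 ?subr_ge0 ?ltW.
Qed.

Lemma smooth_const a b f df : a <= b -> smooth a b f df ->
  (forall t, a < t < b -> df t = 0) -> f a = f b.
Proof.
move=> ab sf df0; apply/eqP; rewrite eq_le (smooth_le ab sf) => [|t /df0->//].
rewrite -lerN2 (smooth_le ab (smooth_opp sf)) => [//|t /df0->].
by rewrite oppr0.
Qed.

Lemma smooth_lip a b f df (M : R) : a <= b -> smooth a b f df ->
  (forall t, a < t < b -> `|df t| <= M) -> `|f b - f a| <= M * (b - a).
Proof.
move=> ab sf dfM.
have s1 := smooth_mul (smooth_cst a b M) (smooth_id a b).
have h1 := smooth_le ab (smooth_add s1 sf).
have h2 := smooth_le ab (smooth_add s1 (smooth_opp sf)).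
have {}h1 : M * a + f a <= M * b + f b.
  by apply: h1 => t /dfM; rewrite ler_norml => /andP[? ?]; lra.
have {}h2 : M * a - f a <= M * b - f b.
  by apply: h2 => t /dfM; rewrite ler_norml => /andP[? ?]; lra.
by rewrite ler_norml; apply/andP; split; lra.
Qed.

End Calculus.

(** * Integrals of continuous functions and their primitives *)

Section RInt.
Context {R : realType}.
Implicit Types (a b t c : R) (f g : R -> R).

Lemma wcont_integrable a b f : wcont a b f ->
  (@lebesgue_measure R).-integrable `[a, b] (EFin \o f).
Proof. by move=> cf; apply: continuous_compact_integrable => //; exact: segment_compact. Qed.

Lemma wcont_at a b f t : wcont a b f -> a < t < b -> {for t, continuous f}.
Proof.
move=> cf tab; have ab : a < b by lra.
move/(continuous_within_itvP _ ab) : cf => [cf _ _].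
by apply: cf; rewrite in_itv.
Qed.

Lemma rint_smooth a b f : a <= b -> wcont a b f -> smooth a b (fun t => rint a t f) f.
Proof.
move=> ab cf; split.
  exact: (parameterized_integral_continuous ab (wcont_integrable cf)).
move=> t /andP[a_t tb].
have [] := continuous_FTC1_closed tb (wcont_integrable cf) a_t.
  by apply: (wcont_at cf); rewrite a_t.
move=> dF F'; rewrite -[X in is_derive _ _ _ X]F' derive1E; exact: derivableP.
Qed.

Lemma rint_refl a f : rint a a f = 0.
Proof. by rewrite /rint set_itv1 Rintegral_set1. Qed.

Lemma rint_ext a b f g : (forall t, a <= t <= b -> f t = g t) -> rint a b f = rint a b g.
Proof.
by move=> e; apply: eq_Rintegral => x; rewrite inE/= in_itv/=; exact: e.
Qed.

Lemma rint_eq a b F f : a <= b -> wcont a b f -> smooth a b F f -> rint a b f = F b - F a.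
Proof.
move=> ab cf sF.
have := smooth_const ab
  (smooth_add (rint_smooth ab cf) (smooth_opp sF)).
by rewrite rint_refl => h; have {}h := h (fun t _ => subrr _); lra.
Qed.

Lemma rint_chasles a c b f : a <= c -> c <= b -> wcont a b f ->
  rint a b f = rint a c f + rint c b f.
Proof.
move=> ac cb cf.
have s1 := rint_smooth (le_trans ac cb) cf.
have s2 := smooth_sub ac (lexx _) s1.
by rewrite (rint_eq cb (wcont_sub ac (lexx _) cf) s2) addrC subrK.
Qed.

Lemma rint_le a b f g : a <= b -> wcont a b f -> wcont a b g ->
  (forall t, a <= t <= b -> f t <= g t) -> rint a b f <= rint a b g.
Proof.
move=> ab cf cg fg; apply: le_Rintegral => //; do ?exact: wcont_integrable.
Qed.

Lemma rint_cst a b c : a <= b -> rint a b (fun=> c) = c * (b - a).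
Proof.
move=> ab; rewrite (rint_eq (F := fun t => c * t) ab (@wcont_cst _ a b c)); first by ring.
apply: smooth_eq (smooth_mul (smooth_cst a b c) (smooth_id a b)) => t _.
by rewrite mul0r add0r mulr1.
Qed.

Lemma rint_ge0 a b f : (forall t, a <= t <= b -> 0 <= f t) -> 0 <= rint a b f.
Proof. by move=> f0; apply: Rintegral_ge0 => x /=; rewrite in_itv/=; exact: f0. Qed.

Lemma rint_add a b f g : wcont a b f -> wcont a b g ->
  rint a b (fun t => f t + g t) = rint a b f + rint a b g.
Proof. by move=> cf cg; apply: RintegralD => //; exact: wcont_integrable. Qed.

Lemma rint_scale a b c f : wcont a b f -> rint a b (fun t => c * f t) = c * rint a b f.
Proof. by move=> cf; apply: RintegralZl => //; exact: wcont_integrable. Qed.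

Lemma rint_mono a b s t f : a <= s -> s <= t -> t <= b -> wcont a b f ->
  (forall x, a <= x <= b -> 0 <= f x) -> rint s t f <= rint a b f.
Proof.
move=> as_ st tb cf f0.
have cf1 : wcont s b f by apply: wcont_sub cf => //; lra.
rewrite (@rint_chasles a s b)//; last lra.
rewrite (@rint_chasles s t b)//  addrCA lerDl addr_ge0// rint_ge0// => x ?; apply: f0; lra.
Qed.

(** Turns the integral equations of the definitions into differential ones. The equation holds on
    the segment only, so the derivative of [f] is read off near each interior point. *)
Lemma smooth_of_integral f g (k c : R) : wcont 0 1 g ->
  (forall t, 0 <= t <= 1 -> f t = k + c * rint 0 t g) -> smooth 0 1 f (fun t => c * g t).
Proof.
move=> cg hf.
have [s1 s2] : smooth 0 1 (fun t => k + c * rint 0 t g) (fun t => c * g t).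
  apply: smooth_eq (smooth_add (smooth_cst 0 1 k)
    (smooth_mul (smooth_cst 0 1 c) (rint_smooth ler01 cg))) => t _.
  by rewrite add0r mul0r add0r.
split; first by apply: wcont_ext s1 => t /hf.
move=> t t01; apply: near_eq_is_derive (s2 t t01).
have : nbhs t `]0, 1[%classic by apply: near_in_itvoo; rewrite in_itv.
apply: filterS => z /=; rewrite in_itv/= => /andP[z0 z1]; apply/esym/hf.
by rewrite !ltW.
Qed.

End RInt.

(** * Trigonometric bounds, differential inequalities and polar angles *)

Section Inequalities.
Context {R : realType}.
Implicit Types (a b l r t x y : R) (f df : R -> R).

Lemma smooth_global a b f df : (forall x : R, is_derive x 1 f (df x)) -> smooth a b f df.
Proof.
move=> hf; split=> [|t _]; last exact: hf.
apply: wcont_continuous => x; apply: differentiable_continuous.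
by apply/derivable1_diffP; case: (hf x).
Qed.

Lemma lipschitz1 (g dg : R -> R) x y : (forall x : R, is_derive x 1 g (dg x)) ->
  (forall x, `|dg x| <= 1) -> `|g y - g x| <= `|y - x|.
Proof.
move=> hg h1; wlog xy : x y / x <= y => [H|].
  by case/orP: (le_total x y) => [/H//|/H]; rewrite distrC (distrC x y).
rewrite [`|y - x|]ger0_norm ?subr_ge0// -[y - x]mul1r.
by have := @smooth_lip _ _ _ _ _ 1 xy (smooth_global x y hg); apply => t _.
Qed.

Lemma sin_lip x y : `|sin y - sin x| <= `|y - x|.
Proof. by apply: (lipschitz1 (dg := cos)) => z; exact: cos_max. Qed.

Lemma abs_sin_le x : `|sin x| <= `|x|.
Proof. by have := sin_lip 0 x; rewrite sin0 !subr0. Qed.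

Lemma sqr_sin_le x : sin x ^+ 2 <= x ^+ 2.
Proof. by rewrite -[sin x ^+ 2]real_normK ?num_real// -[x ^+ 2]real_normK ?num_real// lerXn2r ?nnegrE// abs_sin_le. Qed.

Lemma cos_ge_quad x : 1 - x ^+ 2 / 2 <= cos x.
Proof.
have -> : cos x = 1 - 2 * sin (x / 2) ^+ 2.
  by rewrite [in LHS](splitr x) -mulr2n cos_mulr2n cos2sin2 mulr2n; ring.
by have := sqr_sin_le (x / 2); rewrite exprMn; lra.
Qed.

Lemma cos_ge_half x : `|x| <= 1 -> 1 / 2 <= cos x.
Proof.
rewrite ler_norml => /andP[? ?]; have := cos_ge_quad x.
have : x ^+ 2 <= 1 by nra.
lra.
Qed.

Lemma sin_ge_half x : 0 <= x <= 1 -> x / 2 <= sin x.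
Proof.
move=> /andP[x0 x1].
have s := smooth_add (@smooth_global 0 x _ _ (@is_derive_sin R))
  (smooth_opp (smooth_mul (smooth_id 0 x) (smooth_cst 0 x (1 / 2)))).
have := smooth_le x0 s; rewrite sin0 mul0r subr0 => h.
have {}h : 0 <= sin x - x * (1 / 2).
  apply: h => t /andP[? ?]; have := @cos_ge_half t; rewrite ger0_norm; last lra.
  by move=> h; have := h ltac:(lra); lra.
lra.
Qed.

Lemma cos_sqr_lip x y : `|cos y ^+ 2 - cos x ^+ 2| <= `|y - x|.
Proof.
have -> : cos y ^+ 2 - cos x ^+ 2 = - (sin (y + x) * sin (y - x)).
  by rewrite sinD sinB; have := cos2Dsin2 x; have := cos2Dsin2 y; nra.
rewrite normrN normrM -[leRHS]mul1r ler_pM// ?sin_max//.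
exact: abs_sin_le.
Qed.

(** The product [E t * expR (- (C * t))] is nonincreasing. The signs of [E] and [C] are free, so
    lower bounds come from [- E] and [- C]. *)
Lemma gronwall a b E dE (C : R) : a <= b -> smooth a b E dE ->
  (forall t, a < t < b -> dE t <= C * E t) -> E b <= E a * expR (C * (b - a)).
Proof.
move=> ab sE h.
have s1 := smooth_opp (smooth_mul sE (smooth_expR (smooth_opp
  (smooth_mul (smooth_cst a b C) (smooth_id a b))))).
have := smooth_le ab s1 => {}s1.
have {}s1 : E b * expR (- (C * b)) <= E a * expR (- (C * a)).
  rewrite -lerN2; apply: s1 => t tab; have := h _ tab; have := expR_gt0 (- (C * t)).
  set e := expR _ => e0 h1.
  rewrite (_ : - _ = (C * E t - dE t) * e); last by ring.
  by rewrite mulr_ge0 ?subr_ge0// ltW.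
have -> : C * (b - a) = - (C * a) + C * b by ring.
rewrite expRD mulrA -ler_pdivrMr ?expR_gt0// -expRN; exact: s1.
Qed.

(* Gronwall's inequality is applied to [sqrt (D^2 + d^2) - D], a smooth substitute for
   the negative part of [D], and then [d] tends to 0. *)
Lemma comparison a b D dD (M : R) : a <= b -> 0 <= M -> smooth a b D dD -> 0 <= D a ->
  (forall t, a < t < b -> - (M * `|D t|) <= dD t) -> 0 <= D b.
Proof.
move=> ab M0 sD Da h.
suff H (d : R) : 0 < d -> - D b <= d * expR (M * (b - a)).
  rewrite leNgt; apply/negP => Db.
  have e0 := expR_gt0 (M * (b - a)).
  have := H (- D b / 2 / expR (M * (b - a))).
  rewrite divfK ?gt_eqF// !divr_gt0 ?oppr_gt0// => /(_ isT); lra.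
move=> d0.
have N0 t : 0 < D t ^+ 2 + d ^+ 2 by rewrite ltr_wpDl ?sqr_ge0// exprn_gt0.
have sN := smooth_add (smooth_sqr sD) (smooth_cst a b (d ^+ 2)).
have sq : smooth a b (fun t => Num.sqrt (D t ^+ 2 + d ^+ 2))
    (fun t => D t * dD t / Num.sqrt (D t ^+ 2 + d ^+ 2)).
  case: sN => cN hN; split; first by apply: wcont_comp cN => x; exact: sqrt_continuous.
  move=> t tab.
  have := is_derive1_comp (g := fun t => D t ^+ 2 + d ^+ 2) (is_derive1_sqrt (N0 t)) (hN _ tab) => hh.
  apply: (@is_derive_eq _ _ _ _ _ _ _ _ hh) => /=.
  have s0 : Num.sqrt (D t ^+ 2 + d ^+ 2) != 0 by rewrite gt_eqF// sqrtr_gt0 N0.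
  by field.
have sw := smooth_add sq (smooth_opp sD).
have gw := gronwall (C := M) ab sw.
have nD t : D t <= `|D t| <= Num.sqrt (D t ^+ 2 + d ^+ 2).
  by rewrite ler_norm -sqrtr_sqr ler_wsqrtr// lerDl sqr_ge0.
have wb : - D b <= Num.sqrt (D b ^+ 2 + d ^+ 2) - D b.
  by have := sqrtr_ge0 (D b ^+ 2 + d ^+ 2); lra.
apply: (le_trans wb); apply: (le_trans (gw _)) => [t tab|].
  have := h _ tab; have /andP[h1 h2] := nD t.
  have q0 : 0 < Num.sqrt (D t ^+ 2 + d ^+ 2) by rewrite sqrtr_gt0.
  set q := Num.sqrt _ in h2 q0 *; set n := `|D t| in h1 h2 *.
  (* With [q] the square root, the derivative of [q - D] is [- dD (q - D) / q], and
     [- dD <= M |D| <= M q]. *)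
  move=> h3; have -> : D t * dD t / q - dD t = - dD t * (q - D t) / q by field; rewrite gt_eqF.
  rewrite ler_pdivrMr// mulrAC ler_wpM2r; [by []|lra|].
  have : M * n <= M * q by rewrite ler_wpM2l.
  lra.
rewrite ler_wpM2r ?expR_ge0//.
have : Num.sqrt (D a ^+ 2 + d ^+ 2) <= D a + d.
  rewrite -[leRHS]ger0_norm; last lra.
  by rewrite -sqrtr_sqr ler_sqrt ?sqr_ge0//; nra.
lra.
Qed.

Lemma wcont_pos l r f : l <= r -> wcont l r f -> (forall t, l <= t <= r -> f t != 0) ->
  0 < f l -> 0 < f r.
Proof.
move=> lr cf f0 fl; rewrite ltNge; apply/negP => fr.
have [c] : exists2 c, c \in `[l, r] & f c = 0.
  apply: IVT cf _ => //.
  by rewrite ge_min fr orbT le_max (ltW fl).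
by rewrite in_itv/= => /f0/eqP.
Qed.

(** The angle is defined as the integral of the angular speed, which avoids choosing branches of the
    argument. In the frame turned by [th], the transverse component [Q] has
    [Q ^ 2 / (X ^ 2 + Y ^ 2)] constant, hence vanishes, and the radial component [P] keeps its
    initial sign. *)
Lemma polar_angle l r (X Y dX dY : R -> R) (rho0 th0 : R) : l <= r ->
  smooth l r X dX -> smooth l r Y dY -> wcont l r dX -> wcont l r dY ->
  (forall t, l <= t <= r -> X t ^+ 2 + Y t ^+ 2 != 0) ->
  0 < rho0 -> X l = rho0 * cos th0 -> Y l = rho0 * sin th0 ->
  exists th : R -> R, [/\ th l = th0,
    smooth l r th (fun t => (X t * dY t - Y t * dX t) / (X t ^+ 2 + Y t ^+ 2)) &
    forall t, l <= t <= r -> exists2 rho, 0 < rho &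
      X t = rho * cos (th t) /\ Y t = rho * sin (th t)].
Proof.
move=> lr sX sY cdX cdY N0 rho_gt0 X0 Y0.
pose w t := (X t * dY t - Y t * dX t) / (X t ^+ 2 + Y t ^+ 2).
have sN := smooth_add (smooth_sqr sX) (smooth_sqr sY).
have cw : wcont l r w.
  apply: wcont_mul; last exact: wcont_inv N0 sN.1.
  apply: wcont_add; first exact: wcont_mul sX.1 cdY.
  by apply: wcont_opp; exact: wcont_mul sY.1 cdX.
pose th t := th0 + rint l t w.
have th_l : th l = th0 by rewrite /th rint_refl addr0.
have sth : smooth l r th w.
  apply: smooth_eq (smooth_add (smooth_cst l r th0) (rint_smooth lr cw)) => t _.
  by rewrite add0r.
exists th; split => // t tlr.
pose P t := X t * cos (th t) + Y t * sin (th t).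
pose Q t := Y t * cos (th t) - X t * sin (th t).
have sP := smooth_add (smooth_mul sX (smooth_cos sth)) (smooth_mul sY (smooth_sin sth)).
have sQ := smooth_add (smooth_mul sY (smooth_cos sth))
  (smooth_opp (smooth_mul sX (smooth_sin sth))).
have PQ s : P s ^+ 2 + Q s ^+ 2 = X s ^+ 2 + Y s ^+ 2.
  rewrite /P /Q -[RHS]mulr1 -(cos2Dsin2 (th s)); ring.
have Q_l : Q l = 0 by rewrite /Q th_l X0 Y0; ring.
have P_l : P l = rho0.
  by rewrite /P th_l X0 Y0 -[RHS]mulr1 -(cos2Dsin2 th0); ring.
have Q0 s : l <= s <= r -> Q s = 0.
  move=> /andP[ls sr].
  have sF := smooth_mul (smooth_sqr sQ) (smooth_inv N0 sN).
  have := smooth_const ls (smooth_sub (lexx _) sr sF) => h.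
  have Ns : X s ^+ 2 + Y s ^+ 2 != 0 by apply: N0; rewrite ls.
  have {}h : Q l ^+ 2 / (X l ^+ 2 + Y l ^+ 2) = Q s ^+ 2 / (X s ^+ 2 + Y s ^+ 2).
    apply: h => x xls; have Nx : X x ^+ 2 + Y x ^+ 2 != 0 by apply: N0; lra.
    rewrite /w; move: (cos (th x)) (sin (th x)) => cc ss.
    by field.
  move: h; rewrite Q_l expr0n mul0r => /esym/eqP.
  by rewrite mulf_eq0 invr_eq0 (negbTE Ns) orbF sqrf_eq0 => /eqP.
have P0 s : l <= s <= r -> P s != 0.
  move=> sl; apply/negP => /eqP Ps; have := N0 _ sl.
  by rewrite -PQ Ps (Q0 _ sl) expr0n addr0 eqxx.
exists (P t).
  have /andP[lt tr] := tlr.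
  apply: (@wcont_pos l t) => //; last by rewrite P_l.
    exact: wcont_sub (lexx _) tr sP.1.
  by move=> s sl; apply: P0; lra.
have Qt := Q0 _ tlr; have cs := cos2Dsin2 (th t); split.
  have -> : X t = P t * cos (th t) - Q t * sin (th t).
    by rewrite /P /Q -[LHS]mulr1 -cs; ring.
  by rewrite Qt mul0r subr0.
have -> : Y t = P t * sin (th t) + Q t * cos (th t).
  by rewrite /P /Q -[LHS]mulr1 -cs; ring.
by rewrite Qt mul0r addr0.
Qed.

(** The difference [d] cannot cross [pi / 2] or [- pi / 2], where the cosine vanishes. This compares
    two continuous angles of vectors whose scalar product stays positive. *)
Lemma cos_pos_stay l r d : l <= r -> wcont l r d -> (forall t, l <= t <= r -> 0 < cos (d t)) ->
  `|d l| < pi / 2 -> `|d r| < pi / 2.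
Proof.
move=> lr cd h; rewrite !ltr_norml => /andP[h1 h2].
have p0 : 0 < pi / 2 - d r.
  apply: (@wcont_pos l r (fun t => pi / 2 - d t)) => //; last by rewrite subr_gt0.
    by apply: wcont_add; [exact: wcont_cst|exact: wcont_opp].
  move=> t /h; apply: contraTN => /eqP e.
  by rewrite (_ : d t = pi / 2) ?cos_pihalf ?ltxx//; lra.
have p1 : 0 < pi / 2 + d r.
  apply: (@wcont_pos l r (fun t => pi / 2 + d t)) => //; last by lra.
    by apply: wcont_add; [exact: wcont_cst|].
  move=> t /h; apply: contraTN => /eqP e.
  by rewrite (_ : d t = - (pi / 2)) ?cosN ?cos_pihalf ?ltxx//; lra.
by apply/andP; split; lra.
Qed.

End Inequalities.

(** * The Weierstrass function *)

(* [frS n] plays the role of the [n]-th partial sum and [frdS n] that of its derivative;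
   [fr_alt] says that [phi] alternately decreases and increases between consecutive nodes of
   the mesh of step [beta ^ - n], by an amount which is large compared with the variation
   of [phi] over the shorter distances of [fr_win]. *)
Record fractal (R : realType) (a : R) (beta : nat) (phi : R -> R) := Fractal {
  frB : R; frL : R; frE : R; frD : R;
  frS : nat -> R -> R; frdS : nat -> R -> R;
  fr_a : 0 < a < 1;
  fr_q : 1 < a * beta%:R;
  frB_gt0 : 0 < frB;
  frL_gt0 : 0 < frL;
  frE_gt0 : 0 < frE;
  frD_gt0 : 0 < frD;
  frD_le : frD <= 1 / 2;
  fr_beta : ~~ odd beta;
  fr_deriv : forall n (t : R), is_derive t 1 (frS n) (frdS n t);
  fr_dS : forall n t, `|frdS n t| <= frL * (a * beta%:R) ^+ n;
  fr_dS_cont : forall n, continuous (frdS n);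
  fr_near : forall n t, `|phi t - frS n t| <= frB * a ^+ n;
  fr_alt : forall n k, frE * a ^+ n <=
    (-1) ^+ odd k * (phi (k%:R / beta%:R ^+ n) - phi (k.+1%:R / beta%:R ^+ n));
  fr_win : forall n s t, `|s - t| <= frD / beta%:R ^+ n -> `|phi s - phi t| <= frE / 8 * a ^+ n
}.

Section Weierstrass.
Context {R : realType} (a : R) (beta : nat).
Hypotheses (a01 : 0 < a < 1) (evenb : ~~ odd beta) (hab : 1 + pi / 2 < a * beta%:R).

Let phi := weierstrass a beta.
Let B := (1 - a)^-1.
Let q := a * beta%:R.
Let L := pi / (q - 1).

Let a_gt0 : 0 < a. Proof. by case/andP: a01. Qed.
Let a_lt1 : a < 1. Proof. by case/andP: a01. Qed.
Let q_gt1 : 1 < q. Proof. by have := pi_gt0 R; rewrite /q; move: hab; lra. Qed.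
Let B_gt0 : 0 < B. Proof. by rewrite invr_gt0 subr_gt0. Qed.
Let L_gt0 : 0 < L. Proof. by rewrite divr_gt0 ?pi_gt0 ?subr_gt0. Qed.

Let L_lt2 : L < 2.
Proof. by rewrite /L ltr_pdivrMr ?subr_gt0 ?q_gt1// /q; move: hab; lra. Qed.

Let beta_gt0 : (0 < beta%:R :> R).
Proof. by have := q_gt1; rewrite /q => h; rewrite -(pmulr_rgt0 _ a_gt0); lra. Qed.

Let an_gt0 n : 0 < a ^+ n. Proof. exact: exprn_gt0. Qed.
Let an_ge0 n : 0 <= a ^+ n. Proof. exact/ltW/an_gt0. Qed.
Let bn_gt0 n : 0 < beta%:R ^+ n :> R. Proof. exact: exprn_gt0. Qed.
Let q_gt0 : 0 < q. Proof. exact: lt_trans ltr01 q_gt1. Qed.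
Let qn_gt0 n : 0 < q ^+ n. Proof. exact: exprn_gt0. Qed.

Let term (t : R) (n : nat) := a ^+ n * cos ((beta ^ n)%:R * pi * t).

Lemma weierstrass_cvg t : cvgn (series (term t)).
Proof.
apply: (@normed_cvg _ R^o).
apply: (@series_le_cvg _ _ (geometric 1 a)) => [n|n|n|].
- exact: normr_ge0.
- by rewrite /= mul1r.
- by rewrite /= mul1r /term normrM ger0_norm// ler_piMr// cos_max.
- by apply: is_cvg_geometric_series; rewrite gtr0_norm.
Qed.

Lemma weierstrass_step t : phi t = cos (pi * t) + a * phi (beta%:R * t).
Proof.
have c1 : series (term t) n.+1 @[n --> \oo] --> phi t.
  by rewrite (cvg_shiftS (series (term t))); exact: weierstrass_cvg.
have c2 : series (term t) n.+1 @[n --> \oo] --> cos (pi * t) + a * phi (beta%:R * t).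
  have -> : (fun n => series (term t) n.+1) =
    (fun n => cos (pi * t) + a * series (term (beta%:R * t)) n).
    apply: funext => n; rewrite /series /= big_nat_recl// mulr_sumr.
    rewrite /term expr0 expn0 !mul1r; congr (_ + _).
    apply: eq_bigr => i _; rewrite exprS -mulrA; congr (_ * (_ * cos _)).
    by rewrite expnS natrM; ring.
  apply: cvgD; first exact: cvg_cst.
  by apply: cvgM; [exact: cvg_cst|exact: weierstrass_cvg].
exact: (cvg_unique _ c1 c2).
Qed.

Lemma weierstrass_bound t : `|phi t| <= B.
Proof.
have sb n : `|series (term t) n| <= B.
  apply: (@le_trans _ _ (series (geometric 1 a) n)).
    rewrite /series /=; apply: (le_trans (ler_norm_sum _ _ _)); apply: ler_sum => i _.
    by rewrite mul1r /term normrM ger0_norm// ler_piMr// cos_max.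
  rewrite geometric_seriesE ?lt_eqF//= mul1r ler_pdivrMr ?subr_gt0// /B mulVf ?gt_eqF ?subr_gt0//.
  by rewrite gerBl.
have cv : cvgn (series (term t)) by exact: weierstrass_cvg.
 rewrite ler_norml; apply/andP; split.
  by apply: limr_ge => //; near=> n; have := sb n; rewrite ler_norml => /andP[].
by apply: limr_le => //; near=> n; have := sb n; rewrite ler_norml => /andP[].
Unshelve. all: by end_near.
Qed.

Fixpoint partial (n : nat) (t : R) : R :=
  if n is m.+1 then partial m t + a ^+ m * cos (beta%:R ^+ m * pi * t) else 0.

Fixpoint dpartial (n : nat) (t : R) : R :=
  if n is m.+1 then dpartial m t - pi * q ^+ m * sin (beta%:R ^+ m * pi * t) else 0.

Lemma weierstrass_split n t : phi t = partial n t + a ^+ n * phi (beta%:R ^+ n * t).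
Proof.
elim: n => [|n ->] /=; first by rewrite add0r !expr0 !mul1r.
rewrite (weierstrass_step (_ * t)) (_ : beta%:R * (beta%:R ^+ n * t) = beta%:R ^+ n.+1 * t).
  rewrite (_ : pi * (beta%:R ^+ n * t) = beta%:R ^+ n * pi * t); last by ring.
  by rewrite (exprS a); ring.
by rewrite exprS mulrA.
Qed.

Lemma partial_deriv n (t : R) : is_derive t 1 (partial n) (dpartial n t).
Proof.
elim: n => [|n IH] /=; first exact: is_derive_cst.
have s1 := smooth_mul (smooth_cst (t - 1) (t + 1) (a ^+ n)) (smooth_cos
  (smooth_mul (smooth_cst (t - 1) (t + 1) (beta%:R ^+ n * pi)) (smooth_id (t - 1) (t + 1)))).
case: s1 => _ /(_ t) s1.
have {}s1 := s1 ltac:(lra).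
apply: (@is_derive_eq _ _ _ _ _ _ _ _ (is_deriveD IH s1)).
by rewrite /q exprMn; ring.
Qed.

(** The constant [L = pi / (q - 1)] dominates the geometric sums of [pi q ^ k] and makes the
    induction exact: [L q ^ n + pi q ^ n = L q ^ n.+1]. *)
Lemma dpartial_bound n t : `|dpartial n t| <= L * q ^+ n.
Proof.
have q0 : 0 < q := lt_trans ltr01 q_gt1.
elim: n => [|n IH] /=; first by rewrite normr0 expr0 mulr1 ltW.
apply: (le_trans (ler_normB _ _)); apply: (le_trans (lerD IH (lexx _))).
have -> : L * q ^+ n.+1 = L * q ^+ n + pi * q ^+ n.
  by rewrite exprS /L; field; rewrite subr_eq0 gt_eqF.
have pq : 0 <= pi * q ^+ n by rewrite mulr_ge0 ?pi_ge0 ?exprn_ge0 ?(ltW q_gt0).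
by rewrite lerD2l normrM ger0_norm// ler_piMr// sin_max.
Qed.

Lemma dpartial_continuous n : continuous (dpartial n).
Proof.
elim: n => [|n IH] t /=; first exact: cvg_cst.
apply: cvgB; first exact: IH.
apply: cvgM; first exact: cvg_cst.
apply: (@continuous_comp _ _ _ (fun x : R => beta%:R ^+ n * pi * x) sin).
  by apply: cvgM; [exact: cvg_cst|exact: cvg_id].
exact: continuous_sin.
Qed.

Lemma partial_near n t : `|phi t - partial n t| <= B * a ^+ n.
Proof.
rewrite (weierstrass_split n) addrAC subrr add0r normrM ger0_norm// mulrC.
by rewrite ler_wpM2r// weierstrass_bound.
Qed.

Lemma partial_lip n s t : `|partial n s - partial n t| <= L * q ^+ n * `|s - t|.
Proof.
wlog st : s t / t <= s => [H|].
  by case/orP: (le_total t s) => [/H//|/H]; rewrite distrC (distrC s t).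
rewrite (ger0_norm (x := s - t)) ?subr_ge0//.
have := smooth_lip st (smooth_global t s (partial_deriv n)); apply => x _.
exact: dpartial_bound.
Qed.

Lemma weierstrass_osc n s t : `|phi s - phi t| <= L * q ^+ n * `|s - t| + 2 * B * a ^+ n.
Proof.
have -> : phi s - phi t = (partial n s - partial n t) +
  ((phi s - partial n s) - (phi t - partial n t)) by ring.
apply: (le_trans (ler_normD _ _)); rewrite lerD ?partial_lip//.
apply: (le_trans (ler_normB _ _)).
have := partial_near n s; have := partial_near n t; lra.
Qed.

Lemma cos_natpi (m : nat) : cos (m%:R * pi) = (-1) ^+ m :> R.
Proof.
elim: m => [|m IH]; first by rewrite mul0r cos0 expr0.
rewrite -natr1 mulrDl mul1r cosD cospi sinpi IH exprSr; ring.
Qed.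

(** At an even integer every cosine is 1, whence the geometric sum [B]. At an odd one the first term
    is [-1] and, [beta] being even, the other cosines are 1: the value is [-1 + a B = B - 2]. *)
Lemma weierstrass_nat (m : nat) : phi m%:R = if odd m then B - 2 else B.
Proof.
have ev k : ~~ odd k -> phi k%:R = B.
  move=> ek; rewrite /phi /weierstrass.
  rewrite (_ : (fun n => _) = geometric 1 a); last first.
    apply: funext => n /=; rewrite mul1r mulrAC -natrM cos_natpi.
    by rewrite -signr_odd oddM (negbTE ek) andbF expr0 mulr1.
  have := @cvg_geometric_series R 1 a; rewrite gtr0_norm// => /(_ a_lt1) /cvg_lim ->//.
  by rewrite mul1r.
case: ifPn => [om|]; last exact: ev.
rewrite weierstrass_step -natrM ev; last by rewrite oddM (negbTE evenb).
rewrite mulrC cos_natpi -signr_odd om expr1 /B.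
by field; rewrite subr_eq0 gt_eqF.
Qed.

(** Rescaled by [beta ^ n], the two nodes become consecutive integers, so the tail jumps by
    [2 a ^ n]; over the length [beta ^ - n] the partial sum moves by at most
    [L q ^ n / beta ^ n = L a ^ n]. *)
Lemma weierstrass_alt n k :
  (2 - L) * a ^+ n <=
  (-1) ^+ odd k * (phi (k%:R / beta%:R ^+ n) - phi (k.+1%:R / beta%:R ^+ n)).
Proof.
have bn := lt0r_neq0 (bn_gt0 n).
have := partial_lip n (k%:R / beta%:R ^+ n) (k.+1%:R / beta%:R ^+ n).
have -> : k%:R / beta%:R ^+ n - k.+1%:R / beta%:R ^+ n = - (beta%:R ^+ n)^-1 :> R.
  by rewrite -natr1; field.
have qE : q ^+ n = a ^+ n * beta%:R ^+ n by rewrite /q exprMn.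
rewrite normrN [`|_^-1|]gtr0_norm ?invr_gt0// qE mulrA mulfK//.
have bK (x : R) : beta%:R ^+ n * (x / beta%:R ^+ n) = x by field.
rewrite (weierstrass_split n (k%:R / _)) (weierstrass_split n (k.+1%:R / _)) !bK.
rewrite !weierstrass_nat /=.
rewrite ler_norml => /andP[h1 h2].
by case: (odd k) => /=; rewrite ?expr1 ?expr0; lra.
Qed.

Lemma expr_small (e : R) : 0 < e -> exists m, a ^+ m <= e.
Proof.
move=> e0; have := @cvg_expr R a; rewrite gtr0_norm// => /(_ a_lt1).
move/cvgrPdist_le => /(_ _ e0) [m _ /(_ m (leqnn m))] /=.
by rewrite sub0r normrN ger0_norm// => h; exists m.
Qed.

(** The function is split at the finer level [n + m]: [m] makes the tail [2 B a ^ (n + m)] at most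
    half of the bound, then [d] does the same for the Lipschitz part [L q ^ (n + m) |s - t|].
    Neither choice depends on [n]. *)
Lemma weierstrass_window : exists d : R, [/\ 0 < d, d <= 1 / 2 &
  forall n s t, `|s - t| <= d / beta%:R ^+ n -> `|phi s - phi t| <= (2 - L) / 8 * a ^+ n].
Proof.
have E0 : 0 < 2 - L by rewrite subr_gt0.
have [m hm] : exists m, a ^+ m <= (2 - L) / 32 / B by apply: expr_small; rewrite !divr_gt0.
have q0 : 0 < q := lt_trans ltr01 q_gt1.
have Lq : 0 < L * q ^+ m by rewrite mulr_gt0 ?exprn_gt0.
have Lqi : 0 < (2 - L) / 16 / (L * q ^+ m) by rewrite !divr_gt0.
exists (Num.min (1 / 2) ((2 - L) / 16 / (L * q ^+ m))); split.
- by rewrite lt_min Lqi andbT; lra.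
- by rewrite ge_min lexx.
move=> n s t st; apply: (le_trans (weierstrass_osc (n + m) s t)).
have an : 0 < a ^+ n by rewrite exprn_gt0.
have bn : 0 < beta%:R ^+ n :> R by rewrite exprn_gt0.
have h1 : 2 * B * a ^+ (n + m) <= (2 - L) / 16 * a ^+ n.
  rewrite exprD (mulrC (a ^+ n)) mulrA ler_wpM2r//.
  have : B * a ^+ m <= B * ((2 - L) / 32 / B) by rewrite ler_wpM2l// ltW.
  by rewrite (_ : B * (_ / _) = (2 - L) / 32); [lra|field; rewrite gt_eqF].
have h2 : L * q ^+ (n + m) * `|s - t| <= (2 - L) / 16 * a ^+ n.
  have st' : `|s - t| <= (2 - L) / 16 / (L * q ^+ m) / beta%:R ^+ n.
    by apply: (le_trans st); rewrite ler_wpM2r ?invr_ge0 ?(ltW bn)// ge_min lexx orbT.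
  apply: (@le_trans _ _ (L * q ^+ (n + m) * ((2 - L) / 16 / (L * q ^+ m) / beta%:R ^+ n))).
    by rewrite ler_wpM2l// ltW// mulr_gt0 ?exprn_gt0.
  rewrite le_eqVlt; apply/orP; left; apply/eqP; rewrite exprD {1}/q exprMn.
  by field; rewrite !gt_eqF ?exprn_gt0.
lra.
Qed.

Lemma weierstrass_fractal : fractal a beta (weierstrass a beta).
Proof.
have [d [d0 d1 hd]] := cid weierstrass_window.
by apply: (@Fractal _ _ _ _ B L (2 - L) d partial dpartial) => //;
  [rewrite subr_gt0|exact: partial_deriv|exact: dpartial_bound|exact: dpartial_continuous
  |exact: partial_near|exact: weierstrass_alt].
Qed.

End Weierstrass.

(** * Determinants over cells *)

Section Fractal.
Context {R : realType} {a : R} {beta : nat} {phi : R -> R} (F : fractal a beta phi).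

Local Notation b := (beta%:R : R).
Local Notation E := (frE F).
Local Notation d := (frD F).
Local Notation node n k := (k%:R / b ^+ n).

(** Bounds the oscillation of [phi] over one cell in units of [a ^ n]: [frL F] from the partial sum,
    twice [frB F] from the remainder. *)
Definition frC := frL F + 2 * frB F.
Local Notation C := frC.

Lemma fr_a_gt0 : 0 < a. Proof. by case/andP: (fr_a F). Qed.
Lemma fr_a_lt1 : a < 1. Proof. by case/andP: (fr_a F). Qed.
Lemma fr_an_gt0 n : 0 < a ^+ n. Proof. by rewrite exprn_gt0// fr_a_gt0. Qed.
Lemma fr_an_le1 n : a ^+ n <= 1.
Proof. by rewrite exprn_ile1// ltW// ?fr_a_gt0// fr_a_lt1. Qed.

Lemma fr_b_gt1 : 1 < b.
Proof.
have := fr_q F; have := fr_a_gt0; have := fr_a_lt1 => a1 a0 q1.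
rewrite ltNge; apply/negP => b1; have : a * b <= a * 1 by rewrite ler_wpM2l// ltW.
lra.
Qed.

Lemma fr_b_gt0 : 0 < b. Proof. exact: lt_trans ltr01 fr_b_gt1. Qed.
Lemma fr_bn_gt0 n : 0 < b ^+ n. Proof. by rewrite exprn_gt0// fr_b_gt0. Qed.
Lemma fr_bn_ge1 n : 1 <= b ^+ n. Proof. by rewrite exprn_ege1// ltW// fr_b_gt1. Qed.
Lemma frC_gt0 : 0 < C.
Proof. by rewrite /frC; have := frL_gt0 F; have := frB_gt0 F; lra. Qed.

Lemma fr_osc n s t : `|phi s - phi t| <= frL F * (a * b) ^+ n * `|s - t| + 2 * frB F * a ^+ n.
Proof.
have -> : phi s - phi t = (frS F n s - frS F n t) +
  ((phi s - frS F n s) - (phi t - frS F n t)) by ring.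
apply: (le_trans (ler_normD _ _)); rewrite lerD//; last first.
  apply: (le_trans (ler_normB _ _)).
  by have := fr_near F n s; have := fr_near F n t; lra.
wlog st : s t / t <= s => [H|].
  by case/orP: (le_total t s) => [/H//|/H]; rewrite distrC (distrC s t).
rewrite (ger0_norm (x := s - t)) ?subr_ge0//.
have := smooth_lip st (smooth_global t s (fr_deriv F n)); apply => x _.
exact: fr_dS.
Qed.

Lemma fr_osc_cell n s t : `|s - t| <= (b ^+ n)^-1 -> `|phi s - phi t| <= C * a ^+ n.
Proof.
move=> st; apply: (le_trans (fr_osc n s t)); rewrite /frC (mulrDl (frL F)) lerD2r.
rewrite exprMn mulrA -mulrA ler_piMr//.
  by rewrite mulr_ge0 ?ltW ?frL_gt0 ?fr_an_gt0.
rewrite mulrC; have bn := fr_bn_gt0 n.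
by rewrite -ler_pdivlMr// div1r.
Qed.

Lemma fr_small (e : R) : 0 < e -> exists m, a ^+ m <= e.
Proof.
move=> e0; have := @cvg_expr R a; rewrite gtr0_norm ?fr_a_gt0// => /(_ fr_a_lt1).
move/cvgrPdist_le => /(_ _ e0) [m _ /(_ m (leqnn m))] /=.
by rewrite sub0r normrN ger0_norm ?(ltW (fr_an_gt0 m))// => h; exists m.
Qed.

Lemma fr_continuous : continuous phi.
Proof.
move=> x; apply/cvgrPdist_le => /= e e0.
have [m hm] := fr_small (divr_gt0 e0 (frE_gt0 F)).
have dm : 0 < d / b ^+ m by rewrite divr_gt0 ?frD_gt0 ?fr_bn_gt0.
exists (d / b ^+ m) => //= y /= xy; apply: (le_trans (fr_win (ltW xy))).
have E0 := frE_gt0 F; have := fr_an_gt0 m; rewrite ler_pdivlMr// in hm.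
by move=> ?; nra.
Qed.

(** The quadratic form [e^T H(t) e] of the rank one Hamiltonian. *)
Definition qform (e1 e2 t : R) := (e1 * cos (phi t) + e2 * sin (phi t)) ^+ 2.

Lemma cos_phi_continuous : continuous (fun t => cos (phi t)).
Proof. by move=> x; apply: continuous_comp; [exact: fr_continuous|exact: continuous_cos]. Qed.

Lemma sin_phi_continuous : continuous (fun t => sin (phi t)).
Proof. by move=> x; apply: continuous_comp; [exact: fr_continuous|exact: continuous_sin]. Qed.

Lemma qform_wcont l r e1 e2 : wcont l r (qform e1 e2).
Proof.
apply: wcont_exp; apply: wcont_add; apply: wcont_mul; try exact: wcont_cst.
  exact/wcont_continuous/cos_phi_continuous.
exact/wcont_continuous/sin_phi_continuous.
Qed.

Lemma qform_ge0 e1 e2 t : 0 <= qform e1 e2 t. Proof. exact: sqr_ge0. Qed.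

Lemma node_lt n k : node n k < node n k.+1.
Proof. by rewrite ltr_pM2r ?invr_gt0 ?fr_bn_gt0// ltr_nat. Qed.

Lemma node_step n k : node n k.+1 - node n k = (b ^+ n)^-1.
Proof. by rewrite -mulrBl -natr1 [_ + 1]addrC addrK mul1r. Qed.

(** A vector cannot be nearly orthogonal to two distinct directions. With [A], [A'] the two scalar
    products and [x] the angle between the directions, [|e| ^ 2 sin x ^ 2 = A ^ 2 + A' ^ 2 - 2 A A'
    cos x]. *)
Lemma qform_pair e1 e2 s t :
  (e1 ^+ 2 + e2 ^+ 2) * sin (phi s - phi t) ^+ 2 <= 2 * (qform e1 e2 s + qform e1 e2 t).
Proof.
rewrite /qform sinB; have := cos2Dsin2 (phi s); have := cos2Dsin2 (phi t).
move: (cos (phi s)) (sin (phi s)) (cos (phi t)) (sin (phi t)) => c s' c' s'' h1 h2.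
set A := e1 * c + e2 * s'; set A' := e1 * c' + e2 * s''.
have id1 : (e1 ^+ 2 + e2 ^+ 2) * (s' * c' - c * s'') ^+ 2 =
  (c' ^+ 2 + s'' ^+ 2) * A ^+ 2 + (c ^+ 2 + s' ^+ 2) * A' ^+ 2 - 2 * A * A' * (c * c' + s' * s'').
  by rewrite /A /A'; ring.
rewrite id1 h1 h2 !mul1r.
have id2 : (c * c' + s' * s'') ^+ 2 <= 1.
  rewrite -[leRHS]mulr1 -{1}h1 -h2.
  have -> : (c' ^+ 2 + s'' ^+ 2) * (c ^+ 2 + s' ^+ 2) = (c * c' + s' * s'') ^+ 2 + (c * s'' - s' * c') ^+ 2 by ring.
  by rewrite lerDl sqr_ge0.
have id3 : `|c * c' + s' * s''| <= 1 by rewrite ler_norml; apply/andP; split; nra.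
move: id3; set k := _ + _; rewrite ler_norml => /andP[k1 k2].
have := sqr_ge0 (A + A'); have := sqr_ge0 (A - A'); nra.
Qed.

Lemma sin_sqr_lower (x m : R) : 0 <= m -> m <= `|x| -> `|x| <= 1 -> (m / 2) ^+ 2 <= sin x ^+ 2.
Proof.
move=> m0 mx x1; have -> : sin x ^+ 2 = sin `|x| ^+ 2.
  by case: (ger0P x) => // _; rewrite sinN sqrrN.
have := @sin_ge_half _ `|x|; rewrite normr_ge0 x1 => /(_ isT) h.
rewrite lerXn2r ?nnegrE//; lra.
Qed.

(** If the form is below [kap] at some point of the window at the left end of the cell, it is at
    least [kap] on the whole window at the right end: between the two windows [phi] differs by at
    least [(1 - 2 / 8) E a ^ n], and by at most [C a ^ n <= 1], a range where [sin x >= x / 2]. The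
    factor 9/256 is [(3 / 8) ^ 2 / 4]. *)
Lemma qform_int_small n k e1 e2 : C * a ^+ n <= 1 ->
  9 / 256 * d * E ^+ 2 * (a ^+ n ^+ 2 / b ^+ n) * (e1 ^+ 2 + e2 ^+ 2) <=
  rint (node n k) (node n k.+1) (qform e1 e2).
Proof.
move=> hn; have bn := fr_bn_gt0 n; have an := fr_an_gt0 n.
have E0 := frE_gt0 F; have d0 := frD_gt0 F; have d1 := frD_le F.
set kap := 9 / 256 * E ^+ 2 * a ^+ n ^+ 2 * (e1 ^+ 2 + e2 ^+ 2).
set w := d / b ^+ n.
have w0 : 0 < w by rewrite divr_gt0.
have w1 : w <= 1 / 2 * (b ^+ n)^-1 by rewrite ler_wpM2r// invr_ge0 ltW.
have st := node_step n k.
have bi : 0 < (b ^+ n)^-1 by rewrite invr_gt0.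
have -> : 9 / 256 * d * E ^+ 2 * (a ^+ n ^+ 2 / b ^+ n) * (e1 ^+ 2 + e2 ^+ 2) = kap * w.
  by rewrite /kap /w; field; rewrite gt_eqF.
have win l r : node n k <= l -> r <= node n k.+1 -> r - l = w ->
    (forall t, l <= t <= r -> kap <= qform e1 e2 t) ->
    kap * w <= rint (node n k) (node n k.+1) (qform e1 e2).
  move=> kl rk rl h; have lr : l <= r by lra.
  apply: (@le_trans _ _ (rint l r (qform e1 e2))).
    rewrite -rl -rint_cst//; apply: rint_le => //; first exact: wcont_cst.
    exact: qform_wcont.
  apply: rint_mono => //; first exact: qform_wcont.
  by move=> x _; exact: qform_ge0.
have [h|/existsNP[s]] := pselect (forall t, node n k <= t <= node n k + w -> kap <= qform e1 e2 t).
  by apply: (win (node n k) (node n k + w)) => //; lra.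
move/not_implyP => [sk /negP]; rewrite -ltNge => hs.
apply: (win (node n k.+1 - w) (node n k.+1)) => //; [lra|lra|].
move=> t tk; rewrite leNgt; apply/negP => ht.
have := qform_pair e1 e2 s t; apply/negP; rewrite -ltNge.
have ds : `|phi s - phi (node n k)| <= E / 8 * a ^+ n.
  by apply: (fr_win (f := F)); rewrite ler_norml; apply/andP; split; rewrite -/w; lra.
have dt : `|phi t - phi (node n k.+1)| <= E / 8 * a ^+ n.
  by apply: (fr_win (f := F)); rewrite ler_norml; apply/andP; split; rewrite -/w; lra.
have alt := fr_alt F n k.
have big : 3 / 4 * E * a ^+ n <= `|phi s - phi t|.
  move: ds dt alt; rewrite !ler_norml => /andP[? ?] /andP[? ?].
  case: (odd k); rewrite ?expr1 ?expr0 ?mulN1r ?mul1r => alt.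
    by rewrite -normrN (le_trans _ (ler_norm _))//; lra.
  by rewrite (le_trans _ (ler_norm _))//; lra.
have sm : `|phi s - phi t| <= 1.
  by apply: le_trans hn; apply: fr_osc_cell; rewrite ler_norml; apply/andP; split; lra.
have := sin_sqr_lower _ big sm.
have Ea : 0 <= 3 / 4 * E * a ^+ n by rewrite !mulr_ge0// ltW.
move=> /(_ Ea) sq.
apply: (@lt_le_trans _ _ (4 * kap)); first lra.
rewrite [leRHS]mulrC.
have -> : 4 * kap = (3 / 4 * E * a ^+ n / 2) ^+ 2 * (e1 ^+ 2 + e2 ^+ 2) by rewrite /kap; field.
by rewrite ler_wpM2r// addr_ge0 ?sqr_ge0.
Qed.

(** The integral is restricted to the subcell of level [n + n0] starting at the same node, with [n0]
    such that [C a ^ (n + n0) <= 1] for every [n]; this only costs the constant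
    [a ^ 2n0 / b ^ n0]. *)
Lemma qform_int : exists2 m0 : R, 0 < m0 & forall n k e1 e2,
  m0 * (a ^+ n ^+ 2 / b ^+ n) * (e1 ^+ 2 + e2 ^+ 2) <=
  rint (node n k) (node n k.+1) (qform e1 e2).
Proof.
have [n0 hn0] : exists n0, a ^+ n0 <= C^-1 by apply: fr_small; rewrite invr_gt0 frC_gt0.
have E0 := frE_gt0 F; have d0 := frD_gt0 F; have C0 := frC_gt0.
exists (9 / 256 * d * E ^+ 2 * (a ^+ n0 ^+ 2 / b ^+ n0)).
  have an0 := fr_an_gt0 n0; have bn0 := fr_bn_gt0 n0.
  apply: mulr_gt0; last by rewrite divr_gt0// exprn_gt0.
  by apply: mulr_gt0; [lra|exact: exprn_gt0].
move=> n k e1 e2.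
have b0 := fr_bn_gt0 n; have b1 := fr_bn_gt0 n0; have b2 := fr_bn_gt0 (n + n0).
have hC : C * a ^+ (n + n0) <= 1.
  rewrite mulrC -ler_pdivlMr// div1r exprD (le_trans _ hn0)// ler_piMl ?fr_an_le1//.
  exact/ltW/fr_an_gt0.
have := @qform_int_small (n + n0) (k * beta ^ n0) e1 e2 hC.
rewrite exprD (exprD b) exprMn invfM.
set r := rint _ _ _ => h; apply: (@le_trans _ _ r).
  apply: le_trans h; rewrite le_eqVlt; apply/orP; left; apply/eqP; ring.
rewrite /r; apply: rint_mono; last by move=> x _; exact: qform_ge0.
- rewrite natrM natrX; rewrite le_eqVlt; apply/orP; left; apply/eqP.
  by field; rewrite !gt_eqF.
- by have := ltW (node_lt (n + n0) (k * beta ^ n0)); rewrite exprD invfM.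
- rewrite -natr1 natrM natrX -[k.+1%:R]natr1.
  have -> : (k%:R * b ^+ n0 + 1) * (b ^- n / b ^+ n0) = (k%:R + (b ^+ n0)^-1) / b ^+ n.
    by field; rewrite !gt_eqF.
  by rewrite ler_wpM2r ?invr_ge0 ?(ltW b0)// lerD2l invf_le1// fr_bn_ge1.
- exact: qform_wcont.
Qed.

Definition om0 s t := rint s t (fun x => cos (phi x) ^+ 2).
Definition om1 s t := rint s t (fun x => cos (phi x) * sin (phi x)).
Definition om2 s t := rint s t (fun x => sin (phi x) ^+ 2).

Lemma det_Omega s t :
  \det (Omega (Hamiltonian phi) s t) = om0 s t * om2 s t - om1 s t ^+ 2.
Proof.
have HE i j x : Hamiltonian phi x i j = xi (phi x) i 0 * xi (phi x) j 0.
  by rewrite /Hamiltonian !mxE big_ord1 !mxE.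
rewrite (expand_det_row _ ord0) !big_ord_recl big_ord0 addr0 /cofactor !det_mx11 !mxE /=.
rewrite /om0 /om1 /om2 expr0 expr1 mul1r mulN1r mulrN expr2.
by congr (_ * _ - _ * _); apply: rint_ext => x _; rewrite HE !mxE //= ?expr2// mulrC.
Qed.

Let wcos2 s t : wcont s t (fun x => cos (phi x) ^+ 2).
Proof. by apply: wcont_exp; exact/wcont_continuous/cos_phi_continuous. Qed.
Let wsin2 s t : wcont s t (fun x => sin (phi x) ^+ 2).
Proof. by apply: wcont_exp; exact/wcont_continuous/sin_phi_continuous. Qed.
Let wcs s t : wcont s t (fun x => cos (phi x) * sin (phi x)).
Proof.
by apply: wcont_mul; [exact/wcont_continuous/cos_phi_continuous|exact/wcont_continuous/sin_phi_continuous].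
Qed.

Lemma qform_om s t e1 e2 : rint s t (qform e1 e2) =
  e1 ^+ 2 * om0 s t + 2 * e1 * e2 * om1 s t + e2 ^+ 2 * om2 s t.
Proof.
rewrite /om0 /om1 /om2 -!rint_scale// -!rint_add//; do ?[apply: wcont_add];
  do ?[apply: wcont_mul; first exact: wcont_cst] => //.
by apply: rint_ext => x _; rewrite /qform; ring.
Qed.

Lemma om_trace s t : s <= t -> om0 s t + om2 s t = t - s.
Proof.
move=> st; rewrite /om0 /om2 -rint_add// -[RHS]mul1r -rint_cst//.
by apply: rint_ext => x _; rewrite cos2Dsin2.
Qed.

(** The form is at least [m |e| ^ 2] with [m] of order [a ^ 2n / b ^ n], so the smaller eigenvalue
    of [Omega] is at least [m], while the larger one is at least half of the trace
    [t - s >= b ^ - n]. *)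
Lemma det_Omega_lower : exists2 m : R, 0 < m & forall n k s t,
  s <= node n k -> node n k.+1 <= t ->
  m * (a ^+ n / b ^+ n) ^+ 2 <= \det (Omega (Hamiltonian phi) s t).
Proof.
have [m0 m0_gt0 hm] := qform_int; exists (m0 / 2); first by rewrite divr_gt0.
move=> n k s t sk kt; have st := lt_le_trans (le_lt_trans sk (node_lt n k)) kt.
set m := m0 * (a ^+ n ^+ 2 / b ^+ n).
have m_gt0 : 0 < m by rewrite mulr_gt0// divr_gt0 ?fr_bn_gt0// exprn_gt0// fr_an_gt0.
have Q e1 e2 : m * (e1 ^+ 2 + e2 ^+ 2) <=
    e1 ^+ 2 * om0 s t + 2 * e1 * e2 * om1 s t + e2 ^+ 2 * om2 s t.
  rewrite -qform_om; apply: le_trans (hm n k e1 e2) _.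
  apply: rint_mono => //; [exact/ltW/node_lt|exact: qform_wcont|].
  by move=> x _; exact: qform_ge0.
have tr := om_trace (ltW st).
rewrite det_Omega; move: Q tr; move: (om0 s t) (om1 s t) (om2 s t) => w0 w1 w2 Q tr.
have h0 : m <= w0 by have := Q 1 0; lra.
have h2 : m <= w2 by have := Q 0 1; lra.
(* [Omega - m I] is positive semidefinite, hence has nonnegative determinant; the case of a
   vanishing diagonal entry takes its own test vector. *)
have h1 : w1 ^+ 2 <= (w0 - m) * (w2 - m).
  have [e|ne] := eqVneq w2 m.
    have [->|n1] := eqVneq w1 0; first by rewrite e subrr mulr0 expr0n.
    have := Q 1 (- (w0 - m + 1) / (2 * w1)); rewrite e.
    rewrite (_ : 2 * 1 * _ * w1 = - (w0 - m + 1)); last by field.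
    lra.
  have p : 0 < w2 - m by rewrite subr_gt0 lt_neqAle eq_sym ne.
  have := Q (w2 - m) (- w1) => h.
  by rewrite -subr_ge0 -(pmulr_rge0 _ p); nra.
have len : (b ^+ n)^-1 <= t - s by have := node_step n k; lra.
have : m / 2 * (b ^+ n)^-1 <= w0 * w2 - w1 ^+ 2.
  have : m / 2 * (b ^+ n)^-1 <= m / 2 * (t - s) by rewrite ler_wpM2l// ltW// divr_gt0.
  rewrite -tr; nra.
apply: le_trans; rewrite /m expr_div_n le_eqVlt; apply/orP; left; apply/eqP.
by field; rewrite gt_eqF ?fr_bn_gt0.
Qed.

(** Hadamard's inequality in the basis adapted to [phi s]: across [xi (phi s)] the form is
    [sin (phi x - phi s) ^ 2 <= (C a ^ n) ^ 2], along it at most 1. *)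
Lemma det_Omega_upper n s t : s <= t -> t - s <= (b ^+ n)^-1 ->
  \det (Omega (Hamiltonian phi) s t) <= (C * a ^+ n) ^+ 2 * (t - s) ^+ 2.
Proof.
move=> st len; rewrite det_Omega.
have c1 := cos2Dsin2 (phi s).
have q1 : rint s t (qform (- sin (phi s)) (cos (phi s))) <= (C * a ^+ n) ^+ 2 * (t - s).
  rewrite -rint_cst//; apply: rint_le => //; [exact: qform_wcont|exact: wcont_cst|].
  move=> x xs; rewrite /qform.
  have -> : - sin (phi s) * cos (phi x) + cos (phi s) * sin (phi x) = sin (phi x - phi s).
    by rewrite sinB; ring.
  apply: (le_trans (sqr_sin_le _)).
  rewrite -[leLHS]real_normK ?num_real// lerXn2r ?nnegrE//.
    by rewrite mulr_ge0 ?(ltW frC_gt0) ?(ltW (fr_an_gt0 n)).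
  by apply: fr_osc_cell; rewrite ger0_norm; lra.
have q2 : rint s t (qform (cos (phi s)) (sin (phi s))) <= t - s.
  rewrite -[leRHS]mul1r -rint_cst//; apply: rint_le => //; [exact: qform_wcont|exact: wcont_cst|].
  move=> x xs; rewrite /qform -cosB -[leRHS](expr1n _ 2) -[leLHS]real_normK ?num_real// lerXn2r ?nnegrE//.
  exact: cos_max.
have p1 := rint_ge0 (a := s) (b := t) (fun x _ => qform_ge0 (- sin (phi s)) (cos (phi s)) x).
have p2 := rint_ge0 (a := s) (b := t) (fun x _ => qform_ge0 (cos (phi s)) (sin (phi s)) x).
have := ler_pM p1 p2 q1 q2; rewrite !qform_om.
move: (om0 s t) (om1 s t) (om2 s t) c1 => w0 w1 w2; move: (cos _) (sin _) => c s' c1 h.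
have -> : (C * a ^+ n) ^+ 2 * (t - s) ^+ 2 = (C * a ^+ n) ^+ 2 * (t - s) * (t - s) by ring.
apply: le_trans h.
have -> : w0 * w2 - w1 ^+ 2 = (c ^+ 2 + s' ^+ 2) ^+ 2 * (w0 * w2 - w1 ^+ 2) by rewrite c1 expr1n mul1r.
rewrite -subr_ge0.
(* The defect in Hadamard's inequality is the square of the off-diagonal entry of the rotated
   matrix. *)
set X := _ - _; have -> : X = (- s' * c * w0 + (c ^+ 2 - s' ^+ 2) * w1 + c * s' * w2) ^+ 2.
  by rewrite /X; ring.
exact: sqr_ge0.
Qed.

End Fractal.

(** * The asymptotics of kappa *)

Section Scales.
Context {R : realType} (rho b p : R).
Hypotheses (rho1 : 1 < rho) (b1 : 1 < b) (p0 : 0 <= p) (rho_p : rho `^ p = b).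

Let rho_gt0 : 0 < rho. Proof. exact: lt_trans ltr01 rho1. Qed.
Let rhon_gt0 n : 0 < rho ^+ n. Proof. exact: exprn_gt0. Qed.

Lemma scale_powR n : (rho ^+ n) `^ p = b ^+ n.
Proof.
have r0 := ltW rho_gt0; rewrite -powR_mulrn// powRAC rho_p powR_mulrn//.
exact/ltW/(lt_trans ltr01 b1).
Qed.

Lemma scale_exists (x : R) : exists n, x <= rho ^+ n.
Proof.
have h : 0 < rho - 1 by rewrite subr_gt0.
pose n := (Num.Def.archi_bound (x / (rho - 1))).
have := archi_boundP (x := `|x| / (rho - 1)) _ => /(_ (divr_ge0 (normr_ge0 _) (ltW h))).
set m := Num.bound _ => hm; exists m.
have bern k : 1 + k%:R * (rho - 1) <= rho ^+ k.
  elim: k => [|k IH]; first by rewrite mul0r addr0 expr0.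
  rewrite exprS -natr1; have k0 : 0 <= k%:R :> R by [].
  apply: (@le_trans _ _ (rho * (1 + k%:R * (rho - 1)))); last by rewrite ler_wpM2l// ltW.
  have : 0 <= k%:R * (rho - 1) * (rho - 1) by rewrite !mulr_ge0// ltW.
  lra.
apply: le_trans (bern m); rewrite ltr_pdivrMr// in hm.
by have := ler_norm x; lra.
Qed.

Lemma scale_between (x : R) : 1 <= x -> exists n, rho ^+ n <= x <= rho ^+ n.+1.
Proof.
move=> x1; have [m hm] := scale_exists x.
elim: m hm => [|m IH] hm.
  by exists 0%N; rewrite expr0 x1/= expr1; move: hm; rewrite expr0 => /le_trans; apply; exact: ltW.
have [h|h] := leP x (rho ^+ m); first exact: IH.
by exists m; rewrite hm ltW.
Qed.

Lemma powR_scale_le (x y : R) : 0 <= x -> x <= y -> x `^ p <= y `^ p.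
Proof. by move=> x0 xy; apply: ge0_ler_powR => //; rewrite nnegrE// (le_trans x0). Qed.

Lemma scale_up (A : R) : 0 < A -> exists2 C : R, 0 < C & forall r, 1 < r ->
  exists n, A * r <= rho ^+ n /\ b ^+ n <= C * r `^ p.
Proof.
move=> A0; have Ap : 0 < A `^ p by rewrite powR_gt0.
have b0 : 0 < b := lt_trans ltr01 b1.
(* The summand 1 serves the case [A r <= 1], where [n = 0]; the factor [b] is the price of rounding
   up to the next power of [rho]. *)
exists (1 + b * A `^ p); first by rewrite addr_gt0// mulr_gt0.
move=> r r1; have r0 : 0 < r := lt_trans ltr01 r1.
have rp : 1 <= r `^ p by have := powR_scale_le ler01 (ltW r1); rewrite powR1.
have [h|h] := leP (A * r) 1.
  by exists 0%N; rewrite !expr0; split=> //; have : 0 < b * A `^ p * r `^ p; [rewrite !mulr_gt0// powR_gt0|lra].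
have [n /andP[n1 n2]] := scale_between (ltW h); exists n.+1; split=> //.
have := powR_scale_le (ltW (rhon_gt0 n)) n1.
rewrite scale_powR powRM ?(ltW A0) ?(ltW r0)// exprS => hb.
have : b * b ^+ n <= b * (A `^ p * r `^ p) by rewrite ler_wpM2l// ltW.
lra.
Qed.

(** All powers of [rho] are at least 1, so no level lies below [A r] when that is less than 1; the
    second alternative covers this case, where a trivial lower bound by 1 is enough. *)
Lemma scale_down (A : R) : 0 < A -> exists2 C : R, 0 < C & forall r, 1 < r ->
  (exists n, rho ^+ n <= A * r /\ C * r `^ p <= b ^+ n) \/ C * r `^ p <= 1.
Proof.
move=> A0; have Ap : 0 < A `^ p by rewrite powR_gt0.
have b0 : 0 < b := lt_trans ltr01 b1.
exists (A `^ p / b); first by rewrite divr_gt0.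
move=> r r1; have r0 : 0 < r := lt_trans ltr01 r1.
rewrite mulrAC ler_pdivrMr// mul1r.
have [h|h] := leP (A * r) 1.
  right; rewrite -powRM ?(ltW A0) ?(ltW r0)//; apply: (@le_trans _ _ 1); last exact: ltW.
  by have := powR_scale_le (mulr_ge0 (ltW A0) (ltW r0)) h; rewrite powR1.
have [n /andP[n1 n2]] := scale_between (ltW h); left; exists n; split=> //.
have := powR_scale_le (mulr_ge0 (ltW A0) (ltW r0)) n2.
by rewrite scale_powR powRM ?(ltW A0) ?(ltW r0)// exprS ler_pdivrMr// mulrC (mulrC b).
Qed.

End Scales.

Section Kappa.
Context {R : realType} {a : R} {beta : nat} {phi : R -> R} (F : fractal a beta phi).
Local Notation b := (beta%:R : R).
Local Notation rho := (b / a).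
Local Notation det s t := (\det (Omega (Hamiltonian phi) s t)).

Lemma fr_rho_gt1 : 1 < rho.
Proof.
rewrite ltr_pdivlMr ?(fr_a_gt0 F)// mul1r.
exact: lt_trans (fr_a_lt1 F) (fr_b_gt1 F).
Qed.

Lemma fr_rhonV n : a ^+ n / b ^+ n = (rho ^+ n)^-1.
Proof. by rewrite expr_div_n invf_div. Qed.

(** Over an interval shorter than a cell the determinant stays below [c / r ^ 2], so every step but
    the last is at least one cell long and [j - 1 <= b ^ n]. The factor [frC F ^ 2 / c + 1] is a
    root-free majorant of [frC F / sqrt c]. *)
Lemma kappa_long (c r : R) n j : 0 < c -> 0 < r -> (frC F ^+ 2 / c + 1) * r <= rho ^+ n ->
  kappa_spec (Hamiltonian phi) c r j -> j%:R <= 2 * b ^+ n.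
Proof.
move=> c0 r0 hn [j0 [sg [sg0 [sgj [hs hl]]]]].
have bn := fr_bn_gt0 F n; have an := fr_an_gt0 F n; have C0 := frC_gt0 F.
have rho0 : 0 < rho := lt_trans ltr01 fr_rho_gt1.
have rn : 0 < rho ^+ n by rewrite exprn_gt0.
have small : (frC F * a ^+ n) ^+ 2 / (b ^+ n) ^+ 2 < c / r ^+ 2.
  have -> : (frC F * a ^+ n) ^+ 2 / (b ^+ n) ^+ 2 = (frC F / rho ^+ n) ^+ 2.
    by rewrite -[(rho ^+ n)^-1]fr_rhonV; field; rewrite gt_eqF.
  rewrite expr_div_n ltr_pdivrMr ?exprn_gt0// mulrAC ltr_pdivlMr ?exprn_gt0//.
  have : frC F ^+ 2 < c * (frC F ^+ 2 / c + 1) ^+ 2.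
    set u := frC F ^+ 2; have u0 : 0 < u by rewrite exprn_gt0.
    have -> : c * (u / c + 1) ^+ 2 = u + (u ^+ 2 / c + u + c) by field; rewrite gt_eqF.
    by rewrite ltrDl !addr_gt0 ?divr_gt0 ?exprn_gt0.
  move=> h; apply: (@lt_le_trans _ _ (c * ((frC F ^+ 2 / c + 1) * r) ^+ 2)).
    set u := _ / _ + 1 in h *; have -> : c * (u * r) ^+ 2 = c * u ^+ 2 * r ^+ 2 by ring.
    by rewrite ltr_pM2r ?exprn_gt0.
  rewrite ler_wpM2l ?(ltW c0)// lerXn2r ?nnegrE ?(ltW rn)//.
  by rewrite mulr_ge0 ?(ltW r0)// addr_ge0// divr_ge0 ?sqr_ge0 ?ltW.
have ind i : (i < j)%N -> i%:R / b ^+ n <= sg i.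
  elim: i => [|i IH] ij; first by rewrite mul0r sg0.
  have := hs i.+1; rewrite /= ij => /(_ isT) [_ [/andP[s1 s2] s3]].
  have := IH (ltnW ij); rewrite -natr1 mulrDl mul1r => h.
  suff : (b ^+ n)^-1 <= sg i.+1 - sg i by lra.
  rewrite leNgt; apply/negP => len.
  have := det_Omega_upper F (ltW s1) (ltW len); rewrite s3; apply/negP; rewrite -ltNge.
  apply: le_lt_trans small; rewrite ler_wpM2l ?sqr_ge0// -exprVn lerXn2r ?nnegrE ?invr_ge0 ?(ltW bn)//.
    by rewrite subr_ge0 ltW.
  exact: ltW.
case: j j0 sgj hs hl ind => // j _ sgj hs hl ind.
have := ind j (ltnSn j).
have : sg j <= 1.
  case: j sgj hs hl ind => [|j] sgj hs hl ind; first by rewrite sg0.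
  by have := hs j.+1; rewrite /= ltnSn => /(_ isT) [_ [/andP[_ /ltW]]].
move=> h1 /le_trans/(_ h1); rewrite ler_pdivrMr// mul1r -natr1.
by have := fr_bn_ge1 F n; lra.
Qed.

Lemma node_inside (n : nat) (s t : R) : 0 <= s -> 2 / b ^+ n <= t - s ->
  exists k, s <= k%:R / b ^+ n /\ k.+1%:R / b ^+ n <= t.
Proof.
move=> s0 st; have bn := fr_bn_gt0 F n.
(* The node [k + 1] is the first one beyond [s]. *)
pose k := Num.truncn (s * b ^+ n).
have sb : 0 <= s * b ^+ n by rewrite mulr_ge0// ltW.
have /andP[k1 k2] := truncn_itv sb; exists k.+1; split.
  by rewrite ler_pdivlMr// ltW.
rewrite ler_pdivrMr//; rewrite ler_pdivrMr// in st.
by rewrite -[k.+2%:R]natr1 -natr1; lra.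
Qed.

(** An interval longer than two cells contains a whole one, and its determinant exceeds [c / r ^ 2];
    so each step, the last included, is at most two cells long. With [x = m / c], the factor
    [x / (1 + x)] is a root-free lower bound for [sqrt x]. *)
Lemma kappa_short (m c r : R) n j : 0 < m -> 0 < c -> 0 < r ->
  (forall n k s t, s <= k%:R / b ^+ n -> k.+1%:R / b ^+ n <= t ->
     m * (a ^+ n / b ^+ n) ^+ 2 <= det s t) ->
  rho ^+ n <= (m / c / (1 + m / c)) * r ->
  kappa_spec (Hamiltonian phi) c r j -> b ^+ n <= 2 * j%:R.
Proof.
move=> m0 c0 r0 hm hn [j0 [sg [sg0 [sgj [hs hl]]]]].
have bn := fr_bn_gt0 F n.
have rho0 : 0 < rho := lt_trans ltr01 fr_rho_gt1.
have rn : 0 < rho ^+ n by rewrite exprn_gt0.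
have big : c / r ^+ 2 < m * (a ^+ n / b ^+ n) ^+ 2.
  rewrite fr_rhonV exprVn ltr_pdivrMr ?exprn_gt0// mulrAC ltr_pdivlMr ?exprn_gt0//.
  set x := m / c in hn.
  have x0 : 0 < x by rewrite divr_gt0.
  have -> : m = c * x by rewrite /x; field; rewrite gt_eqF.
  rewrite -mulrA ltr_pM2l//.
  apply: (@le_lt_trans _ _ ((x / (1 + x) * r) ^+ 2)).
    by rewrite lerXn2r ?nnegrE ?(ltW rn)// (le_trans (ltW rn)).
  rewrite exprMn ltr_pM2r ?exprn_gt0// expr_div_n ltr_pdivrMr ?exprn_gt0 ?addr_gt0//.
  have -> : x * (1 + x) ^+ 2 = x ^+ 2 + (x + x ^+ 2 + x ^+ 3) by ring.
  by rewrite ltrDl !addr_gt0 ?exprn_gt0.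
have short s t : 0 <= s -> det s t <= c / r ^+ 2 -> t - s <= 2 / b ^+ n.
  move=> s0 h; rewrite leNgt; apply/negP => /ltW/(node_inside s0)[k [k1 k2]].
  by have := lt_le_trans big (hm _ _ _ _ k1 k2); rewrite ltNge h.
have ind i : (i < j)%N -> 0 <= sg i <= i%:R * (2 / b ^+ n).
  elim: i => [|i IH] ij; first by rewrite sg0 mul0r lexx.
  have := hs i.+1; rewrite /= ij => /(_ isT) [_ [/andP[s1 s2] s3]].
  have /andP[h1 h2] := IH (ltnW ij).
  have := short _ (sg i.+1) h1; rewrite s3 lexx => /(_ isT).
  by rewrite -natr1 mulrDl mul1r; lra.
case: j j0 sgj hs hl ind => // j _ sgj hs hl ind.
have /andP[h1 h2] := ind j (ltnSn j).
have := short _ 1 h1 hl => h3.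
have : 1 <= j.+1%:R * (2 / b ^+ n) by rewrite -natr1 mulrDl mul1r; lra.
by rewrite mulrA ler_pdivlMr// mul1r mulrC.
Qed.

Lemma kappa_asymp (c p : R) (kappa : R -> nat) : 0 < c -> 0 <= p -> rho `^ p = b ->
  (forall r, 0 < r -> kappa_spec (Hamiltonian phi) c r (kappa r)) ->
  exists C1 C2 : R, 0 < C1 /\ 0 < C2 /\ forall r, 1 < r ->
     C1 * r `^ p <= (kappa r)%:R <= C2 * r `^ p.
Proof.
move=> c0 p0 rp hk.
have b1 := fr_b_gt1 F.
have [m m0 hm] := det_Omega_lower F.
have A1 : 0 < m / c / (1 + m / c) by rewrite !divr_gt0 ?addr_gt0 ?divr_gt0.
have A2 : 0 < frC F ^+ 2 / c + 1 by rewrite addr_gt0// divr_gt0// exprn_gt0// frC_gt0.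
have [C1 C10 h1] := scale_down fr_rho_gt1 b1 p0 rp A1.
have [C2 C20 h2] := scale_up fr_rho_gt1 b1 p0 rp A2.
exists (C1 / 2), (2 * C2); split; first by rewrite divr_gt0.
split; first by rewrite mulr_gt0.
move=> r r1; have r0 : 0 < r := lt_trans ltr01 r1; apply/andP; split.
  have [[n [n1 n2]]|h] := h1 r r1.
    by have := kappa_short m0 c0 r0 hm n1 (hk r r0); lra.
  (* No level is available for such [r], and [kappa r >= 1] suffices. *)
  have [j0 _] := hk r r0; have : 1 <= (kappa r)%:R :> R by rewrite ler1n.
  lra.
have [n [n1 n2]] := h2 r r1.
by have := kappa_long c0 r0 n1 (hk r r0); lra.
Qed.

End Kappa.

(** * Growth of the monodromy matrix *)

Lemma mxint_refl {R : realType} (m n : nat) (s : R) (G : R -> 'M[R]_(m, n)) : mxint s s G = 0.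
Proof. by apply/matrixP => i j; rewrite !mxE rint_refl. Qed.

Section RowSystem.
Context {R : realType} (phi : R -> R).

(** A complex row [f = a + i b] with [f' J = z f H], [z = x + i y], split into real and imaginary
    parts. As [H = xi xi^T], the equation reads [f' = z (f xi) (- sin phi, cos phi)], and [s + i sg]
    is [f xi]. *)
Definition row_solution (x y : R) (a1 a2 b1 b2 : R -> R) : Prop :=
  let s t := a1 t * cos (phi t) + a2 t * sin (phi t) in
  let sg t := b1 t * cos (phi t) + b2 t * sin (phi t) in
  [/\ smooth 0 1 a1 (fun t => - (sin (phi t) * (x * s t - y * sg t))),
      smooth 0 1 a2 (fun t => cos (phi t) * (x * s t - y * sg t)),
      smooth 0 1 b1 (fun t => - (sin (phi t) * (x * sg t + y * s t))) &
      smooth 0 1 b2 (fun t => cos (phi t) * (x * sg t + y * s t))].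

(** The complex combination [f + i g], with [g] the primed row: the real part of [i g] is minus the
    imaginary part of [g], its imaginary part the real part of [g]. *)
Lemma row_solution_comb x y a1 a2 b1 b2 a1' a2' b1' b2' :
  row_solution x y a1 a2 b1 b2 -> row_solution x y a1' a2' b1' b2' ->
  row_solution x y (fun t => a1 t - b1' t) (fun t => a2 t - b2' t)
    (fun t => b1 t + a1' t) (fun t => b2 t + a2' t).
Proof.
move=> [h1 h2 h3 h4] [k1 k2 k3 k4]; split.
- by apply: smooth_eq (smooth_add h1 (smooth_opp k3)) => t _; ring.
- by apply: smooth_eq (smooth_add h2 (smooth_opp k4)) => t _; ring.
- by apply: smooth_eq (smooth_add h3 k1) => t _; ring.
- by apply: smooth_eq (smooth_add h4 k2) => t _; ring.
Qed.

Lemma ord2_lift : lift ord0 ord0 = ord_max :> 'I_2. Proof. exact: val_inj. Qed.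

Lemma Hamiltonian_entries t :
  [/\ Hamiltonian phi t ord0 ord0 = cos (phi t) ^+ 2,
      Hamiltonian phi t ord0 ord_max = cos (phi t) * sin (phi t),
      Hamiltonian phi t ord_max ord0 = cos (phi t) * sin (phi t) &
      Hamiltonian phi t ord_max ord_max = sin (phi t) ^+ 2].
Proof.
have HE i j : Hamiltonian phi t i j = xi (phi t) i 0 * xi (phi t) j 0.
  by rewrite /Hamiltonian !mxE big_ord1 !mxE.
by rewrite !HE !mxE /= !expr2; split=> //; rewrite mulrC.
Qed.

Lemma mulHJ (M : 'M[R]_2) t i :
  let u := M i ord0 * cos (phi t) + M i ord_max * sin (phi t) in
  (M *m Hamiltonian phi t *m Jmx R) i ord0 = sin (phi t) * u /\
  (M *m Hamiltonian phi t *m Jmx R) i ord_max = - (cos (phi t) * u).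
Proof.
have [h00 h01 h10 h11] := Hamiltonian_entries t.
have MH j : (M *m Hamiltonian phi t) i j =
    M i ord0 * Hamiltonian phi t ord0 j + M i ord_max * Hamiltonian phi t ord_max j.
  by rewrite mxE !big_ord_recl big_ord0 addr0 ord2_lift.
have MJ j : (M *m Hamiltonian phi t *m Jmx R) i j =
    (M *m Hamiltonian phi t) i ord0 * Jmx R ord0 j +
    (M *m Hamiltonian phi t) i ord_max * Jmx R ord_max j.
  by rewrite [LHS]mxE !big_ord_recl big_ord0 addr0 ord2_lift.
by rewrite !MJ !MH h00 h01 h10 h11 !mxE /=; split; ring.
Qed.

Hypothesis cphi : continuous phi.

Let ccos l r : wcont l r (fun t => cos (phi t)).
Proof.
apply: wcont_continuous => x; apply: continuous_comp; [exact: cphi|exact: continuous_cos].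
Qed.
Let csin l r : wcont l r (fun t => sin (phi t)).
Proof.
apply: wcont_continuous => x; apply: continuous_comp; [exact: cphi|exact: continuous_sin].
Qed.

Lemma fundamental_row (Wr Wi : R -> R -> R -> 'M[R]_2) (x y : R) (i : 'I_2) :
  is_fundamental_solution (Hamiltonian phi) Wr Wi ->
  row_solution x y (fun t => Wr x y t i ord0) (fun t => Wr x y t i ord_max)
    (fun t => Wi x y t i ord0) (fun t => Wi x y t i ord_max).
Proof.
move=> /(_ x y) [cr [ci hW]].
have cs : wcont 0 1 (fun t => Wr x y t i ord0 * cos (phi t) + Wr x y t i ord_max * sin (phi t)).
  by apply: wcont_add; apply: wcont_mul => //; exact: cr.
have csg : wcont 0 1 (fun t => Wi x y t i ord0 * cos (phi t) + Wi x y t i ord_max * sin (phi t)).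
  by apply: wcont_add; apply: wcont_mul => //; exact: ci.
have ode (f g : R -> R) (k : R) : wcont 0 1 g ->
    (forall t, 0 <= t <= 1 -> f t = k - rint 0 t g) -> smooth 0 1 f (fun t => - g t).
  move=> cg hf; apply: smooth_eq (smooth_of_integral (k := k) (c := -1) cg _) => [t _|t t01].
    by rewrite mulN1r.
  by rewrite mulN1r hf.
split.
- have e := ode _ (fun t => sin (phi t) * (x * (Wr x y t i ord0 * cos (phi t) + Wr x y t i ord_max * sin (phi t))
     - y * (Wi x y t i ord0 * cos (phi t) + Wi x y t i ord_max * sin (phi t)))) ((1%:M : 'M[R]_2) i ord0).
  apply: e.
    by apply: wcont_mul => //; apply: wcont_add; [|apply: wcont_opp]; apply: wcont_mul => //; exact: wcont_cst.
  move=> t t01; have [-> _] := hW t t01; rewrite !mxE; congr (_ - _).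
  by apply: rint_ext => u _; rewrite (mulHJ _ u i).1 !mxE; ring.
- have e := ode _ (fun t => - (cos (phi t) * (x * (Wr x y t i ord0 * cos (phi t) + Wr x y t i ord_max * sin (phi t))
     - y * (Wi x y t i ord0 * cos (phi t) + Wi x y t i ord_max * sin (phi t))))) ((1%:M : 'M[R]_2) i ord_max).
  apply: smooth_eq (e _ _ _) => [t _||]; first by rewrite opprK.
    by apply: wcont_opp; apply: wcont_mul => //; apply: wcont_add; [|apply: wcont_opp]; apply: wcont_mul => //; exact: wcont_cst.
  move=> t t01; have [-> _] := hW t t01; rewrite !mxE; congr (_ - _).
  by apply: rint_ext => u _; rewrite (mulHJ _ u i).2 !mxE; ring.
- have e := ode _ (fun t => sin (phi t) * (x * (Wi x y t i ord0 * cos (phi t) + Wi x y t i ord_max * sin (phi t))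
     + y * (Wr x y t i ord0 * cos (phi t) + Wr x y t i ord_max * sin (phi t)))) 0.
  apply: e.
    by apply: wcont_mul => //; apply: wcont_add; apply: wcont_mul => //; exact: wcont_cst.
  move=> t t01; have [_ ->] := hW t t01; rewrite !mxE sub0r; congr (- _).
  by apply: rint_ext => u _; rewrite (mulHJ _ u i).1 !mxE; ring.
- have e := ode _ (fun t => - (cos (phi t) * (x * (Wi x y t i ord0 * cos (phi t) + Wi x y t i ord_max * sin (phi t))
     + y * (Wr x y t i ord0 * cos (phi t) + Wr x y t i ord_max * sin (phi t))))) 0.
  apply: smooth_eq (e _ _ _) => [t _||]; first by rewrite opprK.
    by apply: wcont_opp; apply: wcont_mul => //; apply: wcont_add; apply: wcont_mul => //; exact: wcont_cst.
  move=> t t01; have [_ ->] := hW t t01; rewrite !mxE sub0r; congr (- _).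
  by apply: rint_ext => u _; rewrite (mulHJ _ u i).2 !mxE; ring.
Qed.

Lemma fundamental_init (Wr Wi : R -> R -> R -> 'M[R]_2) (x y : R) (i j : 'I_2) :
  is_fundamental_solution (Hamiltonian phi) Wr Wi ->
  Wr x y 0 i j = (i == j)%:R /\ Wi x y 0 i j = 0.
Proof.
move=> /(_ x y) [_ [_ hW]]; have t0 : 0 <= (0 : R) <= 1 by rewrite lexx ler01.
have [e1 e2] := hW 0 t0.
by rewrite e1 e2 !mxint_refl subr0 oppr0 !mxE.
Qed.

End RowSystem.

(** * Upper bound: energy in the rotating frame *)

Lemma abs_le_of_sqr {R : realType} (z w : R) : 0 <= w -> z ^+ 2 <= w ^+ 2 -> `|z| <= w.
Proof.
move=> w0 h; rewrite -(ger0_norm w0).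
by rewrite -(@ler_pXn2r _ 2) ?nnegrE// !real_normK ?num_real.
Qed.

(** Here [(ua + i ub, va + i vb)] is the row in the rotating frame, [(cd, sd)] the direction of [H]
    there, [S] the speed of the frame and [e = a ^ n]. Relative to the weighted norm [N], the term
    in [sd] is [O (e r)] because [sd = O (e)], and the term in [cd] because it meets [e ^ 2 v],
    where [e v] is controlled by [N]. The rotation terms cancel up to the factor [1 - e ^ 2], and
    [2 e |ua va + ub vb| <= N]. *)
Lemma rotating_energy {R : realType} (ua ub va vb sd cd S x y r e B Lam : R) :
  0 < e -> e <= 1 -> 0 < B -> 0 <= r -> cd ^+ 2 + sd ^+ 2 = 1 -> x ^+ 2 + y ^+ 2 = r ^+ 2 ->
  `|sd| <= B * e -> `|S| <= Lam * e ->
  forall s sg p q, s = cd * ua + sd * va -> sg = cd * ub + sd * vb ->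
  p = x * s - y * sg -> q = x * sg + y * s ->
  2 * ua * (- sd * p + S * va) + 2 * ub * (- sd * q + S * vb) +
    e ^+ 2 * (2 * va * (cd * p - S * ua) + 2 * vb * (cd * q - S * ub)) <=
  (2 * (B + 1) * (2 * (1 + B ^+ 2)) * (e * r) + Lam) *
    (ua ^+ 2 + ub ^+ 2 + e ^+ 2 * (va ^+ 2 + vb ^+ 2)).
Proof.
move=> e0 e1 B0 r0 cs xyr hsd hS s sg p q sE sgE pE qE.
set N := ua ^+ 2 + ub ^+ 2 + _; set M := 2 * (1 + B ^+ 2).
have N0 : 0 <= N.
  apply: addr_ge0; first by apply: addr_ge0; exact: sqr_ge0.
  by rewrite mulr_ge0 ?addr_ge0 ?sqr_ge0.
have M1 : 1 <= M by rewrite /M; have := sqr_ge0 B; lra.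
have sd2 : sd ^+ 2 <= B ^+ 2 * e ^+ 2.
  by rewrite -exprMn -[leLHS]real_normK ?num_real// lerXn2r ?nnegrE// mulr_ge0 ?ltW.
have cd2 : cd ^+ 2 <= 1 by rewrite -cs lerDl sqr_ge0.
have lin (u v : R) : (cd * u + sd * v) ^+ 2 <= 2 * u ^+ 2 + 2 * (B ^+ 2 * (e ^+ 2 * v ^+ 2)).
  have h1 : (sd * v) ^+ 2 <= B ^+ 2 * e ^+ 2 * v ^+ 2 by rewrite exprMn ler_wpM2r ?sqr_ge0.
  have h2 : (cd * u) ^+ 2 <= u ^+ 2 by rewrite exprMn ler_piMl ?sqr_ge0.
  have := sqr_ge0 (cd * u - sd * v); lra.
have sN : s ^+ 2 + sg ^+ 2 <= M * N.
  have h1 := lin ua va; have h2 := lin ub vb.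
  have B2 := sqr_ge0 B; have a2 := sqr_ge0 ua; have b2 := sqr_ge0 ub.
  have e2 : 0 <= e ^+ 2 * (va ^+ 2 + vb ^+ 2) by rewrite mulr_ge0 ?addr_ge0 ?sqr_ge0.
  have h3 : 0 <= B ^+ 2 * (ua ^+ 2 + ub ^+ 2) by rewrite mulr_ge0 ?addr_ge0.
  rewrite sE sgE /M /N; lra.
have pq : p ^+ 2 + q ^+ 2 <= r ^+ 2 * (M * N).
  have -> : p ^+ 2 + q ^+ 2 = r ^+ 2 * (s ^+ 2 + sg ^+ 2) by rewrite -xyr pE qE; ring.
  by rewrite ler_wpM2l ?sqr_ge0.
have M0 : 0 <= M := le_trans ler01 M1.
have MN : 0 <= M * N by exact: mulr_ge0.
have rMN : 0 <= r * (M * N) by exact: mulr_ge0.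
(* [M >= 1] turns the Cauchy-Schwarz bound [r N sqrt M] into the root-free [r M N]. *)
have cauchy (u v : R) : u ^+ 2 + v ^+ 2 <= N -> `|u * p + v * q| <= r * (M * N).
  move=> uvN; apply: abs_le_of_sqr => //.
  have h1 : (u * p + v * q) ^+ 2 <= (u ^+ 2 + v ^+ 2) * (p ^+ 2 + q ^+ 2).
    by have := sqr_ge0 (u * q - v * p); lra.
  apply: (le_trans h1); apply: (@le_trans _ _ (N * (r ^+ 2 * (M * N)))).
    by apply: ler_pM; rewrite ?addr_ge0 ?sqr_ge0.
  have -> : (r * (M * N)) ^+ 2 = N * (r ^+ 2 * (M * N)) * M by ring.
  by rewrite ler_peMr// mulr_ge0// mulr_ge0 ?sqr_ge0.
have c1 : `|ua * p + ub * q| <= r * (M * N).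
  by apply: cauchy; rewrite /N lerDl mulr_ge0 ?addr_ge0 ?sqr_ge0.
have c2 : `|(e * va) * p + (e * vb) * q| <= r * (M * N).
  by apply: cauchy; rewrite /N !exprMn -mulrDr lerDr addr_ge0 ?sqr_ge0.
have t1 : `|sd * (ua * p + ub * q)| <= B * e * (r * (M * N)) by rewrite normrM ler_pM.
have t2 : `|cd * ((e * va) * p + (e * vb) * q)| <= 1 * (r * (M * N)).
  rewrite normrM ler_pM//; apply: abs_le_of_sqr => //; rewrite expr1n//.
have t3 : `|2 * e * (ua * va + ub * vb)| <= N.
  have h1 := sqr_ge0 (ua - e * va); have h2 := sqr_ge0 (ub - e * vb).
  have h3 := sqr_ge0 (ua + e * va); have h4 := sqr_ge0 (ub + e * vb).
  by rewrite ler_norml /N; apply/andP; split; lra.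
have t4 : `|S * (2 * e * (ua * va + ub * vb))| <= Lam * e * N by rewrite normrM ler_pM.
set c := ua * va + ub * vb in t3 t4.
have t5 : S * (2 * c) * (1 - e ^+ 2) <= Lam * N.
  have e2 : 0 <= 1 - e ^+ 2 by rewrite subr_ge0 exprn_ile1 ?(ltW e0).
  have LN : 0 <= Lam * N.
    rewrite mulr_ge0// -(pmulr_lge0 _ e0); exact: le_trans (normr_ge0 _) hS.
  have h : S * (2 * c) <= Lam * N.
    rewrite -(ler_pM2l e0); move: t4; rewrite ler_norml => /andP[_]; lra.
  apply: (@le_trans _ _ (Lam * N * (1 - e ^+ 2))); first by rewrite ler_wpM2r.
  by rewrite ler_piMr// gerBl sqr_ge0.
have -> : 2 * ua * (- sd * p + S * va) + 2 * ub * (- sd * q + S * vb) +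
    e ^+ 2 * (2 * va * (cd * p - S * ua) + 2 * vb * (cd * q - S * ub)) =
  - 2 * (sd * (ua * p + ub * q)) + 2 * e * (cd * ((e * va) * p + (e * vb) * q)) +
    S * (2 * c) * (1 - e ^+ 2) by rewrite /c; ring.
have -> : (2 * (B + 1) * M * (e * r) + Lam) * N =
  2 * (B * e * (r * (M * N))) + 2 * e * (r * (M * N)) + Lam * N by ring.
rewrite !lerD//.
  by move: t1; rewrite ler_norml => /andP[? _]; lra.
rewrite ler_wpM2l ?mulr_ge0 ?(ltW e0)//.
by move: t2; rewrite mul1r => t2; exact: le_trans (ler_norm _) t2.
Qed.

Section MonodromyUpper.
Context {R : realType} {a : R} {beta : nat} {phi : R -> R} (F : fractal a beta phi).
Local Notation b := (beta%:R : R).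
Local Notation rho := (b / a).

(** The constant of [rotating_energy] at [e = a ^ n], in units of [b ^ n]; the factor [rho] comes
    from [a ^ n r <= rho b ^ n] for [r <= rho ^ n.+1]. *)
Definition upper_rate : R :=
  2 * (frB F + 1) * (2 * (1 + frB F ^+ 2)) * rho + frL F.

Lemma upper_rate_ge0 : 0 <= upper_rate.
Proof.
have B0 := frB_gt0 F; have L0 := frL_gt0 F; have r1 := fr_rho_gt1 F.
have h : 0 <= 1 + frB F ^+ 2 by rewrite addr_ge0 ?sqr_ge0.
by apply: addr_ge0; [apply: mulr_ge0; [apply: mulr_ge0|]|]; lra.
Qed.

(** The factor [a ^ 2n] is lost when the weighted energy is compared with the plain norm at [1]; at
    [0] the comparison is free since [a ^ n <= 1]. *)
Lemma row_growth x y r n a1 a2 b1 b2 : 0 <= r -> x ^+ 2 + y ^+ 2 = r ^+ 2 ->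
  r <= rho ^+ n.+1 -> row_solution phi x y a1 a2 b1 b2 ->
  (a ^+ n) ^+ 2 * (a1 1 ^+ 2 + a2 1 ^+ 2 + (b1 1 ^+ 2 + b2 1 ^+ 2)) <=
  (a1 0 ^+ 2 + a2 0 ^+ 2 + (b1 0 ^+ 2 + b2 0 ^+ 2)) * expR (upper_rate * b ^+ n).
Proof.
move=> r0 xyr rn [s1 s2 s3 s4].
have e0 := fr_an_gt0 F n; have e1 := fr_an_le1 F n; have bn := fr_bn_gt0 F n.
have a0 := fr_a_gt0 F.
set e := a ^+ n in e0 e1 *.
have sS := smooth_global 0 1 (fr_deriv F n).
set S := frS F n in sS; set dS := frdS F n in sS.
have sc := smooth_cos sS; have sd := smooth_sin sS.
have u1 := smooth_add (smooth_mul s1 sc) (smooth_mul s2 sd).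
have v1 := smooth_add (smooth_opp (smooth_mul s1 sd)) (smooth_mul s2 sc).
have u2 := smooth_add (smooth_mul s3 sc) (smooth_mul s4 sd).
have v2 := smooth_add (smooth_opp (smooth_mul s3 sd)) (smooth_mul s4 sc).
have sE := smooth_add (smooth_add (smooth_sqr u1) (smooth_sqr u2))
  (smooth_mul (smooth_cst 0 1 (e ^+ 2)) (smooth_add (smooth_sqr v1) (smooth_sqr v2))).
have id1 (z w : R) t : (z * cos (S t) + w * sin (S t)) ^+ 2 +
    (- (z * sin (S t)) + w * cos (S t)) ^+ 2 = z ^+ 2 + w ^+ 2.
  by rewrite -[RHS]mulr1 -(cos2Dsin2 (S t)); ring.
have ee : e ^+ 2 <= 1 by rewrite exprn_ile1// ltW.
have arr0 (A B V W : R) : 0 <= V -> 0 <= W -> A + B + e ^+ 2 * (V + W) <= A + V + (B + W).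
  by move=> V0 W0; have : e ^+ 2 * (V + W) <= V + W; [rewrite ler_piMl// addr_ge0|lra].
have arr1 (A B V W : R) : 0 <= A -> 0 <= B ->
    e ^+ 2 * (A + V + (B + W)) <= A + B + e ^+ 2 * (V + W).
  by move=> V0 W0; have : e ^+ 2 * (A + B) <= A + B; [rewrite ler_piMl// addr_ge0|lra].
have := gronwall (C := upper_rate * b ^+ n) ler01 sE.
rewrite subr0 mulr1 => gr; have {}gr := gr _.
apply: le_trans (le_trans (gr _) _); last 1 first.
- rewrite ler_wpM2r ?expR_ge0//.
  rewrite -(id1 (a1 0) (a2 0) 0) -(id1 (b1 0) (b2 0) 0).
  by apply: arr0; exact: sqr_ge0.
- rewrite -(id1 (a1 1) (a2 1) 1) -(id1 (b1 1) (b2 1) 1).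
  by apply: arr1; exact: sqr_ge0.
move=> t /andP[t0 t1].
have nS := fr_near F n t; have dSb := fr_dS F n t.
pose del := phi t - S t.
have hsd : `|sin del| <= frB F * e by apply: (le_trans (abs_sin_le _)).
have hS : `|dS t| <= (frL F * b ^+ n) * e.
  by apply: (le_trans dSb); rewrite exprMn; rewrite (mulrC (a ^+ n)) mulrA.
have := @rotating_energy R (a1 t * cos (S t) + a2 t * sin (S t))
  (b1 t * cos (S t) + b2 t * sin (S t))
  (- (a1 t * sin (S t)) + a2 t * cos (S t)) (- (b1 t * sin (S t)) + b2 t * cos (S t))
  (sin del) (cos del) (dS t) x y r e (frB F) (frL F * b ^+ n)
  e0 e1 (frB_gt0 F) r0 (cos2Dsin2 del) xyr hsd hS _ _ _ _ erefl erefl erefl erefl.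
set N := (X in _ <= _ * X -> _).
have N0 : 0 <= N.
  apply: addr_ge0; first by rewrite addr_ge0 ?sqr_ge0.
  by rewrite mulr_ge0 ?addr_ge0 ?sqr_ge0.
have er : e * r <= rho * b ^+ n.
  apply: (@le_trans _ _ (e * rho ^+ n.+1)); first by rewrite ler_wpM2l// ltW.
  rewrite le_eqVlt; apply/orP; left; apply/eqP.
  by rewrite exprS expr_div_n /e; field; rewrite !gt_eqF ?exprn_gt0.
have rate : 2 * (frB F + 1) * (2 * (1 + frB F ^+ 2)) * (e * r) + frL F * b ^+ n <=
    upper_rate * b ^+ n.
  have B0 := frB_gt0 F; have h : 0 <= 1 + frB F ^+ 2 by rewrite addr_ge0 ?sqr_ge0.
  rewrite /upper_rate; set K := 2 * (frB F + 1) * _.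
  have K0 : 0 <= K by apply: mulr_ge0 => //; clear - B0 h; lra.
  by have := ler_wpM2l K0 er; clear; lra.
have cphi : cos (phi t) = cos del * cos (S t) - sin del * sin (S t).
  by rewrite -cosD /del subrK.
have sphi : sin (phi t) = sin del * cos (S t) + cos del * sin (S t).
  by rewrite -sinD /del subrK.
have xiu z w : z * cos (phi t) + w * sin (phi t) =
    cos del * (z * cos (S t) + w * sin (S t)) + sin del * (- (z * sin (S t)) + w * cos (S t)).
  by rewrite cphi sphi; ring.
move=> h; apply: le_trans (le_trans h _); last by rewrite ler_wpM2r.
rewrite !xiu.
set sa := cos del * _ + _; set sb := cos del * _ + _.
move: (x * sa - y * sb) (x * sb + y * sa) => p q.
rewrite cphi sphi le_eqVlt; apply/orP; left; apply/eqP.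
have cc := cos2Dsin2 (S t); move: (cos (S t)) (sin (S t)) cc => C D cc.
move: (cos del) (sin del) => CD SD.
set A1 := a1 t * C + a2 t * D; set A2 := b1 t * C + b2 t * D.
set V1 := - (a1 t * D) + a2 t * C; set V2 := - (b1 t * D) + b2 t * C.
have f1 z w P : - ((SD * C + CD * D) * P) * C + z * (- D * dS t) +
   ((CD * C - SD * D) * P * D + w * (C * dS t)) = - SD * P + dS t * (- (z * D) + w * C).
  by rewrite -[- SD * P]mulr1 -cc; ring.
have f2 z w P : - (- ((SD * C + CD * D) * P) * D + z * (C * dS t)) +
   ((CD * C - SD * D) * P * C + w * (- D * dS t)) = CD * P - dS t * (z * C + w * D).
  by rewrite -[CD * P]mulr1 -cc; ring.
by rewrite !f1 !f2 -/A1 -/A2 -/V1 -/V2; ring.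
Qed.

(** The loss [a ^ - 2n] is absorbed by the exponential, as [1 / a <= exp (1 / a)] and [n <= b ^ n]:
    hence [2 / a] in the rate. The summand 1 pays for the two rows through [2 <= exp (b ^ n)]. *)
Lemma cmx_norm_upper Wr Wi x y r n : is_fundamental_solution (Hamiltonian phi) Wr Wi ->
  0 <= r -> x ^+ 2 + y ^+ 2 = r ^+ 2 -> r <= rho ^+ n.+1 ->
  cmx_norm (Wr x y 1) (Wi x y 1) <= expR ((1 + 2 / a + upper_rate) * b ^+ n).
Proof.
move=> hW r0 xyr rn.
have a0 := fr_a_gt0 F; have e0 := fr_an_gt0 F n; have bn := fr_bn_ge1 F n.
have g i := row_growth r0 xyr rn (fundamental_row (fr_continuous F) x y i hW).
have {}g i : (a ^+ n) ^+ 2 * (Wr x y 1 i ord0 ^+ 2 + Wr x y 1 i ord_max ^+ 2 +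
    (Wi x y 1 i ord0 ^+ 2 + Wi x y 1 i ord_max ^+ 2)) <= expR (upper_rate * b ^+ n).
  apply: le_trans (g i) _.
  have h j : Wr x y 0 i j = (i == j)%:R /\ Wi x y 0 i j = 0
    by have := @fundamental_init R phi Wr Wi x y i j hW; apply.
  have [-> ->] := h ord0; have [-> ->] := h ord_max.
  case: i {h g} => [[|[|//]] hi]; rewrite -!val_eqE /= ?expr0n ?expr1n /= ?addr0 ?add0r ?mul1r; lra.
have expn : (n%:R <= b ^+ n).
  have b2 : 2 <= b by rewrite ler_nat -(ltr1n R) (fr_b_gt1 F).
  elim: {g rn e0 bn} n => [|n IH]; first by rewrite expr0 ler01.
  rewrite exprS -natr1; apply: (@le_trans _ _ (2 * b ^+ n)).
    by have := fr_bn_ge1 F n; lra.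
  by rewrite ler_wpM2r// (le_trans ler01)// fr_bn_ge1.
have inva : (a ^+ n)^-1 <= expR (1 / a * b ^+ n).
  rewrite -exprVn; apply: (@le_trans _ _ (expR (a^-1) ^+ n)).
    rewrite lerXn2r ?nnegrE ?expR_ge0 ?invr_ge0 ?(ltW a0)//.
    by have := expR_ge1Dx a^-1; lra.
  rewrite -expRM_natr ler_expR div1r ler_wpM2l// invr_ge0; exact: ltW.
set X := \sum_(i < 2) \sum_(j < 2) (Wr x y 1 i j ^+ 2 + Wi x y 1 i j ^+ 2).
have XE : X <= expR ((1 + 2 / a + upper_rate) * b ^+ n).
  have -> : X = \sum_(i < 2) (Wr x y 1 i ord0 ^+ 2 + Wr x y 1 i ord_max ^+ 2 +
    (Wi x y 1 i ord0 ^+ 2 + Wi x y 1 i ord_max ^+ 2)).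
    apply: eq_bigr => i _; rewrite !big_ord_recl big_ord0 ord2_lift addr0; ring.
  rewrite !big_ord_recl big_ord0 ord2_lift addr0.
  have g1 := g ord0; have g2 := g ord_max.
  move: g1 g2; set Y := _ + _; set Z := (_ + _) => g1 g2.
  have : (a ^+ n) ^+ 2 * (Y + Z) <= 2 * expR (upper_rate * b ^+ n) by lra.
  rewrite -ler_pdivlMl ?exprn_gt0// => h; apply: (le_trans h).
  have -> : (1 + 2 / a + upper_rate) * b ^+ n =
    1 / a * b ^+ n + 1 / a * b ^+ n + (b ^+ n + upper_rate * b ^+ n) by ring.
  rewrite expRD [expR (b ^+ n + _)]expRD expRD -exprVn expr2.
  apply: ler_pM; rewrite ?mulr_ge0 ?expR_ge0 ?invr_ge0 ?(ltW e0)//.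
    by apply: ler_pM; rewrite ?invr_ge0 ?(ltW e0).
  rewrite ler_wpM2r ?expR_ge0//.
  by have := expR_ge1Dx (b ^+ n); lra.
have X0 : 0 <= X by rewrite sumr_ge0// => i _; rewrite sumr_ge0// => j _; rewrite addr_ge0 ?sqr_ge0.
have G1 : 1 <= expR ((1 + 2 / a + upper_rate) * b ^+ n).
  rewrite -[leLHS]expR0 ler_expR mulr_ge0//.
  have := upper_rate_ge0; have : 0 < 2 / a by rewrite divr_gt0.
  lra.
(* From [X <= G] and [1 <= G] follows [sqrt X <= G]; the exponent need not be halved. *)
rewrite /cmx_norm -/X; set G := expR _ in XE G1 *.
apply: (@le_trans _ _ (Num.sqrt (G ^+ 2))); last by rewrite sqrtr_sqr ger0_norm ?(le_trans ler01).
by rewrite ler_wsqrtr// (le_trans XE)// expr2 ler_peMr ?(le_trans ler01).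
Qed.

End MonodromyUpper.

(* [2 |w| <= mu w ^ 2 + 1 / mu], integrated. *)
Lemma young_growth {R : realType} (t0 t1 c y mu : R) (f df D dD w : R -> R) :
  t0 <= t1 -> 0 <= c -> 0 < y -> 0 < mu -> smooth t0 t1 f df -> smooth t0 t1 D dD ->
  (forall t, t0 < t < t1 -> `|df t| <= c * (y * `|w t|)) ->
  (forall t, t0 < t < t1 -> y * w t ^+ 2 <= dD t) ->
  `|f t1 - f t0| <= c / 2 * (mu * (D t1 - D t0) + y / mu * (t1 - t0)).
Proof.
move=> t01 c0 y0 mu0 sf sD hf hD.
have sG := smooth_add (smooth_mul (smooth_cst t0 t1 (c / 2 * mu)) sD)
  (smooth_mul (smooth_cst t0 t1 (c / 2 * (y / mu))) (smooth_id t0 t1)).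
have key t : t0 < t < t1 -> `|df t| <= c / 2 * mu * dD t + c / 2 * (y / mu).
  move=> tt; apply: (le_trans (hf t tt)).
  have h1 : mu * (y * w t ^+ 2) <= mu * dD t by rewrite ler_wpM2l ?(ltW mu0)// hD.
  have h2 : 2 * (y * `|w t|) <= mu * (y * w t ^+ 2) + y / mu.
    rewrite -(real_normK (num_real (w t))); set n := `|w t|.
    have -> : mu * (y * n ^+ 2) + y / mu = 2 * (y * n) + y / mu * (mu * n - 1) ^+ 2.
      by field; rewrite gt_eqF.
    by rewrite lerDl mulr_ge0 ?sqr_ge0// divr_ge0// ltW.
  have -> : c / 2 * mu * dD t + c / 2 * (y / mu) = c / 2 * (mu * dD t + y / mu) by ring.
  have -> : c * (y * `|w t|) = c / 2 * (2 * (y * `|w t|)) by field.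
  rewrite ler_wpM2l ?divr_ge0//; lra.
have u1 := smooth_le t01 (smooth_add sG sf).
have u2 := smooth_le t01 (smooth_add sG (smooth_opp sf)).
have {}u1 := u1 _; have {}u2 := u2 _.
have e (f0 f1 D0 D1 : R) : c / 2 * mu * D0 + c / 2 * (y / mu) * t0 + f0 <=
   c / 2 * mu * D1 + c / 2 * (y / mu) * t1 + f1 ->
  - (f1 - f0) <= c / 2 * (mu * (D1 - D0) + y / mu * (t1 - t0)) by lra.
rewrite ler_norml; apply/andP; split.
  rewrite lerNl; apply: e; apply: u1 => t /key.
  by rewrite ler_norml => /andP[? ?]; lra.
have -> : f t1 - f t0 = - (- f t1 - - f t0) by ring.
apply: e; apply: u2 => t /key.
by rewrite ler_norml => /andP[? ?]; lra.
Qed.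

(** * Lower bound on the imaginary axis *)

Section MonodromyLower.
Context {R : realType} {a : R} {beta : nat} {phi : R -> R} (F : fractal a beta phi).
Local Notation b := (beta%:R : R).
Local Notation rho := (b / a).
Local Notation node n k := (k%:R / b ^+ n).

Section Disc.
Variables (y : R) (a1 a2 b1 b2 : R -> R).
Hypotheses (y0 : 0 < y) (sol : row_solution phi 0 y a1 a2 b1 b2).

Let s t := a1 t * cos (phi t) + a2 t * sin (phi t).
Let sg t := b1 t * cos (phi t) + b2 t * sin (phi t).
Let D t := a1 t * b2 t - a2 t * b1 t.

Lemma disc_smooth : smooth 0 1 D (fun t => y * (s t ^+ 2 + sg t ^+ 2)).
Proof.
case: sol => h1 h2 h3 h4.
apply: smooth_eq (smooth_add (smooth_mul h1 h4) (smooth_opp (smooth_mul h2 h3))) => t _.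
by rewrite /s /sg; ring.
Qed.

(* For nearly constant [(a, b)], the increment of [D] is [y (a^T Om a + b^T Om b)], which is
   at least [2 y sqrt (det Om) D]. *)
Lemma disc_growth t0 t1 n (m : R) : 0 <= t0 -> t0 <= t1 -> t1 <= 1 ->
  t1 - t0 <= (b ^+ n)^-1 -> y <= rho ^+ n.+1 -> 0 < m ->
  m ^+ 2 <= y ^+ 2 * \det (Omega (Hamiltonian phi) t0 t1) -> 0 < D t0 ->
  (1 + m / (1 + 8 * (rho * frC F) ^+ 2)) * D t0 <= D t1.
Proof.
move=> t00 t01 t11 len yn m0 hdet D0.
have C0 := frC_gt0 F; have bn := fr_bn_gt0 F n; have an := fr_an_gt0 F n.
have a_0 := fr_a_gt0 F; have r1 := fr_rho_gt1 F.
set K0 := rho * frC F; have K00 : 0 < K0 by rewrite mulr_gt0//; lra.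
set kap := m / _.
have den0 : 0 < 1 + 8 * K0 ^+ 2 by have := sqr_ge0 K0; lra.
have kap0 : 0 < kap by rewrite divr_gt0.
(* If [D] grew by less than the factor [1 + kap], the products of the row with [xi] would be small
   in mean square, the row would barely move, and freezing it at [t0] would produce the growth after
   all. *)
rewrite leNgt; apply/negP => small.
have l0 : t0 < t1.
  rewrite lt_neqAle t01 andbT; apply/negP => /eqP e; move: hdet.
  rewrite -e det_Omega /om0 /om1 /om2 !rint_refl mul0r expr0n subr0 mulr0.
  by rewrite leNgt exprn_gt0.
have sD := smooth_sub t00 t11 disc_smooth.
set e := frC F * a ^+ n; have e0 : 0 < e by rewrite mulr_gt0.
set l := t1 - t0; have ll : 0 < l by rewrite subr_gt0.
have yle : y * l * e <= K0.
  have : y * l <= rho ^+ n.+1 * (b ^+ n)^-1.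
    by apply: ler_pM => //; [exact: ltW|exact: ltW].
  move=> /(ler_wpM2r (ltW e0)) /le_trans; apply; rewrite le_eqVlt; apply/orP; left; apply/eqP.
  by rewrite /e /K0 exprS expr_div_n; field; rewrite !gt_eqF.
(* Young's parameter, chosen to make the two terms of the estimate equal; their common value is
   [G = sqrt (y l kap D(t0))]. *)
set mu := Num.sqrt (y * l / (kap * D t0)).
have kD0 : 0 < kap * D t0 := mulr_gt0 kap0 D0.
have yl0 : 0 < y * l := mulr_gt0 y0 ll.
have q0 : 0 < y * l / (kap * D t0) := divr_gt0 yl0 kD0.
have mu0 : 0 < mu by rewrite sqrtr_gt0.
have mu2 : mu ^+ 2 = y * l / (kap * D t0) by rewrite sqr_sqrtr// ltW.
set G := (mu * (kap * D t0) + y / mu * l) / 2.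
have ylm : y / mu * l = mu * (kap * D t0).
  have -> : y / mu * l = y * l / (kap * D t0) * (kap * D t0) / mu.
    by field; rewrite !gt_eqF.
  by rewrite -mu2; field; rewrite gt_eqF.
have Gm : G = mu * (kap * D t0) by rewrite /G ylm; field.
have G2 : G ^+ 2 = y * l * (kap * D t0).
  by rewrite Gm exprMn mu2; field; rewrite !gt_eqF.
have G0 : 0 < G by rewrite Gm; exact: mulr_gt0.
have Dmono t : t0 <= t -> t <= t1 -> D t <= D t1.
  move=> h1 h2; have := smooth_le h2 (smooth_sub h1 (lexx _) sD); apply => x _.
  by rewrite mulr_ge0 ?(ltW y0)// addr_ge0 ?sqr_ge0.
pose p0 := phi t0.
have osc t : t0 <= t -> t <= t1 -> `|sin (phi t - p0)| <= e.
  move=> h1 h2; apply: (le_trans (abs_sin_le _)); apply: fr_osc_cell.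
  by rewrite ger0_norm ?subr_ge0// (le_trans _ len)// lerD2r.
have bound c t (f df w : R -> R) : 0 <= c -> t0 <= t -> t <= t1 -> smooth 0 1 f df ->
    (forall x, t0 < x < t1 -> `|df x| <= c * (y * `|w x|)) ->
    (forall x, t0 < x < t1 -> y * w x ^+ 2 <= y * (s x ^+ 2 + sg x ^+ 2)) ->
    `|f t - f t0| <= c * G.
  move=> c0 h1 h2 sf hf hw.
  have := @young_growth _ t0 t c y mu f df D _ w h1 c0 y0 mu0.
  move=> /(_ _ (smooth_sub t00 (le_trans h2 t11) sf) (smooth_sub (lexx _) h2 sD)) h.
  apply: (le_trans (h _ _)) => [x /andP[x0 x1]|x /andP[x0 x1]|]; [by apply: hf; rewrite x0 (lt_le_trans x1)|by apply: hw; rewrite x0 (lt_le_trans x1)|].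
  rewrite /G (_ : c / 2 * _ = c * ((mu * (D t - D t0) + y / mu * (t - t0)) / 2)); last by ring.
  rewrite ler_wpM2l// ler_pM2r ?invr_gt0// lerD//.
    by rewrite ler_wpM2l ?(ltW mu0)//; have := Dmono t h1 h2; clear - small; lra.
  by rewrite ler_wpM2l ?divr_ge0 ?(ltW y0) ?(ltW mu0)// lerD2r.
case: sol => h1 h2 h3 h4.
have wsg x : t0 < x < t1 -> y * sg x ^+ 2 <= y * (s x ^+ 2 + sg x ^+ 2).
  by move=> _; rewrite ler_wpM2l ?(ltW y0)// lerDr sqr_ge0.
have ws x : t0 < x < t1 -> y * s x ^+ 2 <= y * (s x ^+ 2 + sg x ^+ 2).
  by move=> _; rewrite ler_wpM2l ?(ltW y0)// lerDl sqr_ge0.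
(* Along the fixed direction [xi p0] the row moves by at most [e G], since its derivative is
   orthogonal to [xi (phi t)]; across it, by at most [G], but that component meets [xi (phi t)] with
   the weight [sin (phi t - p0)], at most [e] in modulus. *)
have dist (f1 f2 w : R -> R) (k : R) t : `|k| = 1 -> t0 <= t -> t <= t1 ->
    smooth 0 1 f1 (fun t => - (sin (phi t) * (k * (y * w t)))) ->
    smooth 0 1 f2 (fun t => cos (phi t) * (k * (y * w t))) ->
    (forall x, t0 < x < t1 -> y * w x ^+ 2 <= y * (s x ^+ 2 + sg x ^+ 2)) ->
    `|(f1 t - f1 t0) * cos (phi t) + (f2 t - f2 t0) * sin (phi t)| <= 2 * e * G.
  move=> k1 th1 th2 sf1 sf2 hw.
  have sU := smooth_add (smooth_mul sf1 (smooth_cst 0 1 (cos p0))) (smooth_mul sf2 (smooth_cst 0 1 (sin p0))).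
  have sV := smooth_add (smooth_mul sf2 (smooth_cst 0 1 (cos p0))) (smooth_opp (smooth_mul sf1 (smooth_cst 0 1 (sin p0)))).
  have yw x : `|k * (y * w x)| = y * `|w x| by rewrite !normrM k1 mul1r (gtr0_norm y0).
  have bU : `|f1 t * cos p0 + f2 t * sin p0 - (f1 t0 * cos p0 + f2 t0 * sin p0)| <= e * G.
    apply: (bound e t _ _ w (ltW e0) th1 th2 sU _ hw) => x /andP[x0 x1].
    rewrite (_ : _ + _ = - (sin (phi x - p0) * (k * (y * w x)))); last by rewrite sinB; ring.
    rewrite normrN normrM yw; apply: ler_wpM2r; last exact: osc (ltW x0) (ltW x1).
    by rewrite mulr_ge0// ltW.
  have bV : `|f2 t * cos p0 - f1 t * sin p0 - (f2 t0 * cos p0 - f1 t0 * sin p0)| <= 1 * G.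
    apply: (bound 1 t _ _ w ler01 th1 th2 sV _ hw) => x /andP[x0 x1].
    rewrite (_ : _ - _ = cos (phi x - p0) * (k * (y * w x))); last by rewrite cosB; ring.
    rewrite normrM yw; apply: ler_wpM2r; last exact: cos_max.
    by rewrite mulr_ge0// ltW.
  have c1 := cos2Dsin2 p0.
  have -> : (f1 t - f1 t0) * cos (phi t) + (f2 t - f2 t0) * sin (phi t) =
     cos (phi t - p0) * (f1 t * cos p0 + f2 t * sin p0 - (f1 t0 * cos p0 + f2 t0 * sin p0)) +
     sin (phi t - p0) * (f2 t * cos p0 - f1 t * sin p0 - (f2 t0 * cos p0 - f1 t0 * sin p0)).
    by rewrite sinB cosB -[LHS]mulr1 -c1; ring.
  apply: (le_trans (ler_normD _ _)); rewrite !normrM.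
  have -> : 2 * e * G = 1 * (e * G) + e * (1 * G) by ring.
  by rewrite lerD// ler_pM// ?cos_max// osc.
have sa t : t0 <= t -> t <= t1 -> qform (phi := phi) (a1 t0) (a2 t0) t <= 2 * s t ^+ 2 + 8 * (e * G) ^+ 2.
  move=> th1 th2; have := dist a1 a2 sg (-1) t _ th1 th2 _ _ wsg.
  rewrite normrN1 => /(_ erefl) h.
  have {}h := h (smooth_eq _ h1) (smooth_eq _ h2).
  have {}h : `|(a1 t - a1 t0) * cos (phi t) + (a2 t - a2 t0) * sin (phi t)| <= 2 * e * G.
    by apply: h => x _; rewrite /sg; ring.
  have hh : ((a1 t - a1 t0) * cos (phi t) + (a2 t - a2 t0) * sin (phi t)) ^+ 2 <= (2 * e * G) ^+ 2.
    rewrite -[leLHS]real_normK ?num_real// lerXn2r ?nnegrE//.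
    by rewrite mulr_ge0 ?(ltW G0)// mulr_ge0 ?(ltW e0).
  move: hh; rewrite (_ : _ + _ = s t - (a1 t0 * cos (phi t) + a2 t0 * sin (phi t))); last by rewrite /s; ring.
  rewrite /qform; set q := a1 t0 * _ + _ => hh.
  have := sqr_ge0 (2 * s t - q); clear - hh; lra.
have sb t : t0 <= t -> t <= t1 -> qform (phi := phi) (b1 t0) (b2 t0) t <= 2 * sg t ^+ 2 + 8 * (e * G) ^+ 2.
  move=> th1 th2; have := dist b1 b2 s 1 t _ th1 th2 _ _ ws.
  rewrite normr1 => /(_ erefl) h.
  have {}h := h (smooth_eq _ h3) (smooth_eq _ h4).
  have {}h : `|(b1 t - b1 t0) * cos (phi t) + (b2 t - b2 t0) * sin (phi t)| <= 2 * e * G.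
    by apply: h => x _; rewrite /s; ring.
  have hh : ((b1 t - b1 t0) * cos (phi t) + (b2 t - b2 t0) * sin (phi t)) ^+ 2 <= (2 * e * G) ^+ 2.
    rewrite -[leLHS]real_normK ?num_real// lerXn2r ?nnegrE//.
    by rewrite mulr_ge0 ?(ltW G0)// mulr_ge0 ?(ltW e0).
  move: hh; rewrite (_ : _ + _ = sg t - (b1 t0 * cos (phi t) + b2 t0 * sin (phi t))); last by rewrite /sg; ring.
  rewrite /qform; set q := b1 t0 * _ + _ => hh.
  have := sqr_ge0 (2 * sg t - q); clear - hh; lra.
pose Q t := qform (phi := phi) (a1 t0) (a2 t0) t + qform (phi := phi) (b1 t0) (b2 t0) t.
have cQ : wcont t0 t1 Q by apply: wcont_add; exact: (qform_wcont F).
have sQ := smooth_mul (smooth_cst t0 t1 y) (rint_smooth t01 cQ).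
have up : y * rint t0 t1 Q <= 2 * (D t1 - D t0) + 16 * (y * (e * G) ^+ 2) * l.
  have := smooth_le t01 (smooth_add (smooth_add (smooth_mul (smooth_cst t0 t1 2) sD)
    (smooth_mul (smooth_cst t0 t1 (16 * (y * (e * G) ^+ 2))) (smooth_id t0 t1))) (smooth_opp sQ)).
  rewrite rint_refl => h.
  have {}h : 2 * D t0 + 16 * (y * (e * G) ^+ 2) * t0 - y * 0 <=
      2 * D t1 + 16 * (y * (e * G) ^+ 2) * t1 - y * rint t0 t1 Q.
    apply: h => t /andP[x0 x1].
    have q1 := sa t (ltW x0) (ltW x1); have q2 := sb t (ltW x0) (ltW x1).
    have : y * Q t <= y * (2 * (s t ^+ 2 + sg t ^+ 2) + 16 * (e * G) ^+ 2).
      by rewrite ler_wpM2l ?(ltW y0)// /Q; clear - q1 q2; lra.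
    clear; lra.
  by rewrite /l; clear - h; lra.
have low : 2 * m * D t0 <= y * rint t0 t1 Q.
  rewrite /Q rint_add; [|exact: (qform_wcont F)|exact: (qform_wcont F)].
  rewrite !(qform_om F).
  have Qa : 0 <= rint t0 t1 (qform (phi := phi) (a1 t0) (a2 t0)) by apply: rint_ge0 => x _; exact: qform_ge0.
  have Qb : 0 <= rint t0 t1 (qform (phi := phi) (b1 t0) (b2 t0)) by apply: rint_ge0 => x _; exact: qform_ge0.
  rewrite !(qform_om F) in Qa Qb; rewrite det_Omega in hdet.
  move: Qa Qb hdet; move: (om0 _ _) (om1 _ _) (om2 _ _) => w0 w1 w2 Qa Qb hdet.
  set qa := _ + _ in Qa *; set qb := (X in qa + X) in Qb *.
  have idq : (w0 * w2 - w1 ^+ 2) * D t0 ^+ 2 <= qa * qb.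
    rewrite -subr_ge0; set z := _ - _.
    have -> : z = (a1 t0 * b1 t0 * w0 + (a1 t0 * b2 t0 + a2 t0 * b1 t0) * w1 + a2 t0 * b2 t0 * w2) ^+ 2.
      by rewrite /z /qa /qb /D; ring.
    exact: sqr_ge0.
  have h : (2 * m * D t0) ^+ 2 <= (y * (qa + qb)) ^+ 2.
    have hD : m ^+ 2 * D t0 ^+ 2 <= y ^+ 2 * (w0 * w2 - w1 ^+ 2) * D t0 ^+ 2 by rewrite ler_wpM2r ?sqr_ge0.
    have hq : y ^+ 2 * ((w0 * w2 - w1 ^+ 2) * D t0 ^+ 2) <= y ^+ 2 * (qa * qb) by rewrite ler_wpM2l ?sqr_ge0.
    have := mulr_ge0 (sqr_ge0 y) (sqr_ge0 (qa - qb)); clear - hD hq hdet; lra.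
  rewrite -(@ler_pXn2r _ 2)// nnegrE; first by rewrite mulr_ge0 ?(ltW D0)// mulr_ge0 ?(ltW m0).
  by rewrite mulr_ge0 ?(ltW y0)// addr_ge0.
(* The cost of freezing is itself proportional to [kap D(t0)]. The denominator of [kap] is chosen so
   that the main term [2 m D(t0)] still exceeds it by [2 kap D(t0)]. *)
have K2 : 16 * (y * (e * G) ^+ 2) * l <= 16 * K0 ^+ 2 * (kap * D t0).
  have -> : 16 * (y * (e * G) ^+ 2) * l = 16 * (y * l * e) ^+ 2 * (kap * D t0) by rewrite exprMn G2; ring.
  rewrite ler_wpM2r ?(ltW kD0)// ler_wpM2l// lerXn2r ?nnegrE//.
    exact: mulr_ge0 (ltW yl0) (ltW e0).
  exact: ltW.
have mk : m = kap * (1 + 8 * K0 ^+ 2) by rewrite /kap divfK// gt_eqF.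
have : 2 * (D t1 - D t0) < 2 * (kap * D t0) by clear - small; lra.
have : 2 * m * D t0 = 2 * (kap * D t0) + 16 * K0 ^+ 2 * (kap * D t0) by rewrite mk; ring.
clear - up low K2; lra.
Qed.

End Disc.

(** The row [f = W_1 + i W_2] starts with determinant 1, and [disc_growth] applies on each of the
    [beta ^ n] cells with [sqrt m], as [r a ^ n / b ^ n >= 1]. At the end the determinant is at most
    [|f| ^ 2 / 2], and [|f| ^ 2] at most twice the squared norm of [W]. *)
Lemma cmx_norm_lower : exists2 k : R, 0 < k & forall Wr Wi r n,
  is_fundamental_solution (Hamiltonian phi) Wr Wi -> rho ^+ n <= r <= rho ^+ n.+1 ->
  (1 + k) ^+ (beta ^ n) <= cmx_norm (Wr 0 r 1) (Wi 0 r 1) ^+ 2.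
Proof.
have [m m0 hm] := det_Omega_lower F.
have r1 := fr_rho_gt1 F.
have sm0 : 0 < Num.sqrt m by rewrite sqrtr_gt0.
exists (Num.sqrt m / (1 + 8 * (rho * frC F) ^+ 2)).
  by rewrite divr_gt0//; have := sqr_ge0 (rho * frC F); lra.
set k := Num.sqrt m / _ => Wr Wi r n hW /andP[rn1 rn2].
have rn : 0 < rho ^+ n by rewrite exprn_gt0//; lra.
have r0 : 0 < r by apply: lt_le_trans rn rn1.
have k0 : 0 < k by rewrite divr_gt0//; have := sqr_ge0 (rho * frC F); lra.
have sol := row_solution_comb (fundamental_row (fr_continuous F) 0 r ord0 hW)
  (fundamental_row (fr_continuous F) 0 r ord_max hW).
have bn := fr_bn_gt0 F n.
have ind j : (j <= beta ^ n)%N -> (1 + k) ^+ j <=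
  (Wr 0 r (node n j) ord0 ord0 - Wi 0 r (node n j) ord_max ord0) *
  (Wi 0 r (node n j) ord0 ord_max + Wr 0 r (node n j) ord_max ord_max) -
  (Wr 0 r (node n j) ord0 ord_max - Wi 0 r (node n j) ord_max ord_max) *
  (Wi 0 r (node n j) ord0 ord0 + Wr 0 r (node n j) ord_max ord0).
  elim: j => [|j IH] jb.
    rewrite mul0r expr0.
    have w i l := @fundamental_init R phi Wr Wi 0 r i l hW.
    rewrite !(w ord0 ord0).1 !(w ord0 ord0).2 !(w ord0 ord_max).1 !(w ord0 ord_max).2.
    rewrite !(w ord_max ord0).1 !(w ord_max ord0).2 !(w ord_max ord_max).1 !(w ord_max ord_max).2.
    by rewrite -!val_eqE /=; lra.
  have {}IH := IH (ltnW jb).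
  have := @disc_growth r _ _ _ _ r0 sol (node n j) (node n j.+1) n (Num.sqrt m).
  rewrite (@node_step R beta n j) => h; rewrite exprS.
  apply: le_trans (h _ _ _ (lexx _) rn2 sm0 _ _).
  - by rewrite -/k ler_wpM2l//; lra.
  - by rewrite divr_ge0// ltW.
  - exact/ltW/(node_lt F).
  - by rewrite ler_pdivrMr// mul1r -natrX ler_nat.
  - rewrite sqr_sqrtr ?(ltW m0)//.
    apply: (@le_trans _ _ (r ^+ 2 * (m * (a ^+ n / b ^+ n) ^+ 2))); last first.
      by rewrite ler_wpM2l ?sqr_ge0// (hm n j).
    rewrite fr_rhonV mulrCA -exprMn ler_peMr ?(ltW m0)//.
    by rewrite exprn_ege1// ler_pdivlMr// mul1r.
  - by apply: lt_le_trans IH; rewrite exprn_gt0//; lra.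
have := ind (beta ^ n)%N (leqnn _); rewrite natrX divff ?gt_eqF//.
move=> /le_trans; apply; rewrite /cmx_norm sqr_sqrtr; last first.
  by rewrite sumr_ge0// => i _; rewrite sumr_ge0// => j _; rewrite addr_ge0 ?sqr_ge0.
rewrite !big_ord_recl !big_ord0 !ord2_lift !addr0.
move: (Wr 0 r 1 ord0 ord0) (Wr 0 r 1 ord0 ord_max) (Wr 0 r 1 ord_max ord0) (Wr 0 r 1 ord_max ord_max).
move: (Wi 0 r 1 ord0 ord0) (Wi 0 r 1 ord0 ord_max) (Wi 0 r 1 ord_max ord0) (Wi 0 r 1 ord_max ord_max).
move=> i1 i2 i3 i4 w1 w2 w3 w4.
have := sqr_ge0 (w1 - i3 - (i2 + w4)); have := sqr_ge0 (w2 - i4 + (i1 + w3)).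
have := sqr_ge0 (w1 + i3); have := sqr_ge0 (i2 - w4).
have := sqr_ge0 (w2 + i4); have := sqr_ge0 (i1 - w3).
lra.
Qed.

End MonodromyLower.

Section MaxMonodromy.
Context {R : realType} {a : R} {beta : nat} {phi : R -> R} (F : fractal a beta phi).
Local Notation b := (beta%:R : R).
Local Notation rho := (b / a).

Lemma max_monodromy_asymp p Wr Wi : 0 <= p -> rho `^ p = b ->
  is_fundamental_solution (Hamiltonian phi) Wr Wi ->
  exists C1 C2 : R, 0 < C1 /\ 0 < C2 /\ forall r, 1 < r ->
     C1 * r `^ p <= ln (max_monodromy Wr Wi r) <= C2 * r `^ p.
Proof.
move=> p0 rp hW.
have [k k0 low] := cmx_norm_lower F.
have b1 := fr_b_gt1 F; have b0 := fr_b_gt0 F; have a0 := fr_a_gt0 F.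
have rho1 := fr_rho_gt1 F.
have lk : 0 < ln (1 + k) by rewrite ln_gt0//; lra.
have U0 : 0 < 1 + 2 / a + upper_rate F.
  have := upper_rate_ge0 F; have : 0 < 2 / a by rewrite divr_gt0.
  lra.
(* The 2 undoes the square in [cmx_norm_lower]; [b] accounts for [r] lying below [rho ^ n.+1]
   instead of at [rho ^ n]. *)
exists (ln (1 + k) / (2 * b)), (1 + 2 / a + upper_rate F).
split; first by rewrite divr_gt0// mulr_gt0.
split => // r r1; have r0 : 0 < r := lt_trans ltr01 r1.
have [n /andP[n1 n2]] := scale_between rho1 (ltW r1).
have bn := fr_bn_gt0 F n.
have rn0 : 0 <= rho ^+ n by rewrite exprn_ge0//; lra.
have bp1 : b ^+ n <= r `^ p.
  by rewrite -(scale_powR rho1 b1 rp); apply: powR_scale_le.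
have bp2 : r `^ p <= b * b ^+ n.
  by rewrite -exprS -(scale_powR rho1 b1 rp); apply: powR_scale_le => //; exact: ltW.
set V := [set v : R | exists x y : R,
   x ^+ 2 + y ^+ 2 = r ^+ 2 /\ v = cmx_norm (Wr x y 1) (Wi x y 1)].
have ubV : ubound V (expR ((1 + 2 / a + upper_rate F) * b ^+ n)).
  by move=> v [x [y [xy ->]]]; apply: (cmx_norm_upper F hW (ltW r0) xy n2).
have mV : V (cmx_norm (Wr 0 r 1) (Wi 0 r 1)).
  by exists 0, r; split=> //; rewrite expr0n add0r.
have sV : has_sup V by split; [exists (cmx_norm (Wr 0 r 1) (Wi 0 r 1))|exists (expR ((1 + 2 / a + upper_rate F) * b ^+ n))].
have lo : cmx_norm (Wr 0 r 1) (Wi 0 r 1) <= max_monodromy Wr Wi r.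
  exact: (sup_upper_bound sV).
have up : max_monodromy Wr Wi r <= expR ((1 + 2 / a + upper_rate F) * b ^+ n).
  by apply: (@ge_sup R V); [exists (cmx_norm (Wr 0 r 1) (Wi 0 r 1))|].
have X0 : 0 <= cmx_norm (Wr 0 r 1) (Wi 0 r 1) by exact: sqrtr_ge0.
have n12 : rho ^+ n <= r <= rho ^+ n.+1 by rewrite n1 n2.
have l2 := low Wr Wi r n hW n12.
set Mx := max_monodromy Wr Wi r in lo up *.
have M2 : (1 + k) ^+ (beta ^ n) <= Mx ^+ 2.
  by apply: (le_trans l2); rewrite lerXn2r ?nnegrE// (le_trans X0).
have k1 : 0 < (1 + k) ^+ (beta ^ n) by rewrite exprn_gt0//; lra.
have Mx0 : 0 < Mx.
  rewrite lt_neqAle (le_trans X0 lo) andbT eq_sym; apply/negP => /eqP e.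
  by move: M2; rewrite e expr0n /= leNgt k1.
apply/andP; split.
  have : ln ((1 + k) ^+ (beta ^ n)) <= ln (Mx ^+ 2).
    by rewrite ler_ln ?posrE// exprn_gt0.
  rewrite !lnXn//; last lra.
  rewrite -(mulr_natl (ln (1 + k))) natrX => h.
  have : ln (1 + k) / (2 * b) * r `^ p <= ln (1 + k) / (2 * b) * (b * b ^+ n).
    by rewrite ler_wpM2l// ltW// divr_gt0// mulr_gt0.
  rewrite (_ : ln (1 + k) / (2 * b) * (b * b ^+ n) = b ^+ n * ln (1 + k) / 2); last by field; rewrite gt_eqF.
  rewrite mulr2n in h; lra.
have : ln Mx <= (1 + 2 / a + upper_rate F) * b ^+ n.
  by rewrite -[leRHS]expRK ler_ln ?posrE ?expR_gt0.
move=> /le_trans; apply; rewrite ler_wpM2l// ltW//.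
Qed.

End MaxMonodromy.

(** * The Pruefer angle *)

(* The angle is followed along the homotopy [(X, (1 + t (e - 1)) Y)]; the point never becomes
   orthogonal to its initial position. *)
Lemma squeeze_angle {R : realType} (X Y rho psi e : R) : 0 < rho -> 0 < e ->
  X = rho * cos psi -> Y = rho * sin psi ->
  exists eta, `|eta - psi| < pi / 2 /\
    exists2 rho', 0 < rho' & X = rho' * cos eta /\ e * Y = rho' * sin eta.
Proof.
move=> rho0 e0 XE YE.
have sX := smooth_cst 0 1 X.
have sY := smooth_mul (smooth_add (smooth_cst 0 1 1) (smooth_mul (smooth_id 0 1) (smooth_cst 0 1 (e - 1))))
  (smooth_cst 0 1 Y).
have k0 t : 0 <= t <= 1 -> 0 < 1 + t * (e - 1).
  by move=> /andP[t0 t1]; have : 0 <= t * e <= e; [apply/andP; split; nra|]; nra.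
have N0 : X ^+ 2 + Y ^+ 2 = rho ^+ 2 by rewrite XE YE -[RHS]mulr1 -(cos2Dsin2 psi); ring.
have Xn t : 0 <= t <= 1 -> X ^+ 2 + ((1 + t * (e - 1)) * Y) ^+ 2 != 0.
  move=> /k0 k; rewrite gt_eqF//.
  have [x0|xn] := eqVneq X 0.
    rewrite x0 expr0n add0r exprMn; apply: mulr_gt0; first exact: exprn_gt0.
    by move: N0; rewrite x0 expr0n add0r => ->; rewrite exprn_gt0.
  by rewrite ltr_pwDl ?sqr_ge0// lt_neqAle sqr_ge0 eq_sym expf_neq0.
have cd1 : wcont 0 1 (fun _ : R => 0 : R) by exact: wcont_cst.
have cd2 : wcont 0 1 (fun _ : R => (e - 1) * Y) by exact: wcont_cst.
have sY' : smooth 0 1 (fun t => (1 + t * (e - 1)) * Y) (fun=> (e - 1) * Y).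
  by apply: smooth_eq sY => t _; ring.
have [] := @polar_angle R 0 1 (fun=> X) (fun t => (1 + t * (e - 1)) * Y) _ _ rho psi ler01 sX sY' cd1 cd2 Xn rho0 XE.
  by rewrite mul0r addr0 mul1r.
move=> th [th0 sth hth]; exists (th 1); split; last first.
  have [|r' r'0 [h1 h2]] := hth 1; first by rewrite ler01 lexx.
  by exists r' => //; split=> //; rewrite -h2; ring.
apply: (@cos_pos_stay R 0 1 (fun t => th t - psi)) => //.
- by apply: wcont_add; [exact: sth.1|exact: wcont_cst].
- move=> t t01; have [r' r'0 [h1 h2]] := hth t t01.
  have k := k0 t t01.
  rewrite cosB -(pmulr_rgt0 _ (mulr_gt0 r'0 rho0)).
  have -> : r' * rho * (cos (th t) * cos psi + sin (th t) * sin psi) =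
    r' * cos (th t) * (rho * cos psi) + r' * sin (th t) * (rho * sin psi) by ring.
  rewrite -h1 -h2 -XE -YE.
  have -> : X * X + (1 + t * (e - 1)) * Y * Y = X ^+ 2 + (1 + t * (e - 1)) * Y ^+ 2 by ring.
  have [x0|xn] := eqVneq X 0.
    rewrite x0 expr0n add0r mulr_gt0//.
    by move: N0; rewrite x0 expr0n add0r => ->; rewrite exprn_gt0.
  rewrite ltr_pwDl//; last by rewrite mulr_ge0 ?sqr_ge0// ltW.
  by rewrite lt_neqAle sqr_ge0 eq_sym expf_neq0.
- by rewrite th0 subrr normr0 divr_gt0 ?pi_gt0.
Qed.

Section Angles.
Context {R : realType} {a : R} {beta : nat} {phi : R -> R} (F : fractal a beta phi).
Local Notation b := (beta%:R : R).
Local Notation rho := (b / a).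
Local Notation node n k := (k%:R / b ^+ n).

(** The equation [f' = lam J H f] of the relation. For real [lam] it is also satisfied by the real
    parts of the rows of [W], which therefore provide solutions. *)
Definition real_solution (lam : R) (f1 f2 : R -> R) : Prop :=
  let s t := f1 t * cos (phi t) + f2 t * sin (phi t) in
  smooth 0 1 f1 (fun t => - (sin (phi t) * (lam * s t))) /\
  smooth 0 1 f2 (fun t => cos (phi t) * (lam * s t)).

(** Pruefer's equation, from which the modulus has dropped out, for a solution starting in the
    direction [(0, 1)], that is, with [(1, 0) f(0) = 0]. *)
Definition angle (lam : R) (th : R -> R) : Prop :=
  th 0 = pi / 2 /\ smooth 0 1 th (fun t => lam * cos (th t - phi t) ^+ 2).

Let ccos l r : wcont l r (fun t => cos (phi t)).
Proof. exact/wcont_continuous/(cos_phi_continuous F). Qed.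
Let csin l r : wcont l r (fun t => sin (phi t)).
Proof. exact/wcont_continuous/(sin_phi_continuous F). Qed.
Let cphi l r : wcont l r phi.
Proof. exact/wcont_continuous/(fr_continuous F). Qed.

(** With [s], [w] the components along and across [xi], the squared norm has derivative [2 lam s w],
    at most [|lam| (s ^ 2 + w ^ 2)] in modulus. In particular a solution vanishing at one point
    vanishes on the whole segment. *)
Lemma real_solution_pinch lam f1 f2 t : real_solution lam f1 f2 -> 0 <= t <= 1 ->
  (f1 0 ^+ 2 + f2 0 ^+ 2) * expR (- `|lam|) <= f1 t ^+ 2 + f2 t ^+ 2 <=
  (f1 0 ^+ 2 + f2 0 ^+ 2) * expR `|lam|.
Proof.
move=> [s1 s2] /andP[t0 t1].
have sN := smooth_sub (lexx 0) t1 (smooth_add (smooth_sqr s1) (smooth_sqr s2)).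
have key x : `|2 * f1 x * - (sin (phi x) * (lam * (f1 x * cos (phi x) + f2 x * sin (phi x)))) +
    2 * f2 x * (cos (phi x) * (lam * (f1 x * cos (phi x) + f2 x * sin (phi x))))| <=
    `|lam| * (f1 x ^+ 2 + f2 x ^+ 2).
  set s := _ + f2 x * sin _; set N := f1 x ^+ 2 + _; set w := - (f1 x * sin (phi x)) + f2 x * cos (phi x).
  rewrite (_ : _ + _ = lam * (2 * (s * w))); last by rewrite /w; ring.
  rewrite normrM ler_wpM2l//.
  have NE : N = s ^+ 2 + w ^+ 2.
    by rewrite /N /s /w -[LHS]mulr1 -(cos2Dsin2 (phi x)); ring.
  rewrite NE ler_norml; have := sqr_ge0 (s - w); have := sqr_ge0 (s + w).
  by move=> ? ?; apply/andP; split; lra.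
have N0 : 0 <= f1 0 ^+ 2 + f2 0 ^+ 2 by rewrite addr_ge0 ?sqr_ge0.
have lt : `|lam| * t <= `|lam| by rewrite ler_piMr.
apply/andP; split.
  have := gronwall (C := - `|lam|) t0 (smooth_opp sN) => h.
  have {}h : - (f1 t ^+ 2 + f2 t ^+ 2) <= - (f1 0 ^+ 2 + f2 0 ^+ 2) * expR (- `|lam| * (t - 0)).
    apply: h => x _; have := key x; rewrite ler_norml => /andP[h1 h2]; lra.
  have : (f1 0 ^+ 2 + f2 0 ^+ 2) * expR (- `|lam|) <= (f1 0 ^+ 2 + f2 0 ^+ 2) * expR (- `|lam| * (t - 0)).
    by rewrite ler_wpM2l// ler_expR subr0 mulNr lerN2.
  lra.
have := gronwall (C := `|lam|) t0 sN => h.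
have {}h : (f1 t ^+ 2 + f2 t ^+ 2) <= (f1 0 ^+ 2 + f2 0 ^+ 2) * expR (`|lam| * (t - 0)).
  apply: h => x _; have := key x; rewrite ler_norml => /andP[h1 h2]; lra.
apply: (le_trans h); rewrite ler_wpM2l// ler_expR subr0//.
Qed.

Lemma angle_exists lam f1 f2 : real_solution lam f1 f2 -> f1 0 = 0 -> f2 0 = 1 ->
  exists2 th, angle lam th & forall t, 0 <= t <= 1 -> exists2 r, 0 < r &
    f1 t = r * cos (th t) /\ f2 t = r * sin (th t).
Proof.
move=> sol f10 f20; have [s1 s2] := sol.
have cs : wcont 0 1 (fun t => f1 t * cos (phi t) + f2 t * sin (phi t)).
  by apply: wcont_add; apply: wcont_mul => //; [exact: s1.1|exact: s2.1].
have cl : wcont 0 1 (fun t => lam * (f1 t * cos (phi t) + f2 t * sin (phi t))).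
  by apply: wcont_mul => //; exact: wcont_cst.
have d1 : wcont 0 1 (fun t => - (sin (phi t) * (lam * (f1 t * cos (phi t) + f2 t * sin (phi t))))).
  by apply: wcont_opp; exact: wcont_mul.
have d2 : wcont 0 1 (fun t => cos (phi t) * (lam * (f1 t * cos (phi t) + f2 t * sin (phi t)))).
  exact: wcont_mul.
have N0 t : 0 <= t <= 1 -> f1 t ^+ 2 + f2 t ^+ 2 != 0.
  move=> /(real_solution_pinch sol) /andP[h _]; rewrite gt_eqF// (lt_le_trans _ h)//.
  by rewrite f10 f20 expr0n add0r expr1n mul1r expR_gt0.
have [||th [th0 sth hth]] := polar_angle (rho0 := 1) (th0 := pi / 2) ler01 s1 s2 d1 d2 N0 ltr01.
- by rewrite f10 cos_pihalf mulr0.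
- by rewrite f20 sin_pihalf mulr1.
exists th => //; split => //; apply: smooth_eq sth => t t01.
have [|r r0 [h1 h2]] := hth t; first by apply/andP; split; lra.
rewrite cosB h1 h2; have := cos2Dsin2 (th t); have := cos2Dsin2 (phi t).
move: (cos (th t)) (sin (th t)) (cos (phi t)) (sin (phi t)) => C S c s e1 e2.
have -> : (r * C) ^+ 2 + (r * S) ^+ 2 = r ^+ 2 by rewrite -[RHS]mulr1 -e2; ring.
by field; rewrite gt_eqF.
Qed.

Lemma angle_cos_cont lam th : angle lam th -> wcont 0 1 (fun t => cos (th t - phi t) ^+ 2).
Proof.
move=> [_ [cth _]]; apply: wcont_exp.
apply: (wcont_comp (f := fun t => th t - phi t) (g := cos)); first exact: continuous_cos.
by apply: wcont_add => //; exact: wcont_opp.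
Qed.

Lemma qform_int01 e1 e2 : 0 < e1 ^+ 2 + e2 ^+ 2 -> 0 < rint 0 1 (qform (phi := phi) e1 e2).
Proof.
move=> e0; have [m m0 hm] := qform_int F.
have := hm 0%N 0%N e1 e2; rewrite !expr0 mul0r expr1n divr1 mulr1.
by apply: lt_le_trans; rewrite mulr_gt0.
Qed.

(* If the integral vanished then [th] would be constant, hence [phi] constant modulo [pi]. *)
Lemma angle_int_gt0 lam th : angle lam th -> 0 < rint 0 1 (fun t => cos (th t - phi t) ^+ 2).
Proof.
move=> ang; have cc := angle_cos_cont ang; have [th0 sth] := ang.
set w := fun t => cos _ ^+ 2 in cc *.
have w0 t : 0 <= w t by exact: sqr_ge0.
have I0 : 0 <= rint 0 1 w by apply: rint_ge0 => x _.
rewrite lt_neqAle I0 andbT eq_sym; apply/negP => /eqP I1.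
have It t : 0 <= t <= 1 -> rint 0 t w = 0.
  move=> /andP[t0 t1]; apply/eqP; rewrite eq_le; apply/andP; split; last by apply: rint_ge0 => x _.
  by rewrite -[leRHS]I1; apply: rint_mono => // x _.
have thc t : 0 <= t <= 1 -> th t = pi / 2.
  move=> t01; have /andP[t0 t1] := t01.
  have cw : wcont 0 t (fun x => lam * w x).
    by apply: wcont_mul; [exact: wcont_cst|exact: wcont_sub (lexx _) t1 cc].
  have := rint_eq t0 cw (smooth_sub (lexx _) t1 sth).
  rewrite rint_scale; last exact: wcont_sub (lexx _) t1 cc.
  by rewrite It// mulr0 th0 => h; lra.
have := @qform_int01 0 1; rewrite expr0n expr1n add0r => /(_ ltr01).
suff -> : rint 0 1 (qform (phi := phi) 0 1) = rint 0 1 w by rewrite I1 ltxx.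
apply: rint_ext => x x01; rewrite /qform /w thc// mul0r add0r mul1r.
by rewrite (_ : pi / 2 - phi x = - (phi x - pi / 2)) ?cosN ?cosBpihalf//; ring.
Qed.

(** The derivative of [th2 - th1] is [(l2 - l1) cos (th2 - phi) ^ 2] plus an error of at most
    [|l1| |th2 - th1|], so the difference is nonnegative by [comparison]. The integrating factors
    [exp (|l1| t)] and [exp (- |l1| t)] then give a lower bound, for strict monotonicity in the
    parameter, and an upper bound, for continuity. *)
Lemma angle_compare l1 l2 th1 th2 : l1 <= l2 -> angle l1 th1 -> angle l2 th2 ->
  (forall t, 0 <= t <= 1 -> th1 t <= th2 t) /\
  (l2 - l1) * rint 0 1 (fun t => cos (th2 t - phi t) ^+ 2) <= (th2 1 - th1 1) * expR `|l1| /\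
  th2 1 - th1 1 <= (l2 - l1) * expR `|l1|.
Proof.
move=> l12 ang1 ang2; have [i1 s1] := ang1; have [i2 s2] := ang2.
have cc := angle_cos_cont ang2.
have sD := smooth_add s2 (smooth_opp s1).
set M := `|l1|; have M0 : 0 <= M by exact: normr_ge0.
have lip t : `|l1 * (cos (th2 t - phi t) ^+ 2 - cos (th1 t - phi t) ^+ 2)| <= M * `|th2 t - th1 t|.
  rewrite normrM ler_wpM2l//; apply: (le_trans (cos_sqr_lip _ _)).
  by rewrite opprB addrA subrK.
have c01 t : 0 <= cos (th2 t - phi t) ^+ 2 <= 1.
  rewrite sqr_ge0 /= -[leRHS](expr1n _ 2) -[leLHS]real_normK ?num_real// lerXn2r ?nnegrE//.
  exact: cos_max.
have dE t : l2 * cos (th2 t - phi t) ^+ 2 - l1 * cos (th1 t - phi t) ^+ 2 =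
  (l2 - l1) * cos (th2 t - phi t) ^+ 2 + l1 * (cos (th2 t - phi t) ^+ 2 - cos (th1 t - phi t) ^+ 2) by ring.
have le t : 0 <= t <= 1 -> 0 <= th2 t - th1 t.
  move=> /andP[t0 t1].
  apply: (comparison (M := M) t0 M0 (smooth_sub (lexx _) t1 sD)); first by rewrite i1 i2 subrr.
  move=> x _; rewrite dE; have := lip x; rewrite ler_norml => /andP[h1 _].
  have : 0 <= (l2 - l1) * cos (th2 x - phi x) ^+ 2 by rewrite mulr_ge0 ?subr_ge0 ?sqr_ge0.
  lra.
split; first by move=> t /le; rewrite subr_ge0.
split.
  have sG := smooth_mul sD (smooth_expR (smooth_mul (smooth_cst 0 1 M) (smooth_id 0 1))).
  have sI := smooth_mul (smooth_cst 0 1 (l2 - l1)) (rint_smooth ler01 cc).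
  have := smooth_le ler01 (smooth_add sG (smooth_opp sI)).
  rewrite rint_refl i1 i2 => h.
  have {}h : (pi / 2 - pi / 2) * expR (M * 0) - (l2 - l1) * 0 <=
     (th2 1 - th1 1) * expR (M * 1) - (l2 - l1) * rint 0 1 (fun t => cos (th2 t - phi t) ^+ 2).
    apply: h => t /andP[t0 t1]; rewrite dE.
    have E1 : 1 <= expR (M * t) by rewrite -expR0 ler_expR mulr_ge0// ltW.
    have D0 : 0 <= th2 t - th1 t by apply: le; rewrite !ltW.
    have := lip t; rewrite ler_norml (ger0_norm D0) => /andP[h1 _].
    have /andP[g0 _] := c01 t.
    move: h1 g0; set q := l1 * _; set g := cos _ ^+ 2; set Dt := th2 t - th1 t in D0 * => h1 g0.
    have lg : 0 <= (l2 - l1) * g by rewrite mulr_ge0// subr_ge0.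
    have p1 : 0 <= (expR (M * t) - 1) * ((l2 - l1) * g) by rewrite mulr_ge0// subr_ge0.
    have p2 : 0 <= expR (M * t) * (q + M * Dt) by rewrite mulr_ge0 ?expR_ge0//; lra.
    apply: le_trans (addr_ge0 p1 p2) _; rewrite le_eqVlt; apply/orP; left; apply/eqP; ring.
  rewrite mulr1 in h; lra.
have sG := smooth_mul sD (smooth_expR (smooth_opp (smooth_mul (smooth_cst 0 1 M) (smooth_id 0 1)))).
have sI := smooth_mul (smooth_cst 0 1 (l2 - l1)) (smooth_id 0 1).
have := smooth_le ler01 (smooth_add sI (smooth_opp sG)).
rewrite i1 i2 => h.
have {}h : (l2 - l1) * 0 - (pi / 2 - pi / 2) * expR (- (M * 0)) <=
   (l2 - l1) * 1 - (th2 1 - th1 1) * expR (- (M * 1)).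
  apply: h => t /andP[t0 t1]; rewrite dE.
  have E1 : expR (- (M * t)) <= 1 by rewrite -[leRHS]expR0 ler_expR oppr_le0 mulr_ge0// ltW.
  have D0 : 0 <= th2 t - th1 t by apply: le; rewrite !ltW.
  have := lip t; rewrite ler_norml (ger0_norm D0) => /andP[_ h1].
  have /andP[g0 g1] := c01 t.
  move: h1 g0 g1; set q := l1 * _; set g := cos _ ^+ 2; set Dt := th2 t - th1 t in D0 * => h1 g0 g1.
  have l0 : 0 <= l2 - l1 by rewrite subr_ge0.
  have e0 := expR_ge0 (- (M * t)); set e := expR _ in E1 e0 *.
  have p1 : 0 <= (l2 - l1) * (1 - e) by rewrite mulr_ge0// subr_ge0.
  have p3 : 0 <= (l2 - l1) * e * (1 - g) by rewrite mulr_ge0 ?subr_ge0// mulr_ge0// subr_ge0.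
  have p2 : 0 <= e * (M * Dt - q) by rewrite mulr_ge0//; lra.
  apply: le_trans (addr_ge0 (addr_ge0 p1 p3) p2) _; rewrite le_eqVlt; apply/orP; left; apply/eqP; ring.
have {}h : (th2 1 - th1 1) * expR (- M) <= l2 - l1 by rewrite !mulr1 in h; lra.
by move: h; rewrite expRN ler_pdivrMr ?expR_gt0.
Qed.

Lemma angle_lt l1 l2 th1 th2 : l1 < l2 -> angle l1 th1 -> angle l2 th2 -> th1 1 < th2 1.
Proof.
move=> l12 ang1 ang2; have [_ [h _]] := angle_compare (ltW l12) ang1 ang2.
rewrite -subr_gt0 -(pmulr_lgt0 _ (expR_gt0 `|l1|)); apply: lt_le_trans h.
by rewrite mulr_gt0 ?subr_gt0// (angle_int_gt0 ang2).
Qed.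

(** [2 (1 + B ^ 2)] bounds [s ^ 2] by the weighted squared norm, [rho] comes from
    [a ^ n |lam| <= rho b ^ n], and [frL F] from the rotation of the frame. *)
Definition angle_rate : R := 2 * (1 + frB F ^+ 2) * rho + frL F.

(* In the frame rotating with the partial sum [S], and after multiplying the second
   coordinate by [a ^+ n], the angular speed is of order [b ^+ n]. *)
Lemma angle_bound lam f1 f2 th n : real_solution lam f1 f2 -> angle lam th ->
  (forall t, 0 <= t <= 1 -> exists2 r, 0 < r & f1 t = r * cos (th t) /\ f2 t = r * sin (th t)) ->
  `|lam| <= rho ^+ n.+1 ->
  `|th 1 - pi / 2| <= angle_rate * b ^+ n + pi + frC F + 2 * frB F.
Proof.
move=> [s1 s2] [th0 sth] pol hl.
have e0 := fr_an_gt0 F n; have e1 := fr_an_le1 F n; have bn := fr_bn_gt0 F n.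
have a0 := fr_a_gt0 F; have B0 := frB_gt0 F.
have cdS : wcont 0 1 (frdS F n) by apply: wcont_continuous; exact: fr_dS_cont.
have nS t := fr_near F n t; have dSb t := fr_dS F n t.
rewrite exprMn in dSb.
have sS := smooth_global 0 1 (fr_deriv F n).
move: cdS nS dSb sS; set S := frS F n; set dS := frdS F n => cdS nS dSb sS.
set e := a ^+ n in e0 e1 nS dSb *.
have sc := smooth_cos sS; have sd := smooth_sin sS.
have u1 := smooth_add (smooth_mul s1 sc) (smooth_mul s2 sd).
have v1 := smooth_mul (smooth_cst 0 1 e) (smooth_add (smooth_opp (smooth_mul s1 sd)) (smooth_mul s2 sc)).
pose s t := f1 t * cos (phi t) + f2 t * sin (phi t).
pose u t := f1 t * cos (S t) + f2 t * sin (S t).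
pose v t := - (f1 t * sin (S t)) + f2 t * cos (S t).
pose del t := phi t - S t.
pose P t := lam * s t.
have su : smooth 0 1 u (fun t => - sin (del t) * P t + dS t * v t).
  by apply: smooth_eq u1 => t _; rewrite /del sinB /P /s /v; ring.
have sv : smooth 0 1 (fun t => e * v t) (fun t => e * (cos (del t) * P t - dS t * u t)).
  by apply: smooth_eq v1 => t _; rewrite /del cosB /P /s /u; ring.
have cdel : wcont 0 1 del by apply: wcont_add => //; apply: wcont_opp; exact: sS.1.
have cP : wcont 0 1 P.
  apply: wcont_mul; first exact: wcont_cst.
  by apply: wcont_add; apply: wcont_mul => //; [exact: s1.1|exact: s2.1].
have csd : wcont 0 1 (fun t => sin (del t)) by apply: wcont_comp cdel => x; exact: continuous_sin.
have ccd : wcont 0 1 (fun t => cos (del t)) by apply: wcont_comp cdel => x; exact: continuous_cos.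
have cv : wcont 0 1 v.
  by apply: wcont_add; [apply: wcont_opp|]; apply: wcont_mul;
    [exact: s1.1|exact: sd.1|exact: s2.1|exact: sc.1].
have cu : wcont 0 1 u by exact: su.1.
have cdu : wcont 0 1 (fun t => - sin (del t) * P t + dS t * v t).
  by apply: wcont_add; apply: wcont_mul => //; exact: wcont_opp.
have cdv : wcont 0 1 (fun t => e * (cos (del t) * P t - dS t * u t)).
  apply: wcont_mul; first exact: wcont_cst.
  by apply: wcont_add; [|apply: wcont_opp]; exact: wcont_mul.
have polS t : 0 <= t <= 1 -> exists2 r, 0 < r & u t = r * cos (th t - S t) /\ v t = r * sin (th t - S t).
  move=> t01; have [r r0 [h1 h2]] := pol t t01; exists r => //.
  by rewrite /u /v cosB sinB h1 h2; split; ring.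
have N0 t : 0 <= t <= 1 -> u t ^+ 2 + (e * v t) ^+ 2 != 0.
  move=> t01; have [r r0 [h1 h2]] := polS t t01; rewrite gt_eqF//.
  have h : 0 < u t ^+ 2 + v t ^+ 2.
    have -> : u t ^+ 2 + v t ^+ 2 = r ^+ 2.
      by rewrite h1 h2 -[RHS]mulr1 -(cos2Dsin2 (th t - S t)); ring.
    by rewrite exprn_gt0.
  have e2 : 0 < e ^+ 2 by rewrite exprn_gt0.
  have e3 : e ^+ 2 <= 1 by rewrite exprn_ile1// ltW.
  have := mulr_gt0 e2 h; rewrite exprMn.
  have : e ^+ 2 * u t ^+ 2 <= u t ^+ 2 by rewrite ler_piMl ?sqr_ge0.
  lra.
have t001 : 0 <= (0 : R) <= 1 by rewrite lexx ler01.
have t101 : 0 <= (1 : R) <= 1 by rewrite lexx ler01.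
have [r0 r0_gt0 [u0 v0]] := polS 0 t001.
have [eta0 [heta0 [r1 r1_gt0 [u0' v0']]]] := squeeze_angle r0_gt0 e0 u0 v0.
have [eta [heta seta heta2]] := polar_angle ler01 su sv cdu cdv N0 r1_gt0 u0' v0'.
(* [eta] is an angle of [(u, e v)] and [th - S] one of [(u, v)]; the scalar product
   [u ^ 2 + e v ^ 2] is positive, so they stay within [pi / 2]. This gap at [1] and the one at [0]
   make up the summand [pi] of the bound. *)
have close : `|eta 1 - (th 1 - S 1)| < pi / 2.
  apply: (@cos_pos_stay R 0 1 (fun t => eta t - (th t - S t))) => //.
  - apply: wcont_add; first exact: seta.1.
    by apply: wcont_opp; apply: wcont_add; [exact: sth.1|apply: wcont_opp; exact: sS.1].
  - move=> t t01; have [r r_gt0 [h1 h2]] := polS t t01; have [q q_gt0 [k1 k2]] := heta2 t t01.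
    rewrite cosB -(pmulr_rgt0 _ (mulr_gt0 q_gt0 r_gt0)).
    have -> : q * r * (cos (eta t) * cos (th t - S t) + sin (eta t) * sin (th t - S t)) =
      (q * cos (eta t)) * (r * cos (th t - S t)) + (q * sin (eta t)) * (r * sin (th t - S t)) by ring.
    rewrite -k1 -k2 -h1 -h2.
    have h : 0 < u t ^+ 2 + v t ^+ 2.
      have -> : u t ^+ 2 + v t ^+ 2 = r ^+ 2.
        by rewrite h1 h2 -[RHS]mulr1 -(cos2Dsin2 (th t - S t)); ring.
      by rewrite exprn_gt0.
    have := mulr_gt0 e0 h.
    have : e * u t ^+ 2 <= u t ^+ 2 by rewrite ler_piMl ?sqr_ge0.
    by move=> ? ?; apply: (@lt_le_trans _ _ (e * (u t ^+ 2 + v t ^+ 2))) => //; lra.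
  - by rewrite heta.
have rate : `|eta 1 - eta 0| <= angle_rate * b ^+ n * (1 - 0).
  apply: (smooth_lip ler01 seta) => t /andP[t0 t1].
  have t01 : 0 <= t <= 1 by rewrite !ltW.
  have Nt : 0 < u t ^+ 2 + (e * v t) ^+ 2.
    by rewrite lt_neqAle eq_sym N0// addr_ge0 ?sqr_ge0.
  have sE : s t = cos (del t) * u t + sin (del t) * v t.
    rewrite /s /u /v /del sinB cosB -[LHS]mulr1 -(cos2Dsin2 (S t)); ring.
  rewrite normrM normfV (gtr0_norm Nt) ler_pdivrMr//.
  have -> : u t * (e * (cos (del t) * P t - dS t * u t)) -
      e * v t * (- sin (del t) * P t + dS t * v t) =
      e * (lam * s t ^+ 2) - dS t * (e * (u t ^+ 2 + v t ^+ 2)).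
    by rewrite /P [in RHS]expr2 [X in _ = e * (lam * (_ * X)) - _]sE; ring.
  have hsd : sin (del t) ^+ 2 <= (frB F * e) ^+ 2.
    rewrite -[leLHS]real_normK ?num_real// lerXn2r ?nnegrE//.
      by rewrite mulr_ge0// ltW.
    by apply: (le_trans (abs_sin_le _)); exact: nS.
  have hcd : cos (del t) ^+ 2 <= 1 by rewrite -(cos2Dsin2 (del t)) lerDl sqr_ge0.
  have s2b : s t ^+ 2 <= 2 * (1 + frB F ^+ 2) * (u t ^+ 2 + (e * v t) ^+ 2).
    have k1 : (cos (del t) * u t) ^+ 2 <= u t ^+ 2 by rewrite exprMn ler_piMl ?sqr_ge0.
    have k2 : (sin (del t) * v t) ^+ 2 <= (frB F * e) ^+ 2 * v t ^+ 2 by rewrite exprMn ler_wpM2r ?sqr_ge0.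
    have k3 := sqr_ge0 (cos (del t) * u t - sin (del t) * v t).
    have k4 := mulr_ge0 (sqr_ge0 (frB F)) (sqr_ge0 (u t)).
    have k5 := sqr_ge0 (e * v t).
    rewrite sE; clear - hsd hcd k1 k2 k3 k4 k5; lra.
  have el : e * `|lam| <= rho * b ^+ n.
    apply: (@le_trans _ _ (e * rho ^+ n.+1)); first by rewrite ler_wpM2l// ltW.
    rewrite le_eqVlt; apply/orP; left; apply/eqP.
    by rewrite exprS expr_div_n /e; field; rewrite !gt_eqF ?exprn_gt0.
  apply: (le_trans (ler_normB _ _)); rewrite /angle_rate.
  have m1 : `|e * (lam * s t ^+ 2)| <= 2 * (1 + frB F ^+ 2) * rho * b ^+ n * (u t ^+ 2 + (e * v t) ^+ 2).
    rewrite normrM (gtr0_norm e0) normrM [`|s t ^+ 2|]ger0_norm ?sqr_ge0// mulrA.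
    have -> : 2 * (1 + frB F ^+ 2) * rho * b ^+ n * (u t ^+ 2 + (e * v t) ^+ 2) =
       rho * b ^+ n * (2 * (1 + frB F ^+ 2) * (u t ^+ 2 + (e * v t) ^+ 2)) by ring.
    by apply: ler_pM; rewrite ?sqr_ge0// mulr_ge0// ltW.
  have m2 : `|dS t * (e * (u t ^+ 2 + v t ^+ 2))| <= frL F * b ^+ n * (u t ^+ 2 + (e * v t) ^+ 2).
    have uv : 0 <= u t ^+ 2 + v t ^+ 2 by rewrite addr_ge0 ?sqr_ge0.
    rewrite normrM [X in _ * X <= _]ger0_norm; last by rewrite mulr_ge0// ltW.
    apply: (@le_trans _ _ (frL F * (e * b ^+ n) * (e * (u t ^+ 2 + v t ^+ 2)))).
      by rewrite ler_wpM2r// mulr_ge0// ltW.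
    have -> : frL F * (e * b ^+ n) * (e * (u t ^+ 2 + v t ^+ 2)) =
      frL F * b ^+ n * (e ^+ 2 * u t ^+ 2 + (e * v t) ^+ 2) by ring.
    rewrite ler_wpM2l//; first by rewrite mulr_ge0 ?(ltW bn)// ltW// frL_gt0.
    by rewrite lerD2r ler_piMl ?sqr_ge0// exprn_ile1// ltW.
  clear - m1 m2; lra.
(* The frame may turn fast, but its net rotation is bounded: [S] stays within [frB F] of [phi]. *)
have SS : `|S 1 - S 0| <= frC F + 2 * frB F.
  have h0 := nS 0; have h1 := nS 1.
  have h2 : `|phi 1 - phi 0| <= frC F * a ^+ 0.
    by apply: fr_osc_cell; rewrite expr0 invr1 subr0 normr1.
  have Be : frB F * e <= frB F by rewrite ler_piMr// ltW.
  clear - h0 h1 h2 Be.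
  move: h0 h1 h2; rewrite expr0 mulr1 !ler_norml => /andP[? ?] /andP[? ?] /andP[? ?].
  by apply/andP; split; lra.
move: close heta0 rate SS; rewrite heta th0 subr0 mulr1; clear.
rewrite !ltr_norml !ler_norml => /andP[? ?] /andP[? ?] /andP[? ?] /andP[? ?].
by apply/andP; split; lra.
Qed.

End Angles.

(** * Rotation of the angle from node to node *)

Lemma sin_lower {R : realType} (eps u : R) : 0 < eps -> eps <= 1 -> eps <= u -> u <= pi - eps ->
  eps / 2 <= sin u.
Proof.
move=> e0 e1; have p0 := pi_gt0 R.
have key v : eps <= v -> v <= pi / 2 -> eps / 2 <= sin v.
  move=> ev vp; apply: (@le_trans _ _ (sin eps)); first by apply: sin_ge_half; rewrite ltW.
  move: ev; rewrite le_eqVlt => /predU1P[<-//|ev].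
  by apply/ltW; rewrite ltr_sin// in_itv /=; apply/andP; split; lra.
move=> eu up; have [h|h] := leP u (pi / 2); first exact: key.
have -> : sin u = sin (pi - u) by rewrite sinB sinpi cospi; ring.
by apply: key; lra.
Qed.

(* While [th - phi] stays away from the stationary angles, [- cot (th - c)] grows at speed
   at least [r / 16], and it takes values in [[- 2 / eps, 2 / eps]]. *)
Lemma crossing {R : realType} (phi th : R -> R) (r eps c t0 t1 : R) :
  0 < r -> 0 < eps -> eps <= 1 / 2 -> t0 <= t1 ->
  smooth t0 t1 th (fun t => r * cos (th t - phi t) ^+ 2) ->
  (forall t, t0 <= t <= t1 -> `|phi t + pi / 2 - c| <= eps / 4) ->
  64 < r * (t1 - t0) * eps -> c + eps <= th t0 -> c + pi - eps <= th t1.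
Proof.
move=> r0 e0 e1 t01 sth hphi hr start; rewrite leNgt; apply/negP => stop.
have mono s t : t0 <= s -> s <= t -> t <= t1 -> th s <= th t.
  move=> h1 h2 h3; have := smooth_le h2 (smooth_sub h1 h3 sth); apply => x _.
  by rewrite mulr_ge0 ?sqr_ge0 ?(ltW r0).
have rng t : t0 <= t <= t1 -> eps <= th t - c <= pi - eps.
  move=> /andP[h1 h2]; have := mono t0 t (lexx _) h1 h2; have := mono t t1 h1 h2 (lexx _).
  by move=> ? ?; apply/andP; split; lra.
have sinl t : t0 <= t <= t1 -> eps / 2 <= sin (th t - c).
  by move=> /rng /andP[? ?]; apply: sin_lower => //; lra.
have sin0 t : t0 <= t <= t1 -> sin (th t - c) != 0.
  by move=> /sinl h; rewrite gt_eqF//; lra.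
have su := smooth_add sth (smooth_opp (smooth_cst t0 t1 c)).
have sy := smooth_opp (smooth_mul (smooth_cos su) (smooth_inv sin0 (smooth_sin su))).
have sl := smooth_opp (smooth_mul (smooth_cst t0 t1 (r / 16)) (smooth_id t0 t1)).
have := smooth_le t01 (smooth_add sy sl) => h.
have {}h : - (cos (th t0 - c) * (sin (th t0 - c))^-1) - r / 16 * t0 <=
    - (cos (th t1 - c) * (sin (th t1 - c))^-1) - r / 16 * t1.
  apply: h => t /andP[h1 h2].
  have tt : t0 <= t <= t1 by rewrite !ltW.
  have sl1 := sinl t tt; have sn := sin0 t tt; have hd := hphi t tt.
  pose del := phi t + pi / 2 - c; pose u := th t - c.
  have sl2 : eps / 2 <= sin u by exact: sl1.
  have cE : cos (th t - phi t) ^+ 2 = sin (u - del) ^+ 2.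
    have -> : th t - phi t = u - del + pi / 2 by rewrite /u /del; ring.
    by rewrite cosDpihalf sqrrN.
  have d1 : sin del ^+ 2 <= (eps / 4) ^+ 2.
    rewrite -[leLHS]real_normK ?num_real// lerXn2r ?nnegrE//; first by rewrite divr_ge0// ltW.
    exact: le_trans (abs_sin_le _) hd.
  have d2 : 3 / 4 <= cos del.
    have := cos_ge_quad del.
    have : del ^+ 2 <= (eps / 4) ^+ 2.
      by rewrite -[leLHS]real_normK ?num_real// lerXn2r ?nnegrE// divr_ge0// ltW.
    nra.
  have d3 : `|cos u * sin del| <= eps / 4.
    rewrite normrM -[leRHS]mul1r ler_pM ?cos_max//.
    exact: le_trans (abs_sin_le _) hd.
  (* [cos del >= 3 / 4] and [|cos u sin del| <= eps / 4 <= sin u / 2], which leaves [3 / 4 - 1 / 2];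
     the square of this factor is the [1 / 16] in the speed. *)
  have low : sin u / 4 <= sin (u - del).
    rewrite sinB; move: d3; rewrite ler_norml => /andP[_ d3].
    have : sin u * (3 / 4) <= sin u * cos del by rewrite ler_wpM2l//; lra.
    lra.
  have low2 : (sin u / 4) ^+ 2 <= cos (th t - phi t) ^+ 2.
    rewrite cE lerXn2r ?nnegrE//; first lra.
    by apply: le_trans low; lra.
  rewrite -/u in sn *.
  set g := cos (th t - phi t) ^+ 2 in low2 *.
  have -> : - (- sin u * (r * g - 0) * (sin u)^-1 + cos u * (- (cos u * (r * g - 0)) / sin u ^+ 2)) -
      (0 * t + r / 16 * 1) = r * g * (cos u ^+ 2 + sin u ^+ 2) / sin u ^+ 2 - r / 16.
    by field.
  rewrite cos2Dsin2 mulr1 subr_ge0 ler_pdivlMr ?exprn_gt0//; last lra.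
  have : r * (sin u / 4) ^+ 2 <= r * g by rewrite ler_wpM2l ?(ltW r0).
  lra.
have bd t : t0 <= t <= t1 -> `|cos (th t - c) * (sin (th t - c))^-1| <= 2 / eps.
  move=> tt; have sl1 := sinl t tt.
  have sp : 0 < sin (th t - c) by lra.
  rewrite normrM -[leRHS]mul1r ler_pM ?cos_max//.
  have -> : 2 / eps = (eps / 2)^-1 by field; rewrite gt_eqF.
  by rewrite gtr0_norm ?invr_gt0// lef_pV2 ?posrE// divr_gt0.
have /bd : t0 <= t0 <= t1 by rewrite lexx.
have /bd : t0 <= t1 <= t1 by rewrite lexx t01.
rewrite !ler_norml => /andP[? ?] /andP[? ?].
(* Two cotangents of size at most [2 / eps] differ by at most [4 / eps]: hence the threshold
   [64 = 16 * 4]. *)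
have : r / 16 * (t1 - t0) <= 4 / eps by lra.
rewrite ler_pdivlMr//; lra.
Qed.

Lemma cos_sqr_shift {R : realType} (x : R) m : cos (x + m%:R * pi) ^+ 2 = cos x ^+ 2.
Proof.
elim: m => [|m IH]; first by rewrite mul0r addr0.
by rewrite -natr1 mulrDl mul1r addrA cosDpi sqrrN.
Qed.

Section Rotation.
Context {R : realType} {a : R} {beta : nat} {phi : R -> R} (F : fractal a beta phi).
Local Notation b := (beta%:R : R).
Local Notation rho := (b / a).
Local Notation node n k := (k%:R / b ^+ n).

(** Makes [r w eps = K D E / 2 = 128] in the windows below, at every level: twice the threshold of
    [crossing]. *)
Definition rotation_const : R := 256 / (frD F * frE F).
Local Notation K := rotation_const.

Lemma rotation_const_gt0 : 0 < K.
Proof. exact: divr_gt0 (ltr0Sn _ _) (mulr_gt0 (frD_gt0 F) (frE_gt0 F)). Qed.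

Section Level.
Variables (n : nat) (th : R -> R).
Hypothesis (small : (frC F + frE F) * a ^+ n <= 1).
Hypothesis (ang : angle (phi := phi) (K * rho ^+ n) th).

(** A drop of [phi] over a cell is at least [2 eps], which takes an angle from [eps] below a
    stationary one to [eps] above it; and [eps / 4] is the oscillation of [phi] allowed over the
    window [w]. *)
Let eps := frE F * a ^+ n / 2.
Let w := frD F / b ^+ n.
Let r := K * rho ^+ n.

Let an_gt0 : 0 < a ^+ n. Proof. exact: (fr_an_gt0 F). Qed.
Let bn_gt0 : 0 < b ^+ n. Proof. exact: (fr_bn_gt0 F). Qed.
Let r_gt0 : 0 < r.
Proof.
apply: mulr_gt0; first exact: rotation_const_gt0.
by rewrite exprn_gt0// (lt_trans ltr01)// (fr_rho_gt1 F).
Qed.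
Let eps_gt0 : 0 < eps. Proof. by rewrite divr_gt0// mulr_gt0// frE_gt0. Qed.
Let eps_small : frC F * a ^+ n + 2 * eps <= 1.
Proof. by rewrite /eps; move: small; lra. Qed.
Let C_gt0 : 0 < frC F * a ^+ n. Proof. by rewrite mulr_gt0// frC_gt0. Qed.
Let w_gt0 : 0 < w. Proof. by rewrite divr_gt0// frD_gt0. Qed.
Let w_le : w <= 1 / 2 * (b ^+ n)^-1.
Proof. by rewrite ler_wpM2r ?frD_le// invr_ge0 ltW. Qed.

Let th_mono s t : 0 <= s -> s <= t -> t <= 1 -> th s <= th t.
Proof.
move=> h1 h2 h3; have := smooth_le h2 (smooth_sub h1 h3 ang.2); apply => x _.
by rewrite mulr_ge0 ?sqr_ge0 ?(ltW r_gt0).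
Qed.

Let node_ge0 k : 0 <= node n k :> R. Proof. by rewrite divr_ge0// ltW. Qed.

Let node_w k : (k < beta ^ n)%N -> node n k + w <= 1.
Proof.
move=> kb; have := @node_step R beta n k.
have : node n k.+1 <= 1 by rewrite ler_pdivrMr// mul1r -natrX ler_nat.
have : 0 < (b ^+ n)^-1 by rewrite invr_gt0.
by move: w_le; lra.
Qed.

(** The equation sees the angle only modulo [pi], so [crossing] applies after a shift by an integer
    multiple of [pi], written as a difference of two naturals. *)
Let window_cross k (m1 m2 : nat) : (k < beta ^ n)%N ->
  phi (node n k) + pi / 2 + m1%:R * pi - m2%:R * pi + eps <= th (node n k) ->
  phi (node n k) + pi / 2 + m1%:R * pi - m2%:R * pi + pi - eps <= th (node n k + w).
Proof.
move=> kb start.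
have s1 := smooth_sub (node_ge0 k) (node_w kb) ang.2.
have s2 := smooth_add s1 (smooth_cst (node n k) (node n k + w) (m2%:R * pi - m1%:R * pi)).
have s3 : smooth (node n k) (node n k + w) (fun t => th t + (m2%:R * pi - m1%:R * pi))
    (fun t => r * cos (th t + (m2%:R * pi - m1%:R * pi) - phi t) ^+ 2).
  apply: smooth_eq s2 => t _; rewrite addr0; congr (_ * _).
  rewrite -[RHS](cos_sqr_shift _ m1) -(cos_sqr_shift (th t - phi t) m2).
  by congr (cos _ ^+ 2); ring.
have := @crossing R phi _ r eps (phi (node n k) + pi / 2) _ _ r_gt0 eps_gt0 _ _ s3.
move=> h; have : phi (node n k) + pi / 2 + pi - eps <= th (node n k + w) + (m2%:R * pi - m1%:R * pi).
  apply: h; [by move: eps_small C_gt0; lra|by rewrite lerDl ltW| | |lra].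
    move=> t /andP[t1 t2]; rewrite (_ : _ - _ = phi t - phi (node n k)); last by ring.
    rewrite /eps (_ : _ / 2 / 4 = frE F / 8 * a ^+ n); last by field.
    by apply: (fr_win (f := F)); rewrite ger0_norm -/w; lra.
  rewrite addrC addKr.
  have -> : r * w * eps = 128.
    rewrite /r /w /eps /rotation_const expr_div_n; field.
    by rewrite (lt0r_neq0 bn_gt0) (lt0r_neq0 an_gt0) (lt0r_neq0 (frE_gt0 F)) (lt0r_neq0 (frD_gt0 F)).
  lra.
lra.
Qed.

(** After the window at an even node the angle is at most [eps] below a stationary one. By the next
    node [phi] has dropped by [2 eps], so the angle is [eps] above and crosses to the following one.
    On the next cell [phi] rises by at most [C a ^ n], and [C a ^ n + 2 eps <= 1 < pi] still leaves
    the angle above the preceding stationary one, from which it crosses again. The offset [m0] puts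
    the initial angle above the first stationary one. *)
Lemma rotation_steps (m0 j : nat) : phi 0 + 1 <= m0%:R * pi -> (j.*2 < beta ^ n)%N ->
  phi (node n j.*2) + pi / 2 + j.+1%:R * pi - m0%:R * pi - eps <= th (node n j.*2 + w).
Proof.
move=> hm0; have pi2 := pi_ge2 R.
have step k : node n k + w <= node n k.+1.
  by have := @node_step R beta n k; have : 0 < (b ^+ n)^-1; [rewrite invr_gt0|move: w_le; lra].
elim: j => [|j IH] jb.
  have := @window_cross 0 0 m0 jb; rewrite !mul0r ang.1 => h.
  rewrite mul1r.
  have := h ltac:(by move: eps_small C_gt0; lra); lra.
rewrite doubleS in jb *.
have jb1 : (j.*2.+1 < beta ^ n)%N by exact: ltnW.
have jb0 : (j.*2 < beta ^ n)%N by exact: ltnW.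
have nle k : (k < beta ^ n)%N -> node n k <= 1.
  by move=> kb; rewrite ler_pdivrMr// mul1r -natrX ler_nat ltnW.
have h0 := IH jb0.
have a0 := fr_alt F n j.*2; rewrite odd_double expr0 mul1r in a0.
have m1 : th (node n j.*2 + w) <= th (node n j.*2.+1).
  by apply: th_mono; rewrite ?step ?nle// addr_ge0 ?node_ge0// ltW.
have h1 := @window_cross j.*2.+1 j.+1 m0 jb1.
have {}h1 := h1 ltac:(by move: a0 h0 m1; rewrite /eps; lra).
have m2 : th (node n j.*2.+1 + w) <= th (node n j.*2.+2).
  by apply: th_mono; rewrite ?step ?nle// addr_ge0 ?node_ge0// ltW.
have o2 : `|phi (node n j.*2.+2) - phi (node n j.*2.+1)| <= frC F * a ^+ n.
  by apply: fr_osc_cell; rewrite (@node_step R beta n j.*2.+1) gtr0_norm ?invr_gt0.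
move: o2; rewrite ler_norml => /andP[_ o2].
have h2 := @window_cross j.*2.+2 j.+1 m0 jb.
have {}h2 := h2 ltac:(by move: h1 m2 o2 eps_small; lra).
have e : j.+2%:R * pi = j.+1%:R * pi + pi :> R by rewrite -[j.+2%:R]natr1 mulrDl mul1r.
by rewrite e; lra.
Qed.

End Level.

Lemma rotation_lower : exists M : R, exists n1 : nat, forall n th, (n1 <= n)%N ->
  angle (phi := phi) (K * rho ^+ n) th -> (beta ^ n)./2%:R * pi - M <= th 1.
Proof.
have CE : 0 < frC F + frE F by rewrite addr_gt0 ?frC_gt0 ?frE_gt0.
have [n1 hn1] : exists n1, a ^+ n1 <= (frC F + frE F)^-1 by apply: (fr_small F); rewrite invr_gt0.
have pi2 := pi_ge2 R.
pose m0 := Num.bound (`|phi 0| + 1).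
have hm0 : phi 0 + 1 <= m0%:R * pi.
  have : `|phi 0| + 1 < m0%:R by apply: archi_boundP; rewrite addr_ge0.
  have : m0%:R * 1 <= m0%:R * pi :> R by rewrite ler_wpM2l//; lra.
  by have := ler_norm (phi 0); lra.
(* The constant collects the offset, the range of [phi] and [eps]. Requiring [n >= 1] makes
   [beta ^ n] even, so that [beta ^ n - 2] is the last even node opening a cell. *)
exists (m0%:R * pi + `|phi 0| + frC F + 1), n1.+1 => n th n1n ang.
have an1 : a ^+ n <= a ^+ n1.
  by rewrite ler_wiXn2l ?(ltW (fr_a_gt0 F)) ?(ltW (fr_a_lt1 F))// ltnW.
have small : (frC F + frE F) * a ^+ n <= 1.
  by rewrite mulrC -ler_pdivlMr// div1r (le_trans an1).
have b2 : (1 < beta)%N by rewrite -(ltr1n R) (fr_b_gt1 F).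
have ev : ~~ odd (beta ^ n).
  by rewrite oddX negb_or -lt0n (leq_trans _ n1n)//= (fr_beta F).
have bn2 : ((beta ^ n)./2.*2 = beta ^ n)%N by rewrite even_halfK.
have bnp : (1 < beta ^ n)%N by rewrite -(exp1n n) ltn_exp2r// (leq_trans _ n1n).
have [j jE] : exists j, (beta ^ n)./2 = j.+1.
  by exists (beta ^ n)./2.-1; rewrite prednK// half_gt0.
have jb : (j.*2 < beta ^ n)%N by rewrite -bn2 jE doubleS ltnS leqnSn.
have := rotation_steps small ang hm0 jb; rewrite -jE.
have bn := fr_bn_gt0 F n; have an := fr_an_gt0 F n.
have n0 : 0 <= node n j.*2 :> R by rewrite divr_ge0// ltW.
have n1' : node n j.*2.+1 <= 1 :> R by rewrite ler_pdivrMr// mul1r -natrX ler_nat.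
have st := @node_step R beta n j.*2.
have wle : frD F / b ^+ n <= 1 / 2 * (b ^+ n)^-1 by rewrite ler_wpM2r ?frD_le// invr_ge0 ltW.
have wge : 0 < frD F / b ^+ n by rewrite divr_gt0 ?frD_gt0.
have bi : 0 < (b ^+ n)^-1 by rewrite invr_gt0.
have top : th (node n j.*2 + frD F / b ^+ n) <= th 1.
  have h3 : node n j.*2 + frD F / b ^+ n <= 1 by lra.
  have h1 : 0 <= node n j.*2 + frD F / b ^+ n by lra.
  have := smooth_le h3 (smooth_sub h1 (lexx 1) ang.2); apply => x _.
  rewrite mulr_ge0 ?sqr_ge0// mulr_ge0 ?(ltW rotation_const_gt0)//.
  by rewrite exprn_ge0// ltW// (lt_trans ltr01)// (fr_rho_gt1 F).
have osc : `|phi (node n j.*2) - phi 0| <= frC F * a ^+ 0.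
  by apply: fr_osc_cell; rewrite expr0 invr1 subr0 ger0_norm//; lra.
move: osc; rewrite expr0 mulr1 ler_norml => /andP[osc _].
have := lerNnormlW (lexx `|phi 0|) => np.
have e1 : frE F * a ^+ n <= 1.
  by have : 0 < frC F * a ^+ n; [rewrite mulr_gt0// frC_gt0|lra].
lra.
Qed.

End Rotation.

(** * Counting eigenvalues *)

Lemma wcont_lipschitz {R : realType} (l r M : R) (f : R -> R) : 0 <= M ->
  (forall x y, l <= x -> x <= y -> y <= r -> `|f y - f x| <= M * (y - x)) -> wcont l r f.
Proof.
move=> M0 lip; apply/subspace_continuousP => x /=; rewrite in_itv/= => /andP[lx xr].
have M1 : 0 < M + 1 by lra.
apply/cvgrPdist_le => e e0; exists (e / (M + 1)); first by rewrite /= divr_gt0.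
move=> y /= xy; rewrite in_itv/= => /andP[ly yr].
have le : M * `|x - y| <= e.
  move: (ltW xy); rewrite ler_pdivlMr// => h.
  have := normr_ge0 (x - y); lra.
apply: le_trans le; have [h|h] := leP x y.
  by rewrite distrC (distrC x) (ger0_norm (x := y - x)) ?subr_ge0//; exact: lip.
have h' := ltW h; rewrite [X in M * X]ger0_norm ?subr_ge0//; exact: (lip y x).
Qed.

Lemma sin_zeros_apart {R : realType} (x y : R) : sin x = 0 -> sin y = 0 -> x < y -> pi <= y - x.
Proof.
move=> sx sy xy; rewrite leNgt; apply/negP => h.
have : 0 < sin (y - x) by apply: sin_gt0_pi; rewrite subr_gt0 xy.
by rewrite sinB sx sy mul0r mulr0 subrr ltxx.
Qed.

Lemma sin_natpi {R : realType} (m : nat) : sin (m%:R * pi) = 0 :> R.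
Proof.
elim: m => [|m IH]; first by rewrite mul0r sin0.
by rewrite -natr1 mulrDl mul1r sinDpi IH oppr0.
Qed.

Lemma mulJHv {R : realType} (phi : R -> R) (v : 'cV[R]_2) t :
  let u := v ord0 0 * cos (phi t) + v ord_max 0 * sin (phi t) in
  [/\ (Jmx R *m Hamiltonian phi t *m v) ord0 0 = - (sin (phi t) * u),
      (Jmx R *m Hamiltonian phi t *m v) ord_max 0 = cos (phi t) * u &
      (v^T *m Hamiltonian phi t *m v) 0 0 = u ^+ 2].
Proof.
have [h00 h01 h10 h11] := Hamiltonian_entries phi t.
have two m (M : 'M[R]_(m, 2)) (N : 'cV[R]_2) i : (M *m N) i 0 = M i ord0 * N ord0 0 + M i ord_max * N ord_max 0.
  by rewrite mxE !big_ord_recl big_ord0 addr0 ord2_lift.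
have twoH m (M : 'M[R]_(m, 2)) i j : (M *m Hamiltonian phi t) i j =
    M i ord0 * Hamiltonian phi t ord0 j + M i ord_max * Hamiltonian phi t ord_max j.
  by rewrite mxE !big_ord_recl big_ord0 addr0 ord2_lift.
by rewrite !two !twoH h00 h01 h10 h11 !mxE /=; split; ring.
Qed.

Section Eigenvalues.
Context {R : realType} {a : R} {beta : nat} {phi : R -> R} (F : fractal a beta phi).
Local Notation b := (beta%:R : R).
Local Notation rho := (b / a).
Local Notation H := (Hamiltonian phi).

Let ccos l r : wcont l r (fun t => cos (phi t)).
Proof. exact/wcont_continuous/(cos_phi_continuous F). Qed.
Let csin l r : wcont l r (fun t => sin (phi t)).
Proof. exact/wcont_continuous/(sin_phi_continuous F). Qed.

Lemma real_solution_wronskian lam f1 f2 g1 g2 :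
  real_solution (phi := phi) lam f1 f2 -> real_solution (phi := phi) lam g1 g2 ->
  f1 0 * g2 0 - f2 0 * g1 0 = f1 1 * g2 1 - f2 1 * g1 1.
Proof.
move=> [s1 s2] [u1 u2].
apply: (smooth_const ler01 (smooth_add (smooth_mul s1 u2) (smooth_opp (smooth_mul s2 u1)))) => t _.
by ring.
Qed.

Lemma eigenfunction_real lam (f : R -> 'cV[R]_2) :
  (forall i, wcont 0 1 (fun t => f t i 0)) ->
  ((forall t, 0 <= t <= 1 -> f t = f 0 + lam *: mxint 0 t (fun s => Jmx R *m H s *m f s)) <->
   real_solution (phi := phi) lam (fun t => f t ord0 0) (fun t => f t ord_max 0)).
Proof.
move=> cf.
have cs : wcont 0 1 (fun t => f t ord0 0 * cos (phi t) + f t ord_max 0 * sin (phi t)).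
  by apply: wcont_add; apply: wcont_mul.
have c0 : wcont 0 1 (fun t => - (sin (phi t) * (f t ord0 0 * cos (phi t) + f t ord_max 0 * sin (phi t)))).
  by apply: wcont_opp; exact: wcont_mul.
have c1 : wcont 0 1 (fun t => cos (phi t) * (f t ord0 0 * cos (phi t) + f t ord_max 0 * sin (phi t))).
  exact: wcont_mul.
have e0 t : mxint 0 t (fun s => Jmx R *m H s *m f s) ord0 0 =
    rint 0 t (fun t => - (sin (phi t) * (f t ord0 0 * cos (phi t) + f t ord_max 0 * sin (phi t)))).
  by rewrite mxE; apply: rint_ext => x _; case: (mulJHv phi (f x) x).
have e1 t : mxint 0 t (fun s => Jmx R *m H s *m f s) ord_max 0 =
    rint 0 t (fun t => cos (phi t) * (f t ord0 0 * cos (phi t) + f t ord_max 0 * sin (phi t))).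
  by rewrite mxE; apply: rint_ext => x _; case: (mulJHv phi (f x) x).
split=> [hf|[s1 s2] t /andP[t0 t1]].
  split.
    apply: smooth_eq (smooth_of_integral (k := f 0 ord0 0) (c := lam) c0 _) => [t _|t t01]; first by ring.
    by rewrite {1}(hf t t01) -e0 mxE [X in _ + X]mxE.
  apply: smooth_eq (smooth_of_integral (k := f 0 ord_max 0) (c := lam) c1 _) => [t _|t t01]; first by ring.
  by rewrite {1}(hf t t01) -e1 mxE [X in _ + X]mxE.
apply/matrixP => i j; rewrite ord1 mxE [X in _ + X]mxE.
have d0 : wcont 0 t (fun t => lam * - (sin (phi t) * (f t ord0 0 * cos (phi t) + f t ord_max 0 * sin (phi t)))).
  by apply: wcont_mul; [exact: wcont_cst|exact: wcont_sub (lexx _) t1 c0].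
have d1 : wcont 0 t (fun t => lam * (cos (phi t) * (f t ord0 0 * cos (phi t) + f t ord_max 0 * sin (phi t)))).
  by apply: wcont_mul; [exact: wcont_cst|exact: wcont_sub (lexx _) t1 c1].
have r1 : smooth 0 t (fun t => f t ord0 0) (fun t => lam * - (sin (phi t) * (f t ord0 0 * cos (phi t) + f t ord_max 0 * sin (phi t)))).
  by apply: smooth_eq (smooth_sub (lexx _) t1 s1) => x _; ring.
have r2 : smooth 0 t (fun t => f t ord_max 0) (fun t => lam * (cos (phi t) * (f t ord0 0 * cos (phi t) + f t ord_max 0 * sin (phi t)))).
  by apply: smooth_eq (smooth_sub (lexx _) t1 s2) => x _; ring.
have i2 : i = ord0 \/ i = ord_max.
  by case: i => [[|[|//]] hi]; [left|right]; exact: val_inj.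
case: i2 => ->.
  rewrite e0 -rint_scale; last exact: wcont_sub (lexx _) t1 c0.
  by rewrite (rint_eq t0 d0 r1) addrC subrK.
rewrite e1 -rint_scale; last exact: wcont_sub (lexx _) t1 c1.
by rewrite (rint_eq t0 d1 r2) addrC subrK.
Qed.

Section Fundamental.
Variables (Wr Wi : R -> R -> R -> 'M[R]_2).
Hypothesis hW : is_fundamental_solution H Wr Wi.

(** The second row of [W] at a real parameter, the solution starting at [(0, 1)]. *)
Let f1 lam t := Wr lam 0 t ord_max ord0.
Let f2 lam t := Wr lam 0 t ord_max ord_max.

Let fsol lam : real_solution (phi := phi) lam (f1 lam) (f2 lam).
Proof.
case: (fundamental_row (fr_continuous F) lam 0 ord_max hW) => s1 s2 _ _; split.
  by apply: smooth_eq s1 => t _; rewrite /f1 /f2; ring.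
by apply: smooth_eq s2 => t _; rewrite /f1 /f2; ring.
Qed.

Let f1_0 lam : f1 lam 0 = 0.
Proof. by have [h _] := @fundamental_init R phi Wr Wi lam 0 ord_max ord0 hW; rewrite /f1 h. Qed.
Let f2_0 lam : f2 lam 0 = 1.
Proof. by have [h _] := @fundamental_init R phi Wr Wi lam 0 ord_max ord_max hW; rewrite /f2 h eqxx. Qed.

(** An eigenfunction [g] has [g1 0 = 0], so its constant Wronskian with the second row of [W]
    vanishes; at [1], where [g2 1 = 0], this reads [f2 1 * g1 1 = 0]. If [f2 1] were nonzero, [g]
    would vanish at [1], hence everywhere. Conversely, when [f2 1 = 0] the row itself is an
    eigenfunction, of positive norm by [angle_int_gt0]. *)
Lemma eigen_angle : exists Th : R -> R -> R,
  [/\ forall lam, angle (phi := phi) lam (Th lam),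
      forall lam, is_eigenvalue H lam <-> sin (Th lam 1) = 0 &
      forall lam n, `|lam| <= rho ^+ n.+1 ->
        `|Th lam 1 - pi / 2| <= angle_rate F * b ^+ n + pi + frC F + 2 * frB F].
Proof.
have ex lam : exists th, angle (phi := phi) lam th /\ forall t, 0 <= t <= 1 -> exists2 r, 0 < r &
    f1 lam t = r * cos (th t) /\ f2 lam t = r * sin (th t).
  by have [th h1 h2] := angle_exists F (fsol lam) (f1_0 lam) (f2_0 lam); exists th.
have [Th hTh] := choice ex.
exists Th; split=> [lam|lam|lam n hl]; [by case: (hTh lam)| |]; last first.
  by have [h1 h2] := hTh lam; apply: (angle_bound F (fsol lam) h1 h2 hl).
have [ang pol] := hTh lam.
have t1 : 0 <= (1 : R) <= 1 by rewrite lexx ler01.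
have t0 : 0 <= (0 : R) <= 1 by rewrite lexx ler01.
have [r r0 [p1 p2]] := pol 1 t1.
have key : sin (Th lam 1) = 0 <-> f2 lam 1 = 0.
  rewrite p2; split=> [->|/eqP]; first by rewrite mulr0.
  by rewrite mulf_eq0 gt_eqF//= => /eqP.
rewrite key; split.
  move=> [f [cf [hf [g00 [g11 pos]]]]].
  have /(eigenfunction_real lam cf) gsol := hf.
  have w := real_solution_wronskian (fsol lam) gsol.
  rewrite f1_0 f2_0 mul0r mul1r sub0r g00 oppr0 g11 mulr0 sub0r in w.
  have [//|fn] := eqVneq (f2 lam 1) 0.
  have g01 : f 1 ord0 0 = 0.
    by move/eqP: w; rewrite eq_sym oppr_eq0 mulf_eq0 (negbTE fn) => /eqP.
  have := real_solution_pinch gsol t1; rewrite g01 g11 expr0n addr0 => /andP[N0 _].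
  have {}N0 : f 0 ord0 0 ^+ 2 + f 0 ord_max 0 ^+ 2 <= 0.
    by rewrite -(pmulr_lle0 _ (expR_gt0 (- `|lam|))).
  have Nt t : 0 <= t <= 1 -> f t ord0 0 = 0 /\ f t ord_max 0 = 0.
    move=> /(real_solution_pinch gsol) /andP[_ h].
    have {}h : f t ord0 0 ^+ 2 + f t ord_max 0 ^+ 2 <= 0.
      by apply: (le_trans h); rewrite pmulr_lle0 ?expR_gt0.
    have := sqr_ge0 (f t ord0 0); have := sqr_ge0 (f t ord_max 0) => h1 h2.
    by split; apply/eqP; rewrite -sqrf_eq0 eq_le sqr_ge0 andbT; lra.
  move: pos; rewrite (@rint_ext R 0 1 _ (fun=> 0)).
    by rewrite rint_cst ?mul0r ?ltxx.
  move=> t /Nt [h1 h2]; have [_ _ ->] := mulJHv phi (f t) t.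
  by rewrite h1 h2 !mul0r addr0 expr0n.
move=> f21.
pose f t : 'cV[R]_2 := \col_(i < 2) (if i == ord0 then f1 lam t else f2 lam t).
have F0 t : f t ord0 0 = f1 lam t by rewrite mxE.
have F1 t : f t ord_max 0 = f2 lam t by rewrite mxE.
have [s1 s2] := fsol lam.
exists f; split.
  move=> i; have i2 : i = ord0 \/ i = ord_max.
    by case: i => [[|[|//]] hi]; [left|right]; exact: val_inj.
  case: i2 => ->.
    by have := s1.1; apply: wcont_ext => t _; rewrite F0.
  by have := s2.1; apply: wcont_ext => t _; rewrite F1.
have cf i : wcont 0 1 (fun t => f t i 0).
  have i2 : i = ord0 \/ i = ord_max.
    by case: i => [[|[|//]] hi]; [left|right]; exact: val_inj.
  case: i2 => ->.
    by have := s1.1; apply: wcont_ext => t _; rewrite F0.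
  by have := s2.1; apply: wcont_ext => t _; rewrite F1.
split.
  apply/(eigenfunction_real lam cf).
  have -> : (fun t => f t ord0 0) = f1 lam by apply: funext => t; rewrite F0.
  have -> : (fun t => f t ord_max 0) = f2 lam by apply: funext => t; rewrite F1.
  exact: fsol.
split; first by rewrite F0 f1_0.
split; first by rewrite F1.
rewrite (@rint_ext R 0 1 _ (fun t => (f1 lam t * cos (phi t) + f2 lam t * sin (phi t)) ^+ 2)); last first.
  by move=> t _; have [_ _ ->] := mulJHv phi (f t) t; rewrite F0 F1.
have pos := angle_int_gt0 F ang.
(* In polar form [f^T H f = q ^ 2 cos (th - phi) ^ 2], with [q ^ 2 >= exp (- |lam|)]. *)
apply: (@lt_le_trans _ _ (expR (- `|lam|) * rint 0 1 (fun t => cos (Th lam t - phi t) ^+ 2))).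
  by rewrite mulr_gt0 ?expR_gt0.
have cc := angle_cos_cont F ang.
rewrite -rint_scale//; apply: rint_le => //.
- by apply: wcont_mul => //; exact: wcont_cst.
- by apply: wcont_exp; apply: wcont_add; apply: wcont_mul => //; [exact: s1.1|exact: s2.1].
- move=> t t01; have [q q0 [q1 q2]] := pol t t01.
  have := real_solution_pinch (fsol lam) t01.
  rewrite f1_0 f2_0 expr0n add0r expr1n mul1r => /andP[h _].
  rewrite q1 q2 in h *.
  have -> : (q * cos (Th lam t) * cos (phi t) + q * sin (Th lam t) * sin (phi t)) ^+ 2 =
    q ^+ 2 * cos (Th lam t - phi t) ^+ 2 by rewrite cosB; ring.
  rewrite ler_wpM2r ?sqr_ge0//; apply: (le_trans h).
  by rewrite le_eqVlt; apply/orP; left; apply/eqP; rewrite -[RHS]mulr1 -(cos2Dsin2 (Th lam t)); ring.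
Qed.

Definition eigen_set r := [set lam : R | is_eigenvalue H lam /\ `|lam| < r].

(** The half-width of the range of the angle, plus 2 for rounding, in units of [b ^ n >= 1]. The
    full width is divided by [pi >= 2], so the half-width is enough. *)
Definition count_const : R := angle_rate F + pi + frC F + 2 * frB F + 2.

Lemma count_const_gt0 : 0 < count_const.
Proof.
have := pi_ge2 R; have := frC_gt0 F; have := frB_gt0 F; have := frL_gt0 F.
have : 0 <= 2 * (1 + frB F ^+ 2) * rho.
  rewrite mulr_ge0//; last by rewrite ltW// (lt_trans ltr01)// (fr_rho_gt1 F).
  by rewrite mulr_ge0// addr_ge0 ?sqr_ge0.
by rewrite /count_const /angle_rate; lra.
Qed.

(* The values of the angle at distinct eigenvalues differ by at least [pi]. *)
Lemma eigen_card r n : r <= rho ^+ n.+1 -> exists2 M : nat,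
  M%:R <= count_const * b ^+ n & (eigen_set r #<= `I_M)%card.
Proof.
move=> rn; have [Th [ang eig bd]] := eigen_angle.
have pi2 := pi_ge2 R; have bn := fr_bn_ge1 F n.
set Kb := angle_rate F * b ^+ n + pi + frC F + 2 * frB F in bd.
have C0 := frC_gt0 F; have B0 := frB_gt0 F.
have Kb0 : 0 <= Kb by have := bd 0 n; rewrite normr0 => h; apply: le_trans (h _) => //; rewrite exprn_ge0// ltW// (lt_trans ltr01)// (fr_rho_gt1 F).
(* The index of the interval of length [pi] containing the angle; the shift by [Kb] makes the
   argument nonnegative, so that truncation is a floor. *)
pose g lam := Num.truncn ((Th lam 1 + Kb) / pi).
have rng lam : eigen_set r lam -> 0 <= (Th lam 1 + Kb) / pi <= Kb + 1.
  move=> [_ hl]; have := bd lam n (le_trans (ltW hl) rn).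
  rewrite -/Kb ler_norml => /andP[h1 h2]; apply/andP; split; first by rewrite divr_ge0//; lra.
  rewrite ler_pdivrMr; last lra.
  have : 0 <= (pi - 2) * Kb by rewrite mulr_ge0//; lra.
  lra.
exists (Num.truncn (Kb + 1)).+1.
  have Kb1 : 0 <= Kb + 1 by lra.
  have /andP[h _] := truncn_itv Kb1; rewrite -natr1; apply: (@le_trans _ _ (Kb + 2)); first lra.
  have [q1 q2 q3] : [/\ pi <= pi * b ^+ n, frC F <= frC F * b ^+ n & frB F <= frB F * b ^+ n].
    by split; rewrite ler_peMr// ltW// pi_gt0.
  by rewrite /Kb /count_const; lra.
apply/pcard_leP/injfunPex; exists g.
  move=> lam hl /=; rewrite ltnS; apply: le_truncn.
  by have /andP[_] := rng lam hl.
move=> l1 l2 /set_mem h1 /set_mem h2 e.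
have sep x y : eigen_set r x -> eigen_set r y -> g x = g y -> x < y -> False.
  move=> hx hy exy xy.
  have lt := angle_lt F xy (ang x) (ang y).
  have := sin_zeros_apart ((eig x).1 hx.1) ((eig y).1 hy.1) lt.
  have /andP[x0 _] := rng x hx; have /andP[y0 _] := rng y hy.
  have /andP[x1 x2] := truncn_itv x0; have /andP[y1 y2] := truncn_itv y0.
  move: x1 x2 y1 y2; rewrite -/(g x) -/(g y) exy.
  have p0 : 0 < pi :> R by lra.
  rewrite !ler_pdivlMr// !ltr_pdivrMr// -natr1 => x1 x2 y1 y2; lra.
by have [/(sep _ _ h1 h2 e)|/(sep _ _ h2 h1 (esym e))|//] := ltgtP l1 l2.
Qed.

(** This is what gives [n_count] its meaning, since [fset_set] returns the empty set on infinite
    sets. *)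
Lemma eigen_finite r : finite_set (eigen_set r).
Proof.
have [n hn] := scale_exists (fr_rho_gt1 F) r.
have rn : r <= rho ^+ n.+1.
  by apply: (le_trans hn); rewrite ler_weXn2l// ltW// (fr_rho_gt1 F).
by have [M _ hM] := eigen_card rn; apply: card_le_finite hM _; exact: finite_II.
Qed.

Lemma n_count_upper r n : r <= rho ^+ n.+1 -> (n_count H r)%:R <= count_const * b ^+ n.
Proof.
move=> rn; have [M hM cM] := eigen_card rn.
by apply: le_trans hM; rewrite ler_nat; exact: geq_card_fset_set.
Qed.

(** [Th l 1] is continuous in [l], equals [pi / 2] at [0] and is at least [(beta ^ n / 2) pi - M] at
    [rr], so by the intermediate value theorem it takes every multiple of [pi] in between. The
    parameters found lie in [[0, rr]]; the factor 2 in the radius provides the strict inequality. *)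
Lemma n_count_lower : exists m1 n1 : nat, forall n, (n1 <= n)%N ->
  ((beta ^ n)./2 - m1 <= n_count H (2 * (rotation_const F * rho ^+ n)))%N.
Proof.
have [Th [ang eig _]] := eigen_angle.
have [M [n1 hM]] := rotation_lower F.
have pi2 := pi_ge2 R.
(* As [pi >= 1], giving up [m1 > |M|] multiples of [pi] compensates for [M]. *)
pose m1 := Num.bound `|M|; exists m1, n1 => n nn.
have hm1 : `|M| < m1%:R by apply: archi_boundP.
set rr := rotation_const F * rho ^+ n.
have rho0 : 0 < rho := lt_trans ltr01 (fr_rho_gt1 F).
have rr0 : 0 < rr by rewrite mulr_gt0 ?rotation_const_gt0 ?exprn_gt0.
have top := hM n (Th rr) nn (ang rr).
apply: leq_card_fset_set; first exact: eigen_finite.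
set N := (_ - m1)%N.
have Th0 : Th 0 1 = pi / 2.
  have [h0 s0] := ang 0; rewrite -h0; apply/esym/(smooth_const ler01 s0) => t _.
  by rewrite mul0r.
have cT : wcont 0 rr (fun l => Th l 1).
  apply: (@wcont_lipschitz R 0 rr (expR rr)); first exact: expR_ge0.
  move=> x y x0 xy yr.
  have [h1 [_ h2]] := angle_compare F xy (ang x) (ang y).
  rewrite ger0_norm ?subr_ge0; last by apply: h1; rewrite ler01 lexx.
  apply: (le_trans h2); rewrite mulrC ler_wpM2r ?subr_ge0// ler_expR ger0_norm//.
  exact: le_trans xy yr.
have ex k : exists l, (k < N)%N -> 0 <= l <= rr /\ Th l 1 = k.+1%:R * pi.
  have [kN|_] := ltnP k N; last by exists 0.
  have kpi : k.+1%:R * pi <= Th rr 1.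
    apply: le_trans top.
    have : k.+1%:R + m1%:R <= (beta ^ n)./2%:R :> R.
      by rewrite -natrD ler_nat addSn addnC -ltn_subRL.
    move=> h; have hM1 := ler_norm M.
    have pp : 0 <= pi :> R by lra.
    have := ler_wpM2r pp h; rewrite mulrDl.
    have : `|M| * 1 <= m1%:R * pi by apply: ler_pM => //; [exact: ltW|lra].
    lra.
  have pp : 0 <= pi :> R by lra.
  have k1 : 1 <= k.+1%:R :> R by rewrite ler1n.
  have lowk : pi / 2 <= k.+1%:R * pi :> R.
    by have := ler_wpM2r pp k1; lra.
  have between : Num.min (Th 0 1) (Th rr 1) <= k.+1%:R * pi <= Num.max (Th 0 1) (Th rr 1).
    by rewrite Th0 ge_min lowk/= le_max kpi orbT.
  have [l] := IVT (ltW rr0) cT between.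
  by rewrite in_itv/= => l01 e; exists l.
have [l hl] := choice ex.
apply/pcard_leP/injfunPex; exists l.
  move=> k /= kN; have [/andP[l0 l1] e] := hl k kN; split.
    by apply/(eig (l k)).2; rewrite e sin_natpi.
  rewrite ger0_norm//; lra.
move=> k1 k2 /set_mem/= h1 /set_mem/= h2 e.
have [_ e1] := hl _ h1; have [_ e2] := hl _ h2.
rewrite e e2 in e1; have p0 : pi != 0 :> R by rewrite gt_eqF//; lra.
move/(mulIf p0)/eqP: e1; rewrite eqr_nat => /eqP [].
by move=> ->.
Qed.

End Fundamental.
End Eigenvalues.

(** [1 / (1 + nu) = ln b / (ln b - ln a)], which is [ln b / ln rho]. *)
Lemma gap_exponent {R : realType} (a b : R) : 0 < a < 1 -> 1 < b ->
  let p := 1 / (1 + (- ln a / ln b)) in 0 <= p /\ (b / a) `^ p = b.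
Proof.
move=> /andP[a0 a1] b1 p.
have lb : 0 < ln b by rewrite ln_gt0.
have la : ln a < 0 by rewrite ln_lt0// a0.
have nu0 : 0 < - ln a / ln b by rewrite divr_gt0// oppr_gt0.
have b0 : 0 < b := lt_trans ltr01 b1.
split; first by rewrite divr_ge0//; lra.
rewrite /powR gt_eqF ?divr_gt0// ln_div ?posrE//.
have -> : p * (ln b - ln a) = ln b.
  rewrite /p; field.
  by rewrite gt_eqF ?andbT ?gt_eqF//; lra.
by rewrite lnK ?posrE.
Qed.

Unset Implicit Arguments. Set Strict Implicit. Set Printing Implicit Defensive.

Theorem theorem7p4 (R : realType) (alpha : R) (beta : nat) (c : R)
  (Wr Wi : R -> R -> R -> 'M[R]_2) (kappa : R -> nat) :
  0 < alpha < 1 -> ~~ odd beta -> 1 + pi / 2 < alpha * beta%:R -> 0 < c ->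
  let phi := weierstrass alpha beta in
  let H := Hamiltonian phi in
  let nu := - ln alpha / ln (beta%:R) in
  let p := 1 / (1 + nu) in
  is_fundamental_solution H Wr Wi ->
  (forall r, 0 < r -> kappa_spec H c r (kappa r)) ->
  (exists C1 C2 : R, 0 < C1 /\ 0 < C2 /\ forall r, 1 < r ->
     C1 * r `^ p <= ln (max_monodromy Wr Wi r) <= C2 * r `^ p) /\
  (exists C1 C2 : R, 0 < C1 /\ 0 < C2 /\ forall r, 1 < r ->
     C1 * r `^ p <= (kappa r)%:R <= C2 * r `^ p) /\
  (forall r : R, finite_set [set lam : R | is_eigenvalue H lam /\ `|lam| < r]) /\
  (exists C : R, exists R0 : R, forall r, R0 < r ->
      (n_count H r)%:R <= C * r `^ p) /\
  (exists c0 : R, 0 < c0 /\ forall R0 : R, exists r, R0 < r /\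
      c0 * r `^ p <= (n_count H r)%:R).
Proof.
move=> a01 evb hab c0 phi H nu p hW hk.
have F : fractal alpha beta phi := weierstrass_fractal a01 evb hab.
have b1 := fr_b_gt1 F; have rho1 := fr_rho_gt1 F.
have [p0 rp] : 0 <= p /\ (beta%:R / alpha) `^ p = beta%:R := gap_exponent a01 b1.
split; first exact: (max_monodromy_asymp F p0 rp hW).
split; first exact: (kappa_asymp F c0 p0 rp hk).
split; first exact: (eigen_finite F hW).
split.
  exists (count_const F), 1 => r r1.
  have [n /andP[n1 n2]] := scale_between rho1 (ltW r1).
  apply: (le_trans (n_count_upper F hW n2)).
  rewrite ler_wpM2l ?(ltW (count_const_gt0 F))// -(scale_powR rho1 b1 rp).
  by apply: powR_scale_le => //; rewrite exprn_ge0// ltW// (lt_trans ltr01).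
have [m1 [n1 low]] := n_count_lower F hW.
have K0 := rotation_const_gt0 F.
have Kp : 0 < (2 * rotation_const F) `^ p by rewrite powR_gt0// mulr_gt0.
(* At [r = 2 K rho ^ n] the power of [r] is [(2 K) ^ p b ^ n], and [b ^ n / 2 - m1 >= b ^ n / 4]
   once [4 m1 <= b ^ n]. *)
exists (1 / (4 * (2 * rotation_const F) `^ p)); split; first by rewrite divr_gt0// mulr_gt0.
move=> R0.
have [n2 hn2] := scale_exists b1 (4 * m1%:R).
have [n3 hn3] := scale_exists rho1 (`|R0| / (2 * rotation_const F) + 1).
(* This level passes the threshold of [n_count_lower], is positive so that [beta ^ n] is even,
   satisfies [4 m1 <= b ^ n], and makes the radius exceed [R0]. *)
pose n := maxn n1.+1 (maxn n2 n3).
have n1n : (n1 < n)%N by rewrite leq_maxl.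
have n2n : (n2 <= n)%N by rewrite /n maxnCA leq_maxl.
have n3n : (n3 <= n)%N by rewrite /n maxnA leq_maxr.
have {}hn2 : 4 * m1%:R <= beta%:R ^+ n :> R.
  by apply: (le_trans hn2); rewrite ler_weXn2l// ltW.
have {}hn3 : `|R0| / (2 * rotation_const F) + 1 <= (beta%:R / alpha) ^+ n.
  by apply: (le_trans hn3); rewrite ler_weXn2l// ltW.
set rr := rotation_const F * (beta%:R / alpha) ^+ n.
exists (2 * rr); split.
  apply: (le_lt_trans (ler_norm R0)).
  have : `|R0| / (2 * rotation_const F) < (beta%:R / alpha) ^+ n by lra.
  have -> : 2 * rr = (beta%:R / alpha) ^+ n * (2 * rotation_const F) by rewrite /rr; ring.
  by rewrite ltr_pdivrMr// mulr_gt0.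
have rn0 : 0 <= (beta%:R / alpha) ^+ n by rewrite exprn_ge0// ltW// (lt_trans ltr01).
have -> : (2 * rr) `^ p = (2 * rotation_const F) `^ p * beta%:R ^+ n.
  have K2 : 0 <= 2 * rotation_const F by rewrite mulr_ge0// ltW.
  by rewrite /rr mulrA (powRM _ K2 rn0) (scale_powR rho1 b1 rp).
have h := low n (ltnW n1n).
apply: (@le_trans _ _ ((beta ^ n)./2 - m1)%:R); last by rewrite ler_nat.
have ev : ~~ odd (beta ^ n).
  by rewrite oddX negb_or -lt0n (leq_trans _ n1n).
have half : (beta ^ n)./2%:R = beta%:R ^+ n / 2 :> R.
  by rewrite -natrX -{2}(even_halfK ev) -muln2 natrM; field.
have le1 : (m1 <= (beta ^ n)./2)%N.
  have m0 := ler0n R m1; rewrite -(ler_nat R) half; lra.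
rewrite (natrB _ le1) half.
have -> : 1 / (4 * (2 * rotation_const F) `^ p) * ((2 * rotation_const F) `^ p * beta%:R ^+ n) =
  beta%:R ^+ n / 4 by field; rewrite gt_eqF.
lra.
Qed.
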